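(* (Local asymptotic normality.) Let $\delta_0>-1$ and $h\in\mathbb{R}$, and suppose the network is generated with true parameter $\delta_0$. Then, as $n\to\infty$, $$\log\frac{L_n(\delta_0+h/\sqrt n\mid D^{(n)})}{L_n(\delta_0\mid D^{(n)})}=h\,\Delta_n-\tfrac12h^2\nu_0+o_P(1),\qquad \Delta_n=\frac{n+1}{\sqrt n}\,\iota_n'(\delta_0)\rightsquigarrow N(0,\nu_0),$$ where $o_P(1)$ denotes a sequence tending to $0$ in probability, $\rightsquigarrow$ denotes convergence in distribution, and $$\nu_0=\sum_{k=1}^\infty\frac{\mu\, q_k^{(0)}}{(k+\delta_0)^2}-\frac{\mu}{(2\mu+\delta_0)^2}.$$
   Context: Initial degrees. $(m_t)_{t\ge1}$ is an i.i.d. sequence of positive-integer-valued random variables with $r_k=\mathbb{P}(m_1=k)$, mean $\mu=\mathbb{E}m_1\ge 1$ and finite second moment. $M_t=\sum_{j=1}^t m_j$. Model (affine preferential attachment with random initial degrees, parameter $\delta>-1$). $\mathrm{PA}_1(\delta)$ has two vertices $v_0,v_1$ joined by $m_1$ edges. For $t\ge2$, given $\mathrm{PA}_{t-1}(\delta)=:\mathrm{PA}_{t,0}(\delta)$ with vertex set $V_{t-1}=\{v_0,\dots,v_{t-1}\}$, a new vertex $v_t$ is added, and sequentially for $i=1,\dots,m_t$ the network $\mathrm{PA}_{t,i}(\delta)$ is obtained from $\mathrm{PA}_{t,i-1}(\delta)$ by adding an edge between $v_t$ and a random vertex of $V_{t-1}$, where (conditionally on the past and on $(m_t)_{t\ge1}$)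 vertex $v_j\in V_{t-1}$ is chosen with probability $(\mathrm{Deg}_{t,i-1}(v_j)+\delta)/S_{t,i-1}(\delta)$. Here $\mathrm{Deg}_{t,i-1}(v)$ is the degree of $v$ in $\mathrm{PA}_{t,i-1}(\delta)$ and $S_{t,i-1}(\delta)=\sum_{v\in V_{t-1}}(\mathrm{Deg}_{t,i-1}(v)+\delta)=t\delta+2M_{t-1}+(i-1)$. Finally $\mathrm{PA}_t(\delta)=\mathrm{PA}_{t,m_t}(\delta)$. Likelihood. $D_{t,i}$ is the degree in $\mathrm{PA}_{t,i-1}$ of the vertex chosen when constructing $\mathrm{PA}_{t,i}$ from $\mathrm{PA}_{t,i-1}$; $D_t=(D_{t,1},\dots,D_{t,m_t})$ and $D^{(n)}=(D_t)_{t=2}^n$. $N_k(t,i-1)$ is the number of vertices in $V_{t-1}$ (not counting $v_t$) having degree $k$ in $\mathrm{PA}_{t,i-1}$. The conditional likelihood of $D^{(n)}$ given $(m_t)_{t\ge1}$ is $$L_n(\delta\mid D^{(n)})=\prod_{t=2}^n\prod_{i=1}^{m_t}\frac{(D_{t,i}+\delta)N_{D_{t,i}}(t,i-1)}{S_{t,i-1}(\delta)}$$ (for fixed $h$, $\delta_0+h/\sqrt n>-1$ for all large $n$). $N_k(n)$ is the number of vertices of degree $k$ in the network at time $n$ (counting also $v_n$), $N_{>k}(n)=\sum_{j>k}N_j(n)$, $R_{>k}(n)=2\cdot 1_{\{m_1>k\}}+\sum_{t=2}^n1_{\{m_t>k\}}$, and $$\iota'_n(\delta)=\sum_{k=1}^\infty\frac1{k+\delta}\frac{N_{>k}(n)-R_{>k}(n)}{n+1}-\frac1{n+1}\sum_{t=2}^n\sum_{i=1}^{m_t}\frac{t}{S_{t,i-1}(\delta)}.$$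 Limits. For $\delta>-1$ let $\theta=2+\delta/\mu$ and let $(p_k(\delta))_{k\ge1}$ be defined by $p_0=0$ and $p_k=\frac{k-1+\delta}{\theta}p_{k-1}-\frac{k+\delta}{\theta}p_k+r_k$, $k\ge1$. Put $q_k(\delta)=\frac{(k+\delta)p_k(\delta)}{2\mu+\delta}$ and $q_k^{(0)}=q_k(\delta_0)$. *)

(* Defs.v *)
From HB Require Import structures.
From mathcomp Require Import all_boot all_order all_algebra.
From mathcomp Require Import all_classical all_reals all_analysis.
Set Implicit Arguments.
Unset Strict Implicit.
Unset Printing Implicit Defensive.
Import Order.TTheory GRing.Theory Num.Theory.
Import numFieldNormedType.Exports.
Local Open Scope classical_set_scope.
Local Open Scope ring_scope.

(* A network is the sequence of its edges in order of creation; vertex v_j is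
   the number j.  For a realization of the initial degrees and of the choices,
   m t is the initial degree of v_t (t >= 1) and x t i is the index of the
   vertex chosen by the i-th edge of v_t (t >= 2, 1 <= i <= m t); the other
   values of m and x are irrelevant. *)

Definition new_edges (x : nat -> nat -> nat) (t i : nat) : seq (nat * nat) :=
  [seq (t, x t l) | l <- iota 1 i].

(* PA_t; the value at t = 0 is a dummy *)
Fixpoint PA (m : nat -> nat) (x : nat -> nat -> nat) (t : nat)
    : seq (nat * nat) :=
  match t with
  | 0 => [::]
  | 1 => nseq (m 1%N) (1%N, 0%N)
  | s.+1 => PA m x s ++ new_edges x s.+1 (m s.+1)
  end.

(* PA_{t,i}, for t >= 2 *)
Definition PAstep (m : nat -> nat) (x : nat -> nat -> nat) (t i : nat)
    : seq (nat * nat) :=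
  PA m x t.-1 ++ new_edges x t i.

Definition degree (E : seq (nat * nat)) (v : nat) : nat :=
  (count (fun e => e.1 == v) E + count (fun e => e.2 == v) E)%N.

(* number of vertices of degree k in the network E among v_0, ..., v_{N-1} *)
Definition degree_count (E : seq (nat * nat)) (N k : nat) : nat :=
  #|[set v : 'I_N | degree E v == k]|.

Section functionals.
Context {R : realType}.
Variables (m : nat -> nat) (x : nat -> nat -> nat).
Implicit Types (delta : R) (t i k n : nat).

(* S_{t,i}(delta): the sum ranges over V_{t-1} = {v_0, ..., v_{t-1}} *)
Definition total_weight delta t i : R :=
  \sum_(j < t) ((degree (PAstep m x t i) j)%:R + delta).

(* D_{t,i} *)
Definition chosen_degree t i : nat := degree (PAstep m x t i.-1) (x t i).

(* L_n(delta | D^(n)) *)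
Definition likelihood n delta : R :=
  \prod_(2 <= t < n.+1) \prod_(1 <= i < (m t).+1)
    (((chosen_degree t i)%:R + delta)
       * (degree_count (PAstep m x t i.-1) t (chosen_degree t i))%:R
     / total_weight delta t i.-1).

(* N_k(n) *)
Definition Nk k n : nat := degree_count (PA m x n) n.+1 k.

(* N_{>k}(n) *)
Definition Ngt k n : R := limn (fun J => \sum_(k.+1 <= j < J) (Nk j n)%:R : R).

(* R_{>k}(n) *)
Definition Rgt k n : nat := (2 * (k < m 1) + \sum_(2 <= t < n.+1) (k < m t))%N.

(* iota'_n(delta) *)
Definition score n delta : R :=
  limn (fun K => \sum_(1 <= k < K)
     ((k%:R + delta)^-1 * ((Ngt k n - (Rgt k n)%:R) / n.+1%:R)) : R)
  - n.+1%:R^-1 *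
     \sum_(2 <= t < n.+1) \sum_(1 <= i < (m t).+1)
       (t%:R / total_weight delta t i.-1).

End functionals.

Section limits.
Context {R : realType}.
Implicit Types (r p : nat -> R) (mu delta : R).

Definition theta mu delta : R := 2 + delta / mu.

(* the equations for k >= 1 are linear in p k and determine p uniquely *)
Definition is_limit_degree_law r mu delta p : Prop :=
  p 0%N = 0 /\
  forall k, (1 <= k)%N ->
    p k = (k%:R - 1 + delta) / theta mu delta * p k.-1
          - (k%:R + delta) / theta mu delta * p k + r k.

Definition q_of mu delta p (k : nat) : R :=
  (k%:R + delta) * p k / (2 * mu + delta).

Definition information mu delta p : R :=
  limn (fun K =>
    \sum_(1 <= k < K) (mu * q_of mu delta p k / (k%:R + delta) ^+ 2) : R)
  - mu / (2 * mu + delta) ^+ 2.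

End limits.

Section probability.
Context {R : realType} {d : measure_display} {T : measurableType d}.
Variable P : probability T R.

Definition mutually_independent (I : choiceType) {d'} {T' : measurableType d'}
    (X : I -> T -> T') : Prop :=
  forall (s : seq I) (A : I -> set T'), uniq s ->
    (forall i, measurable (A i)) ->
    P (\bigcap_(i in [set` s]) (X i @^-1` A i)) =
      (\prod_(i <- s) P (X i @^-1` A i))%E.

Definition identically_distributed (I : Type) {d'} {T' : measurableType d'}
    (X : I -> T -> T') : Prop :=
  forall (i j : I) (A : set T'), measurable A ->
    P (X i @^-1` A) = P (X j @^-1` A).

Definition cvg_in_probability (X : nat -> T -> R) (l : R) : Prop :=
  (forall n, measurable_fun setT (X n)) /\
  forall eps : R, 0 < eps ->
    P [set w | eps < `|X n w - l|] @[n --> \oo] --> 0%E.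

Definition cvg_in_distribution (X : nat -> T -> R)
    (Q : set R -> \bar R) : Prop :=
  (forall n, measurable_fun setT (X n)) /\
  forall y : R, {for y, continuous (fun z : R => Q [set u | u <= z])} ->
    P [set w | X n w <= y] @[n --> \oo] --> Q [set u | u <= y].

(* (m_t)_{t >= 1}; m 0 is not part of the sequence *)
Definition is_initial_degrees (m : nat -> {RV P >-> nat}) : Prop :=
  [/\ forall t w, (1 <= t)%N -> (0 < m t w)%N,
      mutually_independent (fun t => m t.+1 : T -> nat),
      identically_distributed (fun t => m t.+1 : T -> nat) &
      ('E_P[fun w => ((m 1%N w)%:R ^+ 2 : R)%R] < +oo)%E].

Definition degree_prob (m : nat -> {RV P >-> nat}) (k : nat) : R :=
  fine (P [set w | m 1%N w = k]).

Definition degree_mean (m : nat -> {RV P >-> nat}) : R :=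
  fine ('E_P[fun w => ((m 1%N w)%:R : R)%R])%E.

(* sigma-algebra generated by the whole sequence (m_s)_{s >= 1} and PA_{t,i};
   the edges being ordered, PA_{t,i} records the whole past of the network *)
Definition past (m : nat -> T -> nat) (x : nat -> nat -> T -> nat) (t i : nat)
    : set (set T) :=
  <<s [set A | (exists s k, (1 <= s)%N /\ A = [set w | m s w = k]) \/
               (exists E, A = [set w | PAstep (m ^~ w)
                                         (fun s l => x s l w) t i = E]) ]>>.

(* The third clause says that, on the event {i <= m_t} where the i-th edge of
   v_t exists, the conditional probability that this edge selects v_j is
   (Deg_{t,i-1}(v_j) + delta) / S_{t,i-1}(delta). *)
Definition is_preferential_attachment (delta : R) (m : nat -> {RV P >-> nat})
    (x : nat -> nat -> {RV P >-> nat}) : Prop :=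
  [/\ is_initial_degrees m,
      (forall t i w, (2 <= t)%N -> (1 <= i <= m t w)%N -> (x t i w < t)%N) &
      forall (t i j : nat) (A : set T),
        (2 <= t)%N -> (1 <= i)%N -> (j < t)%N -> past m x t i.-1 A ->
        P (A `&` [set w | (i <= m t w)%N] `&` [set w | x t i w = j]) =
        (\int[P]_(w in A `&` [set w | (i <= m t w)%N])
           (((degree (PAstep (m ^~ w) (fun s l => x s l w) t i.-1) j)%:R + delta)
            / total_weight (m ^~ w) (fun s l => x s l w) delta t i.-1)%:E)%E].

End probability.

Section statistics.
Context {R : realType} {d : measure_display} {T : measurableType d}.
Variables (m : nat -> T -> nat) (x : nat -> nat -> T -> nat).

Definition log_likelihood_ratio (delta0 h : R) (n : nat) (w : T) : R :=
  let L := likelihood (m ^~ w) (fun t i => x t i w) n in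
  ln (L (delta0 + h / Num.sqrt n%:R) / L delta0).

Definition Delta (delta0 : R) (n : nat) (w : T) : R :=
  n.+1%:R / Num.sqrt n%:R * score (m ^~ w) (fun t i => x t i w) n delta0.

End statistics.

(* Main.v *)
Require Import Defs.
From mathcomp Require Import all_boot all_order all_algebra.
From mathcomp Require Import all_classical all_reals all_analysis.
From mathcomp Require Import measurable_realfun ring lra zify.
Set Implicit Arguments.
Unset Strict Implicit.
Unset Printing Implicit Defensive.
Import Order.TTheory GRing.Theory Num.Theory.
Import numFieldNormedType.Exports.
Local Open Scope classical_set_scope.
Local Open Scope ring_scope.

(**
Each new edge adds one to a degree, so that the number of edges leaving degree k is N_{>k} - R_{>k},
and the score becomes a sum over the edges of 1/(D_{t,i} + delta) - t/S_{t,i-1}(delta). Given the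
past, the chosen vertex is size-biased and this summand is centred: the score is a martingale with
bounded differences. Comparing the martingale with a Gaussian through the solution of the heat
equation, step by step and stopped when the accumulated conditional variance becomes too large,
gives a central limit theorem that only asks the differences to be small and the total conditional
variance to be close to a constant in probability.

The conditional variance and the quadratic variation of the score are averages of functionals of
the degrees, up to martingale errors. The degree counts obey, in L^1 and up to errors of order
sqrt n, a recursion whose fixed point is (p_k); the recursion is a contraction on averages since
k + delta > 0. This gives the laws of large numbers that identify nu_0, and a second order Taylor
expansion of the logarithm in each factor of the likelihood ratio concludes.
*)

(** * Calculus *)

(** The score is centred by an exact cancellation: the size-biased mean of [1 / (k + delta)] over
    the [t] old vertices equals [t / S]. Three obstacles shape the proof. (1) The number of edges
    [m_t] is random with only two moments, while a martingale wants deterministic indices. Each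
    vertex gets [n] slots; the edges that do not fit cost about [m_t^2 / n] summands per vertex,
    which the second moment makes harmless. (2) The weight [S] is random. It is replaced by
    [t (2 mu + delta)], with an error governed by [M_t - t mu], of order [sqrt t]; replacing [m_t]
    by [mu] in front of a running average is done by summation by parts, because such averages vary
    slowly. (3) Conditioning: the past is coded in a countable type, so that a zero conditional mean
    becomes a zero integral on every fibre, and then orthogonality to bounded functions of the code.
    The code holds [m_1, ..., m_n] from the start, as the attachment law is given conditionally on
    all initial degrees; whether a slot is occupied is thus predictable. Errors are carried as
    explicit [L^1] bounds of order [sqrt n], so that hardly any limit is taken before the end. *)

Section calculus.
Context {R : realType}.
Implicit Types (f g df : R -> R) (a b x y z K : R).

Lemma is_derive_continuous f x (l : R) : is_derive x 1 f l -> {for x, continuous f}.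
Proof. by case=> /derivable1_diffP/differentiable_continuous. Qed.

Lemma is_derive_congr f g x (l l' : R) :
  is_derive x 1 f l -> f =1 g -> l = l' -> is_derive x 1 g l'.
Proof. by move=> + /funext <- <-. Qed.

(** The segment is given by [Num.min] and [Num.max] so that increments of either sign are covered;
    by symmetry only [a <= b] is treated. *)
Lemma norm_MVT f df a b K :
  (forall t, Num.min a b <= t <= Num.max a b -> is_derive t 1 f (df t)) ->
  (forall t, Num.min a b <= t <= Num.max a b -> `|df t| <= K) ->
  `|f b - f a| <= K * `|b - a|.
Proof.
wlog ab : a b / a <= b => [H D B|].
  have [/H|ba] := leP a b; first exact.
  rewrite distrC (distrC b); apply: H; first exact: ltW.
    by move=> t; rewrite minC maxC; exact: D.
  by move=> t; rewrite minC maxC; exact: B.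
rewrite (min_idPl ab) (max_idPr ab) => D B.
have Dt t : t \in `]a, b[ -> is_derive t 1 f (df t).
  by rewrite in_itv/= => /andP[/ltW ? /ltW ?]; apply: D; apply/andP.
have [|c cab ->] := MVT_segment ab Dt.
  apply: continuous_in_subspaceT => t; rewrite inE/= in_itv/= => tab.
  exact: is_derive_continuous (D _ tab).
rewrite normrM ler_wpM2r//; apply: B.
by move: cab; rewrite in_itv.
Qed.

Lemma between0 y t : Num.min 0 y <= t <= Num.max 0 y -> `|t| <= `|y|.
Proof.
have [y0|y0] := leP 0 y => /andP[t0 ty].
  by rewrite !ger0_norm.
by rewrite !ler0_norm// ?lerN2// ltW.
Qed.

Lemma between0_trans y t u : Num.min 0 y <= t <= Num.max 0 y ->
  Num.min 0 t <= u <= Num.max 0 t -> Num.min 0 y <= u <= Num.max 0 y.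
Proof.
have [y0|y0] := leP 0 y => /andP[t0 ty].
  by rewrite (min_idPl t0) (max_idPr t0) => /andP[-> /le_trans]; apply.
by rewrite (min_idPr ty) (max_idPl ty) => /andP[/(le_trans t0) -> ->].
Qed.

(** One rung of a Taylor estimate: applied to successive derivatives with their Taylor polynomials
    removed, it raises the order of the remainder by one each time, at the price of the
    factorials. *)
Lemma norm_MVT0 f df y K n : 0 <= K ->
  (forall t, Num.min 0 y <= t <= Num.max 0 y -> is_derive t 1 f (df t)) ->
  (forall t, Num.min 0 y <= t <= Num.max 0 y -> `|df t| <= K * `|t| ^+ n) ->
  f 0 = 0 -> `|f y| <= K * `|y| ^+ n.+1.
Proof.
move=> K0 D B f0.
have := @norm_MVT f df 0 y (K * `|y| ^+ n) D.
rewrite f0 !subr0 exprSr mulrA; apply => t ty.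
apply: (le_trans (B _ ty)); rewrite ler_wpM2l// lerXn2r ?nnegrE//.
exact: between0.
Qed.

(** The derivative of the expression under the norm is [t^2 / (1 + t)], and [1 + t >= 1/2] on the
    segment. *)
Lemma ln1D_taylor x : `|x| <= 2^-1 -> `|ln (1 + x) - x + x ^+ 2 / 2| <= 2 * `|x| ^+ 3.
Proof.
move=> x2.
pose f (t : R) := ln (1 + t) - t + t ^+ 2 / 2.
pose df (t : R) := (1 + t)^-1 - 1 + t.
have t1 (t : R) : Num.min 0 x <= t <= Num.max 0 x -> 2^-1 <= 1 + t.
  move/between0 => /le_trans/(_ x2); rewrite ler_norml => /andP[]; lra.
rewrite -/(f x); apply: (@norm_MVT0 f df) => // [t tx|t tx|].
- have t0 : 0 < 1 + t by have := t1 _ tx; lra.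
  rewrite /f /df.
  have H1 : is_derive t (1:R) (fun u : R => 1 + u) 1.
    apply: (is_derive_congr (is_deriveD (is_derive_cst (1 : R) t 1) (is_derive_id t 1))) => //.
    by rewrite add0r.
  have H3 := @is_derive1_comp _ _ _ _ _ _ (is_derive1_ln t0) H1.
  apply: (is_derive_congr (is_deriveD (is_deriveB H3 (is_derive_id t 1))
     (is_deriveM (is_deriveX 2 (is_derive_id t 1)) (is_derive_cst (2^-1 : R) t 1)))) => //.
  rewrite /GRing.scale/=; field; lra.
- have := t1 _ tx => t2; rewrite /df.
  have -> : (1 + t)^-1 - 1 + t = t ^+ 2 / (1 + t) by field; lra.
  rewrite normrM normrX mulrC ler_wpM2r ?exprn_ge0//.
  rewrite normfV ger0_norm; last by lra.
  rewrite -[leRHS]invrK lef_pV2 ?posrE ?invr_gt0//; lra.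
- by rewrite /f addr0 ln1 expr0n/= mul0r; lra.
Qed.

End calculus.

(** * Gaussian smoothing *)

Section heat.
Context {R : realType}.
Implicit Types (x y z s v e : R).

Local Notation phi := (@normal_pdf R 0 1).

Definition gauss_cdf z : R := fine (normal_prob (0 : R) 1 `]-oo, z]).

Lemma gauss_pdfE z : phi z = normal_peak 1 * expR (- z ^+ 2 / 2).
Proof. by rewrite normal_pdfE ?oner_neq0// /normal_fun subr0 expr1n. Qed.

Lemma gauss_cdfE z : normal_prob (0 : R) 1 `]-oo, z] = (gauss_cdf z)%:E.
Proof. by rewrite fineK//; apply: fin_num_measure. Qed.

Lemma gauss_cdf_ge0 z : 0 <= gauss_cdf z.
Proof. by rewrite fine_ge0. Qed.

Lemma gauss_cdf_le1 z : gauss_cdf z <= 1.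
Proof. by rewrite -lee_fin -gauss_cdfE; apply: probability_le1. Qed.

Lemma is_derive_gauss_cdf z : is_derive z 1 gauss_cdf (phi z).
Proof.
have [||||] := @continuous_FTC1 R phi -oo%O z (z + 1).
- by rewrite ltrDl.
- by apply: integrableS (@integrable_normal_pdf R 0 1).
- by rewrite ltNyr.
- by apply: continuous_normal_pdf; rewrite oner_neq0.
move=> D E; split => //.
by rewrite -E derive1E.
Qed.

Lemma is_derive_gauss_pdf z : is_derive z 1 phi (- z * phi z).
Proof.
have H := is_deriveM (is_derive_cst (- 2^-1 : R) z 1) (is_deriveX 2 (is_derive_id z 1)).
have H2 := @is_derive1_comp _ _ _ _ _ _ (is_derive_expR _) H.
apply: (is_derive_congr (is_deriveM (is_derive_cst (normal_peak 1 : R) z 1) H2)) => [u|].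
  by rewrite gauss_pdfE/=; congr (_ * expR _); rewrite !fctE/=; field.
rewrite gauss_pdfE /GRing.scale/= !fctE/=.
set E := expR (- z ^+ 2 / 2).
have -> : expR (- 2^-1 * z ^+ 2) = E by congr expR; field.
by field.
Qed.

(** From [exp (z^2 / 2) >= 1 + z^4 / 8], the Gaussian factor absorbs [1 + z^4 <= 8 (1 + z^4 / 8)],
    and [|z|^j <= 1 + z^4] for [j <= 4]. *)
Lemma gauss_pdf_moment_le z j : (j <= 4)%N -> `|z ^+ j * phi z| <= 8 * normal_peak 1.
Proof.
move=> j4; rewrite gauss_pdfE normrM mulrC (ger0_norm (mulr_ge0 _ _)) ?normal_peak_ge0 ?expR_ge0//.
rewrite -mulrA [leRHS]mulrC ler_wpM2l ?normal_peak_ge0//.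
have E : (1 + z ^+ 4 / 8) * expR (- z ^+ 2 / 2) <= 1.
  rewrite mulNr expRN -ler_pdivlMr ?invr_gt0 ?expR_gt0// invrK mul1r.
  have := @expR_ge1Dxn R (z ^+ 2 / 2) 1 _; rewrite divr_ge0 ?sqr_ge0//.
  move=> /(_ isT); apply: le_trans; rewrite lerD2l.
  by rewrite expr_div_n -exprM !factS fact0; lra.
have z4 : `|z| ^+ j <= 1 + z ^+ 4.
  have -> : z ^+ 4 = `|z| ^+ 4 by rewrite -normrX ger0_norm// exprn_even_ge0.
  have [z1|z1] := leP `|z| 1.
    by apply: (@le_trans _ _ 1); [rewrite exprn_ile1|rewrite lerDl exprn_ge0].
  by apply: (@le_trans _ _ (`|z| ^+ 4)); [rewrite ler_weXn2l ?ltW|rewrite lerDr].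
rewrite normrX mulrC; apply: (le_trans (ler_wpM2r (expR_ge0 _) z4)).
have := expR_gt0 (- z ^+ 2 / 2); lra.
Qed.

(** The substitution [x / s] reduces the limit law, given by its standard deviation, to
    [gauss_cdf]. *)
Lemma normal_prob_Nyc (s y : R) : 0 < s ->
  normal_prob 0 s `]-oo, y] = (gauss_cdf (y / s))%:E.
Proof.
move=> s0; rewrite -gauss_cdfE /normal_prob.
have H x : is_derive x 1 (fun x => x / s) s^-1.
  apply: (is_derive_congr (is_deriveM (is_derive_id x 1) (is_derive_cst (s^-1 : R) x 1))) => //.
  by rewrite /GRing.scale/=; field; lra.
have FE : (fun x => x / s)^`()%classic = cst s^-1.
  by apply/funext => x; rewrite derive1E derive_val.
have D x : derivable (fun x => x / s) x 1 by case: (H x).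
rewrite (@increasing_ge0_integration_by_substitutionNy _ (fun x => x / s)).
- apply: eq_integral => x _; congr EFin; rewrite FE !fctE.
  rewrite !normal_pdfE ?gt_eqF ?oner_neq0// /normal_fun !subr0.
  rewrite /normal_peak !expr1n mul1r.
  have -> : expR (- (x / s) ^+ 2 / 2) = expR (- x ^+ 2 / (s ^+ 2 *+ 2)).
    by congr expR; field; lra.
  rewrite -mulrnAr sqrtrM ?sqr_ge0// sqrtr_sqr gtr0_norm// invfM.
  by ring.
- by move=> u v _ _ uv; rewrite ltr_pM2r ?invr_gt0.
- by rewrite FE => ? _; exact: cvg_cst.
- by rewrite FE; exact: is_cvg_cst.
- by rewrite FE; exact: cvg_cst.
- split; first by move=> x _; exact: D.
  by apply: cvg_at_left_filter; exact: (is_derive_continuous (H y)).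
- apply/gt0_cvgMlNy; last exact: cvg_id.
  by rewrite invr_gt0.
- by apply: continuous_subspaceT; apply: continuous_normal_pdf.
- by move=> x _; exact: normal_pdf_ge0.
Qed.

End heat.

Section heat.
Context {R : realType}.
Implicit Types (x y z s v e : R).

Local Notation phi := (@normal_pdf R 0 1).

(* [heat y s x] is P(x + sqrt s Z <= y) for Z standard normal; it solves the heat equation
   d/ds = (1/2) d^2/dx^2. *)
Definition heat y s x := gauss_cdf ((y - x) / Num.sqrt s).
Definition heat_x y s x := - (phi ((y - x) / Num.sqrt s) / Num.sqrt s).
Definition heat_xx y s x :=
  - ((y - x) / Num.sqrt s * phi ((y - x) / Num.sqrt s) / Num.sqrt s ^+ 2).
Definition heat_xxx y s x :=
  (1 - ((y - x) / Num.sqrt s) ^+ 2) * phi ((y - x) / Num.sqrt s) / Num.sqrt s ^+ 3.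
Definition heat_ss y s x := let z := (y - x) / Num.sqrt s in
  2^-1 * (z + z * (1 - z ^+ 2) / 2) * phi z / Num.sqrt s ^+ 4.

Lemma is_derive_arg_x y (k : R) x : is_derive x 1 (fun x => (y - x) / k) (- k^-1).
Proof.
have H := is_deriveB (is_derive_cst (y : R) x 1) (is_derive_id x 1).
apply: (is_derive_congr (is_deriveM H (is_derive_cst (k^-1 : R) x 1))) => //.
by rewrite /GRing.scale/=; ring.
Qed.

Lemma is_derive_arg_s y x s : 0 < s ->
  is_derive s 1 (fun s => (y - x) / Num.sqrt s) (- (2^-1 * ((y - x) / Num.sqrt s) / Num.sqrt s ^+ 2)).
Proof.
move=> s0; have r0 : 0 < Num.sqrt s by rewrite sqrtr_gt0.
have H := is_deriveV (lt0r_neq0 r0) (is_derive1_sqrt s0).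
apply: (is_derive_congr (is_deriveM (is_derive_cst (y - x : R) s 1) H)) => //.
by rewrite /GRing.scale/=; field; rewrite gt_eqF.
Qed.

Lemma is_derive_heat_x y s x : is_derive x 1 (heat y s) (heat_x y s x).
Proof.
have := @is_derive1_comp _ _ _ _ _ _ (is_derive_gauss_cdf _) (is_derive_arg_x y (Num.sqrt s) x).
by move/is_derive_congr; apply => //; rewrite /heat_x mulrN.
Qed.

Lemma is_derive_heat_xx y s x : 0 < s -> is_derive x 1 (heat_x y s) (heat_xx y s x).
Proof.
move=> s0; have r0 : 0 < Num.sqrt s by rewrite sqrtr_gt0.
have := @is_derive1_comp _ _ _ _ _ _ (is_derive_gauss_pdf _) (is_derive_arg_x y (Num.sqrt s) x).
move=> H; apply: (is_derive_congr (is_deriveM H (is_derive_cst (- (Num.sqrt s)^-1 : R) x 1))) => [u|].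
  by rewrite /heat_x !fctE /= mulrN.
by rewrite /heat_xx /GRing.scale/=; field; rewrite gt_eqF.
Qed.

Lemma is_derive_heat_xxx y s x : 0 < s -> is_derive x 1 (heat_xx y s) (heat_xxx y s x).
Proof.
move=> s0; have r0 : 0 < Num.sqrt s by rewrite sqrtr_gt0.
have H1 := is_derive_arg_x y (Num.sqrt s) x.
have H := @is_derive1_comp _ _ _ _ _ _ (is_derive_gauss_pdf _) H1.
apply: (is_derive_congr (is_deriveM (is_deriveM H1 H) (is_derive_cst (- (Num.sqrt s ^+ 2)^-1 : R) x 1))) => [u|].
  by rewrite /heat_xx !fctE /= mulrN.
by rewrite /heat_xxx /GRing.scale/=; field; rewrite gt_eqF.
Qed.

Lemma is_derive_heat_s y s x : 0 < s ->
  is_derive s 1 (fun s => heat y s x) (2^-1 * heat_xx y s x).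
Proof.
move=> s0; have r0 : 0 < Num.sqrt s by rewrite sqrtr_gt0.
have := @is_derive1_comp _ _ _ _ _ _ (is_derive_gauss_cdf _) (is_derive_arg_s y x s0).
by move/is_derive_congr; apply => //; rewrite /heat_xx; field; rewrite gt_eqF.
Qed.

Lemma is_derive_heat_ss y s x : 0 < s ->
  is_derive s 1 (fun s => 2^-1 * heat_xx y s x) (heat_ss y s x).
Proof.
move=> s0; have r0 : 0 < Num.sqrt s by rewrite sqrtr_gt0.
have H1 := is_derive_arg_s y x s0.
have H := @is_derive1_comp _ _ _ _ _ _ (is_derive_gauss_pdf _) H1.
have H2 := is_deriveX 2 (is_deriveV (lt0r_neq0 r0) (is_derive1_sqrt s0)).
apply: (is_derive_congr (is_deriveM (is_deriveM (is_deriveM H1 H) H2) (is_derive_cst (- 2^-1 : R) s 1))) => [u|].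
  by rewrite /heat_xx !fctE /= exprVn; ring.
rewrite /heat_ss /GRing.scale/= !fctE /=; field; rewrite gt_eqF//.
Qed.

Lemma heat_ge0 y s x : 0 <= heat y s x. Proof. exact: gauss_cdf_ge0. Qed.
Lemma heat_le1 y s x : heat y s x <= 1. Proof. exact: gauss_cdf_le1. Qed.

(** Each derivative is a polynomial in [z] times [phi z] over a power of [sqrt s]. The constant
    deteriorates as [e] tends to 0, which is why some time [e] is always left in the heat
    equation. *)
Lemma heat_bounds e : 0 < e -> exists2 K, 0 <= K & forall y s x, e <= s ->
  [/\ `|heat_x y s x| <= K, `|heat_xx y s x| <= K, `|heat_xxx y s x| <= K & `|heat_ss y s x| <= K].
Proof.
move=> e0; pose c := 8 * @normal_peak R 1.
have c0 : 0 <= c by rewrite mulr_ge0// normal_peak_ge0.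
pose k := (Num.sqrt e)^-1; have k0 : 0 < k by rewrite invr_gt0 sqrtr_gt0.
pose K := 4 * c * (k + k ^+ 2 + k ^+ 3 + k ^+ 4).
have [kp2 kp3 kp4] : [/\ 0 < k ^+ 2, 0 < k ^+ 3 & 0 < k ^+ 4] by rewrite !exprn_gt0.
exists K; first by apply: mulr_ge0; [exact: mulr_ge0|lra].
move=> y s x es.
have r0 : 0 < Num.sqrt s by rewrite sqrtr_gt0 (lt_le_trans e0).
set r := Num.sqrt s in r0 *.
have rk1 : r^-1 <= k.
  by rewrite /k lef_pV2 ?posrE// ?sqrtr_gt0// ler_wsqrtr.
have rk n : (r ^+ n)^-1 <= k ^+ n.
  by rewrite -exprVn; apply: lerXn2r => //; rewrite nnegrE ltW// invr_gt0.
have rn n : 0 < (r ^+ n)^-1 by rewrite invr_gt0 exprn_gt0.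
have bd (a : R) n : `|a| <= 4 * c -> (n <= 4)%N -> (0 < n)%N -> `|a / r ^+ n| <= K.
  move=> ac n4 n0; rewrite normrM (ger0_norm (ltW (rn n))).
  apply: (@le_trans _ _ (4 * c * k ^+ n)).
    by rewrite ler_pM// ltW.
  apply: ler_wpM2l; first by apply: mulr_ge0.
  case: n n4 n0 {ac} => [//|[|[|[|[|//]]]]] _ _; rewrite ?expr1; lra.
rewrite /heat_x /heat_xx /heat_xxx /heat_ss -/r; set z := (y - x) / r.
have m0 : `|phi z| <= c by have := gauss_pdf_moment_le z (j:=0) isT; rewrite expr0 mul1r.
have m1 : `|z * phi z| <= c by have := gauss_pdf_moment_le z (j:=1) isT; rewrite expr1.
have m2 : `|z ^+ 2 * phi z| <= c by exact: gauss_pdf_moment_le.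
have m3 : `|z ^+ 3 * phi z| <= c by exact: gauss_pdf_moment_le.
split; rewrite ?normrN.
- by rewrite -[r]expr1; apply: bd => //; lra.
- by apply: bd => //; lra.
- apply: bd => //; rewrite mulrBl mul1r; apply: (le_trans (ler_normB _ _)); lra.
- apply: bd => //.
  have -> : 2^-1 * (z + z * (1 - z ^+ 2) / 2) * phi z = 3 / 4 * (z * phi z) - 4^-1 * (z ^+ 3 * phi z) by field.
  move: m1 m3; rewrite !ler_norml => /andP[? ?] /andP[? ?].
  by apply/andP; split; lra.
Qed.

(** Moves the space point by [u] while [v] units of time are spent. By the heat equation the time
    derivative is half the second space derivative, so these two terms merge into the factor
    [u ^+ 2 - v], whose conditional mean vanishes when [v] is the conditional variance of a centred
    [u]. *)
Lemma heat_taylor e : 0 < e -> exists2 K, 0 <= K & forall y s v x u,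
  e <= s -> 0 <= v ->
  [/\ `|heat_x y s x| <= K, `|heat_xx y s x| <= K,
      `|heat y (s + v) x - heat y s x| <= K * v
    & `|heat y s (x + u) - heat y (s + v) x - heat_x y s x * u
        - 2^-1 * heat_xx y s x * (u ^+ 2 - v)| <= K * (`|u| ^+ 3 + v ^+ 2)].
Proof.
move=> e0; have [K K0 bd] := heat_bounds e0; exists K => // y s v x u es v0.
have [b1 b2 b3 b4] := bd y s x es.
have s0 : 0 < s by exact: lt_le_trans es.
have sv t : Num.min 0 v <= t <= Num.max 0 v -> e <= s + t.
  by rewrite (min_idPl v0) => /andP[t0 _]; rewrite (le_trans es)// lerDl.
have sh (t k : R) : is_derive t 1 (fun t => k + t) 1.
  apply: (is_derive_congr (is_deriveD (is_derive_cst (k : R) t 1) (is_derive_id t 1))) => //.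
  by rewrite add0r.
have Hs : `|heat y (s + v) x - heat y s x| <= K * v.
  have := @norm_MVT0 _ (fun t => heat y (s + t) x - heat y s x)
    (fun t => 2^-1 * heat_xx y (s + t) x) v K 0 K0.
  rewrite expr1 (ger0_norm v0); apply.
  - move=> t /sv st; have st0 : 0 < s + t by exact: lt_le_trans st.
    have := is_deriveB (@is_derive1_comp _ _ _ _ _ _ (is_derive_heat_s y x st0) (sh t s)) (is_derive_cst (heat y s x) t 1).
    by move/is_derive_congr; apply => //; rewrite /GRing.scale/= subr0 mulr1.
  - move=> t /sv st; have [_ b _ _] := bd y (s + t) x st.
    by rewrite expr0 mulr1 normrM ger0_norm; lra.
  - by rewrite addr0 subrr.
have Hss : `|heat y (s + v) x - heat y s x - 2^-1 * heat_xx y s x * v| <= K * v ^+ 2.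
  have := @norm_MVT0 _ (fun t => heat y (s + t) x - heat y s x - 2^-1 * heat_xx y s x * t)
    (fun t => 2^-1 * heat_xx y (s + t) x - 2^-1 * heat_xx y s x) v K 1 K0.
  rewrite (ger0_norm v0); apply.
  - move=> t /sv st; have st0 : 0 < s + t by exact: lt_le_trans st.
    have H1 := is_deriveB (@is_derive1_comp _ _ _ _ _ _ (is_derive_heat_s y x st0) (sh t s)) (is_derive_cst (heat y s x) t 1).
    have := is_deriveB H1 (is_deriveM (is_derive_cst (2^-1 * heat_xx y s x) t 1) (is_derive_id t 1)).
    by move/is_derive_congr; apply => //; rewrite /GRing.scale/=; ring.
  - move=> t tv.
    have := @norm_MVT0 _ (fun t => 2^-1 * heat_xx y (s + t) x - 2^-1 * heat_xx y s x)
      (fun t => heat_ss y (s + t) x) t K 0 K0; apply.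
    + move=> w /(between0_trans tv) /sv st; have st0 : 0 < s + w by exact: lt_le_trans st.
      have := is_deriveB (@is_derive1_comp _ _ _ _ _ _ (is_derive_heat_ss y x st0) (sh w s)) (is_derive_cst (2^-1 * heat_xx y s x) w 1).
      by move/is_derive_congr; apply => //; rewrite /GRing.scale/= subr0 mulr1.
    + by move=> w /(between0_trans tv) /sv st; have [_ _ _ ?] := bd y (s + w) x st; rewrite expr0 mulr1.
    + by rewrite addr0 subrr.
  - by rewrite addr0 subrr mulr0 subr0.
have Hx : `|heat y s (x + u) - heat y s x - heat_x y s x * u - 2^-1 * heat_xx y s x * u ^+ 2| <= K * `|u| ^+ 3.
  have D1 (t : R) := @is_derive1_comp _ _ _ _ _ _ (is_derive_heat_x y s (x + t)) (sh t x).
  have D2 (t : R) := @is_derive1_comp _ _ _ _ _ _ (is_derive_heat_xx y (x + t) s0) (sh t x).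
  have D3 (t : R) := @is_derive1_comp _ _ _ _ _ _ (is_derive_heat_xxx y (x + t) s0) (sh t x).
  apply: (@norm_MVT0 _ (fun t => heat y s (x + t) - heat y s x - heat_x y s x * t - 2^-1 * heat_xx y s x * t ^+ 2)
    (fun t => heat_x y s (x + t) - heat_x y s x - heat_xx y s x * t)) => //.
  - move=> t _.
    have := is_deriveB (is_deriveB (is_deriveB (D1 t) (is_derive_cst (heat y s x) t 1))
      (is_deriveM (is_derive_cst (heat_x y s x) t 1) (is_derive_id t 1)))
      (is_deriveM (is_derive_cst (2^-1 * heat_xx y s x) t 1) (is_deriveX 2 (is_derive_id t 1))).
    by move/is_derive_congr; apply => //; rewrite /GRing.scale/=; field.
  - move=> t tu.
    apply: (@norm_MVT0 _ (fun t => heat_x y s (x + t) - heat_x y s x - heat_xx y s x * t)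
      (fun t => heat_xx y s (x + t) - heat_xx y s x)) => //.
    + move=> w _.
      have := is_deriveB (is_deriveB (D2 w) (is_derive_cst (heat_x y s x) w 1))
        (is_deriveM (is_derive_cst (heat_xx y s x) w 1) (is_derive_id w 1)).
      by move/is_derive_congr; apply => //; rewrite /GRing.scale/=; ring.
    + move=> w wt.
      apply: (@norm_MVT0 _ (fun t => heat_xx y s (x + t) - heat_xx y s x)
        (fun t => heat_xxx y s (x + t))) => //.
      * move=> r _.
        have := is_deriveB (D3 r) (is_derive_cst (heat_xx y s x) r 1).
        by move/is_derive_congr; apply => //; rewrite /GRing.scale/= subr0 mulr1.
      * by move=> r _; have [_ _ ? _] := bd y s (x + r) es; rewrite expr0 mulr1.
      * by rewrite addr0 subrr.
    + by rewrite addr0 subrr mulr0 subr0.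
  - by rewrite addr0 subrr mulr0 expr0n /= mulr0 !subr0.
split => //.
set A := (X in `|X| <= _) in Hx; set B := (X in `|X| <= _) in Hss.
have -> : heat y s (x + u) - heat y (s + v) x - heat_x y s x * u -
   2^-1 * heat_xx y s x * (u ^+ 2 - v) = A - B by rewrite /A /B; ring.
by rewrite (le_trans (ler_normB _ _))// mulrDr lerD.
Qed.

Lemma gauss_cdf_nondecreasing : {homo @gauss_cdf R : x y / x <= y}.
Proof.
move=> x y xy; rewrite -lee_fin -!gauss_cdfE.
by apply: le_measure; rewrite ?inE//; apply: subset_itvl; rewrite bnd_simp.
Qed.

Lemma gauss_cdf_tails e : 0 < e -> exists2 z, 0 < z &
  gauss_cdf (- z) <= e /\ 1 - e <= gauss_cdf z.
Proof.
move=> e0.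
have cvg1 : gauss_cdf (n%:R : R) @[n --> \oo] --> (1 : R).
  suff H : normal_prob 0 1 `]-oo, n%:R] @[n --> \oo] --> (1%E : \bar R).
    exact: (fine_cvg H).
  have -> : 1%E = normal_prob (0 : R) 1 (\bigcup_n [set` `]-oo, (n%:R : R)]]).
    rewrite -(@probability_setT _ _ _ (normal_prob (0 : R) 1)); congr (normal_prob _ _ _).
    apply/esym; rewrite -subTset => x _; exists (Num.bound `|x|) => //=.
    by rewrite in_itv/= ltW// (le_lt_trans (ler_norm _) (archi_boundP _)).
  apply: nondecreasing_cvg_mu => //; first exact: bigcup_measurable.
  by move=> i j ij; apply/subsetPset/subset_itvl; rewrite bnd_simp ler_nat.
have cvg0 : gauss_cdf (- n%:R : R) @[n --> \oo] --> (0 : R).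
  suff H : normal_prob 0 1 `]-oo, - n%:R] @[n --> \oo] --> (0%E : \bar R).
    exact: (fine_cvg H).
  have -> : 0%E = normal_prob (0 : R) 1 (\bigcap_n [set` `]-oo, (- n%:R : R)]]).
    rewrite -(@measure0 _ _ _ (normal_prob (0 : R) 1)); congr (normal_prob _ _ _).
    apply/esym; rewrite -subset0 => x /(_ (Num.bound `|x|) I) /=.
    rewrite in_itv/= leNgt ltrNl => /negP; apply.
    by rewrite (le_lt_trans (ler_norm _))// normrN archi_boundP.
  apply: nonincreasing_cvg_mu => //.
  - by rewrite ltey_eq fin_num_measure.
  - exact: bigcap_measurable.
  - by move=> i j ij; apply/subsetPset/subset_itvl; rewrite bnd_simp lerN2 ler_nat.
have [n [n0 n1 n2]] : exists n, [/\ (0 < n)%N, 1 - e <= gauss_cdf (n%:R : R) & gauss_cdf (- n%:R : R) <= e].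
  near \oo => n; exists n; split; first by near: n; exists 1%N.
    near: n; apply: (cvgr_ge _ cvg1); lra.
  by near: n; apply: (cvgr_le _ cvg0).
by exists n%:R; rewrite ?ltr0n.
Unshelve. all: by end_near. Qed.

End heat.

(** * Expectations *)

Section expectation.
Context {R : realType} {d : measure_display} {T : measurableType d}.
Variable P : probability T R.
Implicit Types (X Y : T -> R) (A : set T).

Definition Ex X : R := \int[P]_w X w.
Definition L1 X : Prop := P.-integrable setT (EFin \o X).

Lemma L1_measurable X : L1 X -> measurable_fun setT X.
Proof. by move=> /integrableP[/measurable_EFinP]. Qed.

Lemma L1_cst (c : R) : L1 (fun=> c).
Proof. exact: (finite_measure_integrable_cst P c measurableT). Qed.

Lemma L1_le X Y : measurable_fun setT X -> L1 Y -> (forall w, `|X w| <= Y w) -> L1 X.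
Proof.
move=> mX iY XY; apply: le_integrable iY => //; first exact/measurable_EFinP.
by move=> w _; rewrite /= lee_fin (le_trans (XY w))// ler_norm.
Qed.

Lemma L1_bounded X (c : R) : measurable_fun setT X -> (forall w, `|X w| <= c) -> L1 X.
Proof. by move=> mX; apply: L1_le => //; exact: L1_cst. Qed.

Lemma L1D X Y : L1 X -> L1 Y -> L1 (fun w => X w + Y w).
Proof.
move=> iX iY; apply: eq_integrable (integrableD measurableT iX iY) => //.
Qed.

Lemma L1B X Y : L1 X -> L1 Y -> L1 (fun w => X w - Y w).
Proof.
move=> iX iY; apply: eq_integrable (integrableB measurableT iX iY) => //.
Qed.

Lemma L1Z X (c : R) : L1 X -> L1 (fun w => c * X w).
Proof.
move=> iX; apply: eq_integrable (integrableZl measurableT c iX) => //.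
Qed.

Lemma L1_norm X : L1 X -> L1 (fun w => `|X w|).
Proof. by move=> iX; apply: integrable_norm. Qed.

Lemma L1_sum (I : Type) (s : seq I) (F : I -> T -> R) :
  (forall i, L1 (F i)) -> L1 (fun w => \sum_(i <- s) F i w).
Proof.
move=> iF; elim: s => [|i s IH].
  by under eq_fun do rewrite big_nil; exact: L1_cst.
by under eq_fun do rewrite big_cons; exact: L1D.
Qed.

Lemma ExD X Y : L1 X -> L1 Y -> Ex (fun w => X w + Y w) = Ex X + Ex Y.
Proof. exact: RintegralD. Qed.

Lemma ExB X Y : L1 X -> L1 Y -> Ex (fun w => X w - Y w) = Ex X - Ex Y.
Proof. exact: RintegralB. Qed.

Lemma ExZ X (c : R) : L1 X -> Ex (fun w => c * X w) = c * Ex X.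
Proof. exact: RintegralZl. Qed.

Lemma Ex_cst (c : R) : Ex (fun=> c) = c.
Proof. by rewrite /Ex Rintegral_cst// [X in fine X](_ : _ = 1%E) ?mulr1//; exact: probability_setT. Qed.

Lemma Ex_sum (I : Type) (s : seq I) (F : I -> T -> R) : (forall i, L1 (F i)) ->
  Ex (fun w => \sum_(i <- s) F i w) = \sum_(i <- s) Ex (F i).
Proof.
move=> iF; elim: s => [|i s IH].
  by under eq_fun do rewrite big_nil; rewrite Ex_cst big_nil.
under eq_fun do rewrite big_cons; rewrite ExD//; last exact: L1_sum.
by rewrite IH big_cons.
Qed.

Lemma Ex_le X Y : L1 X -> L1 Y -> (forall w, X w <= Y w) -> Ex X <= Ex Y.
Proof. by move=> iX iY XY; exact: le_Rintegral. Qed.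

Lemma Ex_ge0 X : (forall w, 0 <= X w) -> 0 <= Ex X.
Proof. by move=> X0; exact: Rintegral_ge0. Qed.

Lemma norm_Ex X : L1 X -> `|Ex X| <= Ex (fun w => `|X w|).
Proof. exact: le_normr_Rintegral. Qed.

Lemma Ex_le_cst X (c : R) : L1 X -> (forall w, X w <= c) -> Ex X <= c.
Proof. by move=> iX Xc; rewrite -[c]Ex_cst; apply: Ex_le => //; exact: L1_cst. Qed.

Lemma measurable_gt X (e : R) : measurable_fun setT X -> measurable [set w | e < X w].
Proof.
move=> mX; rewrite (_ : mkset _ = X @^-1` `]e, +oo[).
  by rewrite -[X in measurable X]setTI; exact: mX.
by apply/seteqP; split => w /=; rewrite in_itv/= andbT.
Qed.

Lemma measurable_le X (e : R) : measurable_fun setT X -> measurable [set w | X w <= e].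
Proof.
move=> mX; rewrite (_ : mkset _ = X @^-1` `]-oo, e]).
  by rewrite -[X in measurable X]setTI; exact: mX.
by apply/seteqP; split => w /=; rewrite in_itv.
Qed.

Lemma fineP_le1 A : measurable A -> fine (P A) <= 1.
Proof. by move=> mA; rewrite -lee_fin fineK ?fin_num_measure// probability_le1. Qed.

Lemma fineP_ge0 A : 0 <= fine (P A).
Proof. exact: fine_ge0. Qed.

Lemma fineP_le A B : measurable A -> measurable B -> A `<=` B -> fine (P A) <= fine (P B).
Proof. by move=> mA mB AB; rewrite fine_le ?fin_num_measure// le_measure ?inE. Qed.

Lemma Ex_indic A : measurable A -> Ex (\1_A) = fine (P A).
Proof. by move=> mA; rewrite /Ex /Rintegral integral_indic// setIT. Qed.

Lemma L1_indic A : measurable A -> L1 (\1_A).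
Proof. by move=> mA; exact: integrable_indic. Qed.

Lemma Ex_le_prob X A (c : R) : 0 <= c -> measurable_fun setT X -> measurable A ->
  (forall w, `|X w| <= 1) -> (forall w, ~ A w -> X w <= c) ->
  Ex X <= c + fine (P A).
Proof.
move=> c0 mX mA X1 Xc; rewrite -Ex_indic// -[c]Ex_cst -ExD; [|exact: L1_cst|exact: L1_indic].
apply: Ex_le; first exact: L1_bounded X1.
  by apply: L1D; [exact: L1_cst|exact: L1_indic].
move=> w; rewrite indicE; case: (boolP (w \in A)) => [_|/negP/[!inE] /Xc XA].
  by rewrite ler_wpDl// (le_trans (ler_norm _)).
by rewrite addr0.
Qed.

(** Markov's inequality, the passage from mean errors to probabilities. *)
Lemma prob_norm_gt_le X (e : R) : 0 < e -> L1 X ->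
  fine (P [set w | e < `|X w|]) <= Ex (fun w => `|X w|) / e.
Proof.
move=> e0 iX; have mX := L1_measurable iX.
have mA : measurable [set w | e < `|X w|].
  by apply: measurable_gt; exact: measurableT_comp.
rewrite -Ex_indic// ler_pdivlMr// mulrC -ExZ; last exact: L1_indic.
apply: Ex_le; [exact/L1Z/L1_indic|exact: L1_norm|] => w.
rewrite indicE; case: (boolP (w \in _)) => [|_]; last by rewrite mulr0.
by rewrite inE/= mulr1 => /ltW.
Qed.

End expectation.

(** * Conditioning on a countable code of the past *)

Section determined.
Context {R : realType} {d : measure_display} {T : measurableType d}.
Variable P : probability T R.
Variable C : countType.
Implicit Types (H : T -> C).

Definition measurable_fibers H := forall a, measurable (H @^-1` [set a]).

(** For a countable code this stands for measurability with respect to the sigma-algebra of [H], and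
    it is checked pointwise. *)
Definition determined_by H {V : Type} (g : T -> V) := forall w w', H w = H w' -> g w = g w'.

(** A preimage is a union of fibres of [H], indexed by [pickle], hence a countable one. *)
Lemma determined_measurable H (g : T -> R) : measurable_fibers H ->
  determined_by H g -> measurable_fun setT g.
Proof.
move=> mH Hg _ B mB; rewrite setTI.
pose F (n : nat) := [set w | B (g w) /\ pickle (H w) = n].
have -> : g @^-1` B = \bigcup_n F n.
  by apply/seteqP; split => w /=; [move=> Bw; exists (pickle (H w))|case=> n _ []].
apply: bigcup_measurable => n _.
have [[w [Bw wn]]|Fn] := pselect (exists w, F n w).
  suff -> : F n = H @^-1` [set H w] by exact: mH.
  apply/seteqP; split => w'; rewrite /F /=; rewrite -wn.
    by move=> [_ /(pcan_inj pickleK)].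
  by move=> e; rewrite e (Hg w' w).
suff -> : F n = set0 by exact: measurable0.
by rewrite -subset0 => w wF; apply: Fn; exists w.
Qed.

(** The fibres cut the space into countably many atoms; a zero integral on each of them is what a
    vanishing conditional expectation amounts to. *)
Lemma Ex_eq0_fibers H (X : T -> R) : measurable_fibers H -> L1 P X ->
  (forall w, (\int[P]_(w' in H @^-1` [set H w]) (X w')%:E = 0)%E) -> Ex P X = 0.
Proof.
move=> mH iX X0; rewrite /Ex /Rintegral.
pose F (n : nat) := [set w | pickle (H w) = n].
have FE n : F n = set0 \/ exists w, F n = H @^-1` [set H w].
  have [[w wn]|Fn] := pselect (exists w, F n w); last first.
    by left; rewrite -subset0 => w wF; apply: Fn; exists w.
  right; exists w; apply/seteqP; split => w'; rewrite /F /= -wn.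
    by move=> /(pcan_inj pickleK).
  by move=> ->.
have UF : \bigcup_n F n = setT by rewrite -subTset => w _; exists (pickle (H w)).
have mF k : measurable (F k) by case: (FE k) => [->|[w ->]].
rewrite -UF integral_bigcup//; last by rewrite UF.
- rewrite eseries0 => [//|n _ _].
  by case: (FE n) => [->|[w ->]]; rewrite ?integral_set0.
- by apply/trivIsetP => i j _ _ ij; rewrite -subset0 => w [/= wi wj]; move: ij; rewrite -wi -wj eqxx.
Qed.

End determined.

(** * A central limit theorem for bounded martingale differences *)

Section martingale.
Context {R : realType} {d : measure_display} {T : measurableType d}.
Variable P : probability T R.
Variable C : countType.
Local Notation Ex := (Ex P).
Local Notation L1 := (L1 P).

(** A filtration presented as successively finer countable partitions, up to a finite horizon. *)
Record history (H : nat -> T -> C) (N : nat) : Prop := History {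
  hist_fibers : forall k, (k <= N)%N -> measurable_fibers (H k) ;
  hist_refine : forall k w w', (k < N)%N -> H k.+1 w = H k.+1 w' -> H k w = H k w' }.

(** [md_orth] encodes a zero conditional mean given [H k] by testing against bounded functions of
    [H k]. The indices are shifted: [Y k] is known at time [k.+1]. *)
Record mart_diff (H : nat -> T -> C) (N : nat) (Y : nat -> T -> R) (c : R) : Prop := MartDiff {
  md_bound_ge0 : 0 <= c ;
  md_adapted : forall k, (k < N)%N -> determined_by (H k.+1) (Y k) ;
  md_bounded : forall k w, (k < N)%N -> `|Y k w| <= c ;
  md_orth : forall k (g : T -> R) (b : R), (k < N)%N -> determined_by (H k) g ->
    (forall w, `|g w| <= b) -> Ex (fun w => g w * Y k w) = 0 }.

Variables (H : nat -> T -> C) (N : nat) (hH : history H N).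

Lemma history_le k l w w' : (k <= l)%N -> (l <= N)%N -> H l w = H l w' -> H k w = H k w'.
Proof.
move=> + lN; elim: l lN => [|l IH] lN; first by rewrite leqn0 => /eqP ->.
rewrite leq_eqVlt ltnS => /orP[/eqP -> //|kl] e.
by apply: IH => //; [exact: ltnW|exact: (hist_refine hH)].
Qed.

Lemma determined_le {V : Type} k l (g : T -> V) : (k <= l)%N -> (l <= N)%N ->
  determined_by (H k) g -> determined_by (H l) g.
Proof. by move=> kl lN Hg w w' /(history_le kl lN); exact: Hg. Qed.

Lemma determined_sum (g : nat -> T -> R) k : (k <= N)%N ->
  (forall j, (j < N)%N -> determined_by (H j.+1) (g j)) ->
  determined_by (H k) (fun w => \sum_(j < k) g j w).
Proof.
move=> kN Hg w w' e; apply: eq_bigr => j _.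
have jN : (j < N)%N by exact: leq_trans kN.
by apply: (Hg j jN); apply: (history_le _ kN).
Qed.

Lemma norm_sum_le (g : nat -> T -> R) (c : R) k w : (k <= N)%N ->
  (forall j, (j < N)%N -> `|g j w| <= c) -> `|\sum_(j < k) g j w| <= k%:R * c.
Proof.
move=> kN gc; apply: (le_trans (ler_norm_sum _ _ _)).
apply: (@le_trans _ _ (\sum_(j < k) c)).
  by apply: ler_sum => j _; apply: gc; apply: leq_trans kN.
by rewrite sumr_const card_ord mulr_natl.
Qed.

Lemma determined_L1 k (g : T -> R) (b : R) : (k <= N)%N -> determined_by (H k) g ->
  (forall w, `|g w| <= b) -> L1 g.
Proof.
move=> kN Hg; apply: L1_bounded.
exact: determined_measurable (hist_fibers hH kN) Hg.
Qed.

(** The cross term is [md_orth] tested against the partial sum, which is bounded by [k%:R * c]. *)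
Lemma mart_sum_sqr Y (c : R) : mart_diff H N Y c ->
  Ex (fun w => (\sum_(k < N) Y k w) ^+ 2) = \sum_(k < N) Ex (fun w => Y k w ^+ 2).
Proof.
move=> mY.
suff : forall k, (k <= N)%N ->
  Ex (fun w => (\sum_(j < k) Y j w) ^+ 2) = \sum_(j < k) Ex (fun w => Y j w ^+ 2) by exact.
elim => [_|k IH kN].
  under eq_fun do rewrite big_ord0 expr0n /=.
  by rewrite Ex_cst big_ord0.
rewrite big_ord_recr /= -IH; last exact: ltnW.
set S := fun w => \sum_(j < k) Y j w.
have HS : determined_by (H k) S.
  by apply: determined_sum; [exact: ltnW|exact: md_adapted mY].
have Sb w : `|S w| <= k%:R * c.
  by apply: norm_sum_le; [exact: ltnW|move=> j jN; exact: (md_bounded mY)].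
have Yb w : `|Y k w| <= c by exact: (md_bounded mY).
have HY := md_adapted mY kN.
have HS1 := determined_le (leqnSn k) kN HS.
have c0 := md_bound_ge0 mY.
have i1 : L1 (fun w => S w ^+ 2).
  apply: (@determined_L1 k _ ((k%:R * c) ^+ 2)); first exact: ltnW.
    by move=> w w' e; rewrite (HS w w').
  by move=> w; rewrite normrX lerXn2r ?nnegrE ?mulr_ge0.
have i2 : L1 (fun w => Y k w ^+ 2).
  apply: (@determined_L1 k.+1 _ (c ^+ 2)) => //.
    by move=> w w' e; rewrite (HY w w').
  by move=> w; rewrite normrX lerXn2r ?nnegrE ?mulr_ge0.
have i3 : L1 (fun w => S w * Y k w).
  apply: (@determined_L1 k.+1 _ (k%:R * c * c)) => //.
    by move=> w w' e; rewrite (HY w w')// (HS1 w w').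
  by move=> w; rewrite normrM ler_pM.
transitivity (Ex (fun w => S w ^+ 2 + 2 * (S w * Y k w) + Y k w ^+ 2)).
  by congr (Ex _); apply/funext => w; rewrite big_ord_recr /= -/(S w); ring.
rewrite ExD//; last by apply: L1D => //; exact: L1Z.
rewrite ExD//; last exact: L1Z.
by rewrite ExZ// (md_orth mY (b := k%:R * c)) // mulr0 addr0.
Qed.

(** [v k] is the conditional variance of [Y k] given [H k], again expressed by orthogonality; unlike
    [Y k] it is already known at time [k]. *)
Record cond_variance (Y v : nat -> T -> R) (c : R) : Prop := CondVariance {
  cv_predictable : forall k, (k < N)%N -> determined_by (H k) (v k) ;
  cv_ge0 : forall k w, (k < N)%N -> 0 <= v k w ;
  cv_le : forall k w, (k < N)%N -> v k w <= c ^+ 2 ;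
  cv_orth : forall k (g : T -> R) (b : R), (k < N)%N -> determined_by (H k) g ->
    (forall w, `|g w| <= b) -> Ex (fun w => g w * (Y k w ^+ 2 - v k w)) = 0 }.

(** The sum runs up to index [k] included and is nevertheless known at time [k]. This is what makes
    the stopping rule below predictable. *)
Lemma predictable_sum (g : nat -> T -> R) k : (k < N)%N ->
  (forall j, (j < N)%N -> determined_by (H j) (g j)) ->
  determined_by (H k) (fun w => \sum_(j < k.+1) g j w).
Proof.
move=> kN Hg w w' e; apply: eq_bigr => j _.
have jk : (j <= k)%N by rewrite -ltnS.
have jN : (j < N)%N by exact: leq_ltn_trans kN.
by apply: (Hg j jN); apply: (history_le jk (ltnW kN)).
Qed.

Section stopped.
Variables (Y v : nat -> T -> R) (c : R).
Hypotheses (mY : mart_diff H N Y c) (vY : cond_variance Y v c).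
Variables (b e y : R).
Hypotheses (b0 : 0 <= b) (e0 : 0 < e).

Let V k w := \sum_(j < k) v j w.
(* Stopping when the accumulated conditional variance exceeds b is predictable and keeps the
   remaining time of the heat equation nonnegative. *)
Let chi k w : R := (V k.+1 w <= b)%R%:R.
Let Y' k w := chi k w * Y k w.
Let v' k w := chi k w * v k w.
Let S' k w := \sum_(j < k) Y' j w.
Let V' k w := \sum_(j < k) v' j w.
(** The heat solution along the stopped path: the variance already spent is taken out of the
    remaining time, so that the expectation is nearly constant in [k]. *)
Let f k w := heat y (b + e - V' k w) (S' k w).

Let chi_det k : (k < N)%N -> determined_by (H k) (chi k).
Proof.
move=> kN w w' E; rewrite /chi /V.
by rewrite (predictable_sum kN (cv_predictable vY) E).
Qed.

Let chi_01 k w : chi k w = 0 \/ chi k w = 1.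
Proof. by rewrite /chi; case: (_ <= _)%R; [right|left]. Qed.

Let chi_sqr k w : chi k w * chi k w = chi k w.
Proof. by case: (chi_01 k w) => ->; rewrite ?mul0r ?mulr1. Qed.

Let chi_norm k w : `|chi k w| <= 1.
Proof. by case: (chi_01 k w) => ->; rewrite ?normr0 ?normr1. Qed.

Let v'_det k : (k < N)%N -> determined_by (H k) (v' k).
Proof.
by move=> kN w w' E; rewrite /v' (chi_det kN E) (cv_predictable vY kN E).
Qed.

Let Y'_det k : (k < N)%N -> determined_by (H k.+1) (Y' k).
Proof.
move=> kN w w' E; rewrite /Y' (md_adapted mY kN E).
by rewrite (determined_le (leqnSn k) kN (chi_det kN) E).
Qed.

Let v'_ge0 k w : (k < N)%N -> 0 <= v' k w.
Proof. by move=> kN; rewrite mulr_ge0 ?ler0n// (cv_ge0 vY). Qed.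

Let v'_le k w : (k < N)%N -> v' k w <= c ^+ 2.
Proof.
move=> kN; rewrite /v'; case: (chi_01 k w) => ->; rewrite ?mul1r ?mul0r ?sqr_ge0//.
exact: (cv_le vY).
Qed.

Let Y'_le k w : (k < N)%N -> `|Y' k w| <= c.
Proof.
move=> kN; rewrite /Y' normrM.
by rewrite (le_trans (ler_piMl _ (chi_norm k w)))// (md_bounded mY).
Qed.

Let V'_ge0 k w : (k <= N)%N -> 0 <= V' k w.
Proof.
by move=> kN; apply: sumr_ge0 => j _; apply: v'_ge0; apply: leq_trans kN.
Qed.

(** The test in [chi] includes the variance of the step about to be made, so the budget [b] is never
    overshot. *)
Let V'_le k w : (k <= N)%N -> V' k w <= b /\ V' k w <= V k w.
Proof.
elim: k => [_|k IH kN]; first by rewrite /V' /V !big_ord0.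
have [i1 i2] := IH (ltnW kN).
have vk := cv_ge0 vY w kN.
rewrite /V' /V !big_ord_recr /= -/(V' k w) -/(V k w) /v' /chi.
have [le_b|_] := boolP (V k.+1 w <= b)%R.
  move: le_b; rewrite /V big_ord_recr /= -/(V k w) => le_b.
  by rewrite mul1r; split; lra.
by rewrite mul0r; split; lra.
Qed.

Let S'_det k : (k <= N)%N -> determined_by (H k) (S' k).
Proof. by move=> kN; exact: determined_sum. Qed.

Let V'_pdet k : (k < N)%N -> determined_by (H k) (V' k.+1).
Proof. by move=> kN; apply: predictable_sum. Qed.

Let V'_det k : (k <= N)%N -> determined_by (H k) (V' k).
Proof.
case: k => [_ w w' _|k kN]; first by rewrite /V' !big_ord0.
exact: determined_le (leqnSn k) kN (V'_pdet kN).
Qed.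

Let f_norm k w : `|f k w| <= 1.
Proof. by rewrite ger0_norm ?heat_ge0 ?heat_le1. Qed.

Let f_det k : (k <= N)%N -> determined_by (H k) (f k).
Proof. by move=> kN w w' E; rewrite /f (V'_det kN E) (S'_det kN E). Qed.

Let f_L1 k : (k <= N)%N -> L1 (f k).
Proof. by move=> kN; exact: determined_L1 (f_det kN) (f_norm k). Qed.

Let v'_L1 k : (k < N)%N -> L1 (v' k).
Proof.
move=> kN; apply: determined_L1 (ltnW kN) (v'_det kN) _ => w.
by rewrite ger0_norm ?v'_ge0//; exact: v'_le.
Qed.

Variable K : R.
Hypothesis K0 : 0 <= K.
Hypothesis taylorK : forall y s v x u, e <= s -> 0 <= v ->
  [/\ `|heat_x y s x| <= K, `|heat_xx y s x| <= K,
      `|heat y (s + v) x - heat y s x| <= K * v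
    & `|heat y s (x + u) - heat y (s + v) x - heat_x y s x * u
        - 2^-1 * heat_xx y s x * (u ^+ 2 - v)| <= K * (`|u| ^+ 3 + v ^+ 2)].

(** In the expansion of [heat_taylor] the first order term and the [u ^+ 2 - v] term have mean zero.
    The remainder is charged to [v']: the cube of the stopped increment is at most [c] times its
    square, whose mean is that of [v'], and [v' ^+ 2 <= c ^+ 2 * v']. *)
Let step k : (k < N)%N ->
  `|Ex (f k.+1) - Ex (f k)| <= K * (c + c ^+ 2) * Ex (v' k).
Proof.
move=> kN; have c0 := md_bound_ge0 mY.
pose s w := b + e - V' k.+1 w.
have es w : e <= s w by have [? _] := V'_le w kN; rewrite /s; lra.
have sE w : b + e - V' k w = s w + v' k w by rewrite /s /V' big_ord_recr /=; ring.
have SE w : S' k.+1 w = S' k w + Y' k w by rewrite /S' big_ord_recr.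
pose gx w := heat_x y (s w) (S' k w) * chi k w.
pose gxx w := 2^-1 * heat_xx y (s w) (S' k w) * chi k w.
have s_det : determined_by (H k) s.
  by move=> w w' E; rewrite /s (V'_pdet kN E).
have gx_det : determined_by (H k) gx.
  by move=> w w' E; rewrite /gx (s_det _ _ E) (S'_det (ltnW kN) E) (chi_det kN E).
have gxx_det : determined_by (H k) gxx.
  by move=> w w' E; rewrite /gxx (s_det _ _ E) (S'_det (ltnW kN) E) (chi_det kN E).
have gx_b w : `|gx w| <= K.
  have [B _ _ _] := taylorK y (S' k w) 0 (es w) (lexx 0).
  by rewrite /gx normrM (le_trans (ler_piMr _ (chi_norm k w))).
have gxx_b w : `|gxx w| <= K.
  have [_ B _ _] := taylorK y (S' k w) 0 (es w) (lexx 0).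
  rewrite /gxx normrM (le_trans (ler_piMr _ (chi_norm k w)))// normrM ger0_norm//.
  by have := normr_ge0 (heat_xx y (s w) (S' k w)); lra.
have oA := md_orth mY kN gx_det gx_b.
have oB := cv_orth vY kN gxx_det gxx_b.
have oC := cv_orth vY kN (chi_det kN) (chi_norm k).
have det1 := @determined_le R k k.+1 _ (leqnSn k) kN.
have Y_det := md_adapted mY kN.
have v_det := det1 _ (cv_predictable vY kN).
have chi1 := det1 _ (chi_det kN).
have gx1 := det1 _ gx_det.
have gxx1 := det1 _ gxx_det.
have vb w : `|v k w| <= c ^+ 2 by rewrite ger0_norm ?(cv_le vY) ?(cv_ge0 vY).
have Yb w : `|Y k w| <= c := md_bounded mY w kN.
have Y2b w : `|Y k w ^+ 2| <= c ^+ 2 by rewrite normrX lerXn2r ?nnegrE.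
have Yvb w : `|Y k w ^+ 2 - v k w| <= c ^+ 2 + c ^+ 2.
  by rewrite (le_trans (ler_normB _ _))// lerD.
have iA : L1 (fun w => gx w * Y k w).
  apply: (@determined_L1 k.+1 _ (K * c)) => // [w w' E|w].
    by rewrite (gx1 _ _ E) (Y_det _ _ E).
  by rewrite normrM ler_pM.
have iB : L1 (fun w => gxx w * (Y k w ^+ 2 - v k w)).
  apply: (@determined_L1 k.+1 _ (K * (c ^+ 2 + c ^+ 2))) => // [w w' E|w].
    by rewrite (gxx1 _ _ E) (Y_det _ _ E) (v_det _ _ E).
  by rewrite normrM ler_pM.
have iY2 : L1 (fun w => chi k w * Y k w ^+ 2).
  apply: (@determined_L1 k.+1 _ (1 * c ^+ 2)) => // [w w' E|w].
    by rewrite (chi1 _ _ E) (Y_det _ _ E).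
  by rewrite normrM ler_pM.
have iv := v'_L1 kN.
have EY2 : Ex (fun w => chi k w * Y k w ^+ 2) = Ex (v' k).
  apply/eqP; rewrite -subr_eq0 -ExB// -[X in _ == X]oC; apply/eqP.
  by congr (Ex _); apply/funext => w; rewrite /v'; ring.
have i1 := f_L1 kN; have i0 := f_L1 (ltnW kN).
rewrite -ExB//.
pose D w := f k.+1 w - f k w - gx w * Y k w - gxx w * (Y k w ^+ 2 - v k w).
have iD1 : L1 (fun w => f k.+1 w - f k w - gx w * Y k w) by apply: L1B iA; exact: L1B.
have iD : L1 D by exact: L1B iD1 iB.
have -> : Ex (fun w => f k.+1 w - f k w) = Ex D.
  by rewrite (ExB iD1 iB) oB subr0 (ExB (L1B i1 i0) iA) oA subr0.
rewrite (le_trans (norm_Ex iD))//.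
have -> : K * (c + c ^+ 2) * Ex (v' k) = Ex (fun w => K * c * (chi k w * Y k w ^+ 2) + K * c ^+ 2 * v' k w).
  rewrite ExD//; [|exact: L1Z|exact: L1Z].
  by rewrite !ExZ// EY2; ring.
apply: Ex_le; [exact: L1_norm|by apply: L1D; exact: L1Z|move=> w].
have v'0 := v'_ge0 w kN.
have [_ _ _] := taylorK y (S' k w) (Y' k w) (es w) v'0.
rewrite -sE -SE -/(f k w) -[heat _ _ _]/(f k.+1 w).
have -> : f k.+1 w - f k w - heat_x y (s w) (S' k w) * Y' k w -
    2^-1 * heat_xx y (s w) (S' k w) * (Y' k w ^+ 2 - v' k w) = D w.
  rewrite /D /gx /gxx /Y' /v'.
  by rewrite [(_ * _) ^+ 2]expr2 mulrACA chi_sqr -expr2; ring.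
move/le_trans; apply.
rewrite -mulrA -[X in _ <= _ + X]mulrA -mulrDr ler_wpM2l//.
apply: lerD.
  have -> : chi k w * Y k w ^+ 2 = `|Y' k w| ^+ 2.
    by rewrite real_normK ?num_real// /Y' [RHS]expr2 mulrACA chi_sqr -expr2.
  by rewrite exprS ler_wpM2r ?exprn_ge0// Y'_le.
by rewrite expr2 ler_wpM2r// v'_le.
Qed.

(** Telescoping of the steps; the total of [v'] is at most [b], whatever the number [N] of steps. *)
Lemma stopped_heat_bound :
  `|Ex (f N) - heat y (b + e) 0| <= K * (c + c ^+ 2) * b.
Proof.
have c0 := md_bound_ge0 mY.
suff : forall k, (k <= N)%N -> `|Ex (f k) - heat y (b + e) 0| <= K * (c + c ^+ 2) * Ex (V' k).
  move=> /(_ N (leqnn N)) /le_trans; apply.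
  apply: ler_wpM2l; first by rewrite mulr_ge0// addr_ge0// sqr_ge0.
  apply: Ex_le_cst => [|w]; last by have [] := V'_le w (leqnn N).
  apply: (determined_L1 (leqnn N) (V'_det (leqnn N)) (b := b)) => w.
  by rewrite ger0_norm ?V'_ge0//; have [] := V'_le w (leqnn N).
elim => [_|k IH kN].
  have -> : f 0 = fun=> heat y (b + e) 0.
    by apply/funext => w; rewrite /f /V' /S' !big_ord0 subr0.
  by rewrite Ex_cst subrr normr0 mulr_ge0 ?mulr_ge0 ?addr_ge0 ?sqr_ge0// Ex_ge0// => w; exact: V'_ge0.
have -> : Ex (V' k.+1) = Ex (V' k) + Ex (v' k).
  rewrite -ExD; [|apply: (determined_L1 (ltnW kN) (V'_det (ltnW kN)) (b := b)) => w|exact: v'_L1].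
    by congr (Ex _); apply/funext => w; rewrite /V' big_ord_recr.
  by rewrite ger0_norm ?V'_ge0 1?ltnW//; have [] := V'_le w (ltnW kN).
rewrite mulrDr [leRHS]addrC (le_trans (ler_distD (Ex (f k)) _ _))// lerD//; first exact: step.
by apply: IH; exact: ltnW.
Qed.

(** When the total conditional variance is within [eta] of [nu], nothing is stopped and at most
    [2 * eta] of the time budget is left over, which costs [2 * K * eta]. On the exceptional event
    two values in [[0, 1]] are compared. *)
Lemma mart_heat_bound (nu eta : R) : b = nu + eta -> 0 <= eta ->
  `|Ex (fun w => heat y e (\sum_(k < N) Y k w)) - heat y (nu + eta + e) 0| <=
  K * (c + c ^+ 2) * (nu + eta) + 2 * K * eta
  + fine (P [set w | eta < `|\sum_(k < N) v k w - nu|]).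
Proof.
move=> bE eta0; rewrite -bE.
have YN_det := determined_sum (leqnn N) (md_adapted mY).
have VN_det : determined_by (H N) (V N).
  apply: determined_sum => // j jN.
  exact: determined_le (leqnSn j) jN (cv_predictable vY jN).
have mF := hist_fibers hH (leqnn N).
set h := fun w => heat y e _.
have h_det : determined_by (H N) h by move=> w w' E; rewrite /h (YN_det _ _ E).
have h_b w : `|h w| <= 1 by rewrite ger0_norm ?heat_ge0 ?heat_le1.
have iN := f_L1 (leqnn N).
have ih : L1 h by exact: (determined_L1 _ h_det h_b).
set A := [set w | _ ].
have mA : measurable A.
  apply: measurable_gt; apply: measurableT_comp => //.
  by apply: measurable_funB => //; exact: (determined_measurable mF VN_det).
have -> : Ex h - heat y (b + e) 0 = (Ex (f N) - heat y (b + e) 0) + Ex (fun w => h w - f N w).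
  by rewrite ExB// [RHS]addrC subrKA.
rewrite -[leRHS]addrA (le_trans (ler_normD _ _))// lerD//; first exact: stopped_heat_bound.
have ihf : L1 (fun w => h w - f N w) by exact: L1B.
rewrite (le_trans (norm_Ex ihf))//.
have fdiff w : `|h w - f N w| <= 1.
  rewrite ler_norml; have := (heat_ge0 y e (\sum_(k < N) Y k w)).
  have := (heat_le1 y e (\sum_(k < N) Y k w)).
  have := (heat_ge0 y (b + e - V' N w) (S' N w)).
  have := (heat_le1 y (b + e - V' N w) (S' N w)).
  by rewrite /h /f => *; apply/andP; split; lra.
apply: Ex_le_prob => //.
- by rewrite mulr_ge0// mulr_ge0.
- exact: L1_measurable (L1_norm ihf).
- by move=> w; rewrite normr_id.
move=> w; rewrite /A /= => /negP; rewrite -leNgt ler_norml => /andP[l1 l2].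
have Vle k : (k <= N)%N -> V k w <= V N w.
  move=> kN; rewrite /V -!(big_mkord xpredT (fun j => v j w)) (big_cat_nat (n := k) (p := N))//=.
  rewrite lerDl big_nat_cond sumr_ge0// => j /andP[/andP[_ jN] _].
  exact: (cv_ge0 vY).
have chi1 k : (k < N)%N -> chi k w = 1.
  move=> kN; rewrite /chi (_ : (V k.+1 w <= b)%R = true)//.
  by apply: (le_trans (Vle _ kN)); rewrite bE /V; lra.
have SE : S' N w = \sum_(k < N) Y k w.
  by apply: eq_bigr => j _; rewrite /Y' chi1// mul1r.
have VE : V' N w = V N w.
  by apply: eq_bigr => j _; rewrite /v' chi1// mul1r.
have VNb : V N w <= b by rewrite /V bE; lra.
have bV : 0 <= b - V N w by lra.
have [_ _ B _] := taylorK y (\sum_(k < N) Y k w) 0 (lexx e) bV.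
rewrite /h /f SE VE distrC (_ : b + e - V N w = e + (b - V N w)); last by ring.
apply: (le_trans B); rewrite [2 * K]mulrC -mulrA ler_wpM2l//.
by rewrite /V bE; lra.
Qed.

End stopped.
End martingale.

Lemma chain_le {R : realType} (p E h1 h2 h3 e1 e2 e3 q f k : R) :
  `|E - h1| <= e1 -> `|h1 - h2| <= e2 -> `|h2 - h3| <= e3 -> p <= E + q + f ->
  e1 + e2 + e3 + q + f <= k -> p - h3 <= k.
Proof.
rewrite !ler_norml => /andP[_ ?] /andP[_ ?] /andP[_ ?]; lra.
Qed.

Lemma chain_ge {R : realType} (p E h1 h2 h3 e1 e2 e3 q f k : R) :
  `|E - h1| <= e1 -> `|h1 - h2| <= e2 -> `|h2 - h3| <= e3 -> E - q - f <= p ->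
  e1 + e2 + e3 + q + f <= k -> - k <= p - h3.
Proof.
rewrite !ler_norml => /andP[? _] /andP[? _] /andP[? _]; lra.
Qed.

Lemma clt_budget {R : realType} (K1 K2 nu q eta r zr A f : R) :
  A <= 2 * K2 * (nu + 1) * eta -> f <= eta ->
  0 <= K1 * eta -> 0 <= K2 * eta -> 0 <= 2 * K2 * (nu + 1) * eta -> 0 <= q -> 0 < eta ->
  K1 * (r ^+ 2 + zr) <= q ->
  2 * K1 * eta + 2 * K2 * (nu + 1) * eta + 2 * K2 * eta + 2 * eta <= q ->
  A + 2 * K2 * eta + eta + K1 * (eta + r ^+ 2) + K1 * (eta + zr) + q + f <= 8 * q.
Proof.
rewrite !(mulrDr K1) -(mulrA _ (nu + 1)) -!(mulrA 2).
move: (K1 * eta) (K1 * r ^+ 2) (K1 * zr) (K2 * ((nu + 1) * eta)) (K2 * eta) => *; lra.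
Qed.

Section clt.
Context {R : realType} {d : measure_display} {T : measurableType d}.
Variable P : probability T R.
Local Notation Ex := (Ex P).
Local Notation L1 := (L1 P).

Lemma ExDcst X Z q : L1 X -> L1 Z -> Ex (fun w => X w + q + Z w) = Ex X + q + Ex Z.
Proof.
move=> iX iZ; have iq := L1_cst P q.
by rewrite ExD ?ExD ?Ex_cst//; exact: L1D.
Qed.

Lemma L1Dcst X Z q : L1 X -> L1 Z -> L1 (fun w => X w + q + Z w).
Proof. by move=> iX iZ; do 2 apply: L1D => //; exact: L1_cst. Qed.

(* Both inequalities compare 1{X <= y} with the smoothed indicator [heat _ (r ^+ 2) S]. *)
Lemma smoothing (S X : T -> R) (y q eta z r : R) :
  measurable_fun setT S -> measurable_fun setT X -> 0 < r -> 0 <= q ->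
  (forall y e, measurable_fun setT (fun w => heat y e (S w))) ->
  gauss_cdf (- z) <= q -> 1 - q <= gauss_cdf z ->
  fine (P [set w | X w <= y]) <=
    Ex (fun w => heat (y + eta + z * r) (r ^+ 2) (S w)) + q + fine (P [set w | eta < `|X w - S w|]) /\
  Ex (fun w => heat (y - eta - z * r) (r ^+ 2) (S w)) - q - fine (P [set w | eta < `|X w - S w|]) <=
    fine (P [set w | X w <= y]).
Proof.
move=> mS mX r0 q0 mh zq z1.
have mA : measurable [set w | X w <= y] by exact: measurable_le.
have mB : measurable [set w | eta < `|X w - S w|].
  by apply: measurable_gt; apply: measurableT_comp => //; exact: measurable_funB.
have hL1 y' : L1 (fun w => heat y' (r ^+ 2) (S w)).
  by apply: (@L1_bounded _ _ _ P _ 1) => // w; rewrite ger0_norm ?heat_ge0 ?heat_le1.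
have sr : Num.sqrt (r ^+ 2) = r by rewrite sqrtr_sqr gtr0_norm.
have iA := L1_indic P mA; have iB := L1_indic P mB.
rewrite -(Ex_indic P mA) -(Ex_indic P mB); split.
- rewrite -ExDcst//; apply: Ex_le => // [|w]; first exact: L1Dcst.
  have h0 := heat_ge0 (y + eta + z * r) (r ^+ 2) (S w).
  rewrite !indicE; case: (boolP (w \in [set w | eta < _])) => [_|/negP B].
    by case: (_ \in _) => /=; lra.
  case: (boolP (w \in _)) => [|_]; last by rewrite /=; lra.
  rewrite inE /= => Xy; move: B; rewrite inE /= => /negP; rewrite -leNgt ler_norml => /andP[B1 B2].
  suff : 1 - q <= heat (y + eta + z * r) (r ^+ 2) (S w) by lra.
  apply: (le_trans z1); rewrite /heat sr; apply: gauss_cdf_nondecreasing.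
  by rewrite ler_pdivlMr//; lra.
- rewrite lerBlDr lerBlDr [leRHS]addrAC -ExDcst//; apply: Ex_le => // [|w]; first exact: L1Dcst.
  have h1 := heat_le1 (y - eta - z * r) (r ^+ 2) (S w).
  rewrite !indicE; case: (boolP (w \in [set w | eta < _])) => [_|/negP B].
    by case: (_ \in _) => /=; lra.
  case: (boolP (w \in _)) => [_|]; first by rewrite /=; lra.
  rewrite notin_setE /= => /negP; rewrite -ltNge => Xy.
  move: B; rewrite inE /= => /negP; rewrite -leNgt ler_norml => /andP[B1 B2].
  suff : heat (y - eta - z * r) (r ^+ 2) (S w) <= q by lra.
  apply: le_trans zq; rewrite /heat sr; apply: gauss_cdf_nondecreasing.
  by rewrite ler_pdivrMr//; lra.
Qed.

(** The tolerance [eta] is fixed before the array, so one statement serves every type of codes and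
    every length. The variable [X] need only be close to the martingale in probability: it will be
    the score over all edges, while the martingale sees only those on the grid. *)
Theorem martingale_clt (nu y k : R) : 0 < nu -> 0 < k ->
  exists2 eta, 0 < eta &
  forall (C : countType) (H : nat -> T -> C) N (Y v : nat -> T -> R) (c : R) (X : T -> R),
    history H N -> mart_diff P H N Y c -> cond_variance P H N Y v c ->
    measurable_fun setT X -> c <= eta ->
    fine (P [set w | eta < `|\sum_(k < N) v k w - nu|]) <= eta ->
    fine (P [set w | eta < `|X w - \sum_(k < N) Y k w|]) <= eta ->
    `|fine (P [set w | X w <= y]) - gauss_cdf (y / Num.sqrt nu)| <= k.
Proof.
(* The order of the choices is forced: [z] for the Gaussian tails, then the smoothing width [r] from
   the Lipschitz constant [K1] at time [nu], then [K2], which depends on [r], and finally [eta].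
   Three shares [q] are spent; eight are allowed. *)
move=> nu0 k0; pose q := k / 8; have q0 : 0 < q by rewrite divr_gt0.
have [z z0 [zq z1]] := @gauss_cdf_tails R _ q0.
have [K1 K10 T1] := heat_taylor nu0.
pose r := Num.min 1 (q / ((K1 + 1) * (1 + z))).
have D0 : 0 < (K1 + 1) * (1 + z) by rewrite mulr_gt0; lra.
have r0 : 0 < r by rewrite lt_min ltr01 divr_gt0.
have r1 : r <= 1 by rewrite ge_min lexx.
have rq : K1 * (r ^+ 2 + z * r) <= q.
  have : r <= q / ((K1 + 1) * (1 + z)) by rewrite ge_min lexx orbT.
  rewrite ler_pdivlMr// => Hr; apply: le_trans Hr.
  have rr : r ^+ 2 <= r by rewrite expr2 ler_piMr// ltW.
  have -> : r * ((K1 + 1) * (1 + z)) = K1 * (r + z * r) + (r + r * z) by ring.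
  have H1 : K1 * (r ^+ 2 + z * r) <= K1 * (r + z * r) by rewrite ler_wpM2l// lerD2r.
  have : 0 <= r * z by rewrite mulr_ge0// ltW.
  lra.
clearbody r; have e0 : 0 < r ^+ 2 by rewrite exprn_gt0.
have [K2 K20 T2] := heat_taylor e0.
pose D := 2 * K1 + 2 * K2 * (nu + 1) + 2 * K2 + 2.
have K2nu : 0 <= K2 * (nu + 1) by rewrite mulr_ge0//; lra.
have D1 : 0 < D by rewrite /D; lra.
pose eta := Num.min 1 (q / D).
have eta0 : 0 < eta by rewrite lt_min ltr01 divr_gt0.
have eta1 : eta <= 1 by rewrite ge_min lexx.
have etaq : D * eta <= q.
  by rewrite mulrC -ler_pdivlMr// ge_min lexx orbT.
move: etaq; rewrite /D 3!mulrDl => etaq {D1 D0}; clearbody eta; clear D.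
have qk : k = 8 * q by rewrite /q; field.
clearbody q.
exists eta => // C H N Y v c X hH mY vY mX ceta HV HX.
have c0 := md_bound_ge0 mY.
have err y' : `|Ex (fun w => heat y' (r ^+ 2) (\sum_(k < N) Y k w)) - heat y' (nu + eta + r ^+ 2) 0|
   <= K2 * (c + c ^+ 2) * (nu + eta) + 2 * K2 * eta + eta.
  have b0 : 0 <= nu + eta by rewrite addr_ge0// ltW.
  have := mart_heat_bound hH mY vY y' b0 K20 T2 (erefl _) (ltW eta0).
  by move=> /le_trans; apply; rewrite lerD2l.
have err1 : K2 * (c + c ^+ 2) * (nu + eta) <= 2 * K2 * (nu + 1) * eta.
  have cc : c + c ^+ 2 <= 2 * eta.
    have : c ^+ 2 <= c by rewrite expr2 ler_piMr// (le_trans ceta).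
    by lra.
  have -> : 2 * K2 * (nu + 1) * eta = K2 * (2 * eta) * (nu + 1) by ring.
  apply: ler_pM; [by rewrite mulr_ge0// addr_ge0// sqr_ge0|lra| |lra].
  by rewrite ler_wpM2l.
(* [heat] depends on [y - x] only, so a shift of the threshold is a shift of the starting point. *)
have lipy y' : `|heat y' nu 0 - heat y nu 0| <= K1 * `|y' - y|.
  have -> : heat y' nu 0 = heat y nu (y - y') by rewrite /heat subr0 opprB addrCA subrr addr0.
  have := @norm_MVT R (heat y nu) (heat_x y nu) 0 (y - y') K1.
  rewrite subr0 (distrC y'); apply => t _; first exact: is_derive_heat_x.
  by have [] := T1 y nu 0 t 0 (lexx _) (lexx _).
have lips y' : `|heat y' (nu + eta + r ^+ 2) 0 - heat y' nu 0| <= K1 * (eta + r ^+ 2).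
  have ve : 0 <= eta + r ^+ 2 by rewrite addr_ge0// ltW.
  by have [_ _ + _] := T1 y' nu (eta + r ^+ 2) 0 0 (lexx _) ve; rewrite addrA.
have mF := hist_fibers hH (leqnn N).
have SN_det := determined_sum hH (leqnn N) (md_adapted mY).
have mS := determined_measurable mF SN_det.
have [|U1 U2] := @smoothing (fun w => \sum_(k < N) Y k w) X y q eta z r mS mX r0 (ltW q0) _ zq z1.
  by move=> y' e; apply: (determined_measurable mF) => w w' E; rewrite (SN_det _ _ E).
have heatE : gauss_cdf (y / Num.sqrt nu) = heat y nu 0 by rewrite /heat subr0.
have K2eta : 0 <= K2 * eta by rewrite mulr_ge0// ltW.
have K1eta : 0 <= K1 * eta by rewrite mulr_ge0// ltW.
have K3eta : 0 <= 2 * K2 * (nu + 1) * eta by rewrite -!mulrA mulr_ge0// mulrA mulr_ge0// ltW.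
have zr : 0 <= eta + z * r by rewrite addr_ge0 ?mulr_ge0// ltW.
have budget := clt_budget err1 HX K1eta K2eta K3eta (ltW q0) eta0 rq etaq.
rewrite heatE qk ler_norml; apply/andP; split.
- apply: (chain_ge (err _) (lips _) _ U2 budget); apply: (le_trans (lipy _)).
  by rewrite (_ : y - eta - z * r - y = - (eta + z * r)) ?normrN ?ger0_norm//; ring.
- apply: (chain_le (err _) (lips _) _ U1 budget); apply: (le_trans (lipy _)).
  by rewrite (_ : y + eta + z * r - y = eta + z * r) ?ger0_norm//; ring.
Qed.

End clt.

(** * Degrees, likelihood and score of a realization *)

Section network.
Variables (m : nat -> nat) (x : nat -> nat -> nat).
Implicit Types (E F : seq (nat * nat)) (t i j v k n : nat).
Local Open Scope nat_scope.

Lemma degree_cat E F v : degree (E ++ F) v = degree E v + degree F v.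
Proof. by rewrite /degree !count_cat addnACA. Qed.

Lemma degree_seq1 e v : degree [:: e] v = (e.1 == v) + (e.2 == v).
Proof. by rewrite /degree /= !addn0. Qed.

Lemma degree_le_size E v : degree E v <= 2 * size E.
Proof. by rewrite mul2n -addnn leq_add ?count_size. Qed.

Lemma PAS t : 1 <= t -> PA m x t.+1 = PA m x t ++ new_edges x t.+1 (m t.+1).
Proof. by case: t. Qed.

Lemma new_edgesS t i : new_edges x t i.+1 = new_edges x t i ++ [:: (t, x t i.+1)].
Proof. by rewrite /new_edges -[in LHS](addn1 i) iotaD map_cat /= add1n. Qed.

Lemma PAstepS t i : PAstep m x t i.+1 = PAstep m x t i ++ [:: (t, x t i.+1)].
Proof. by rewrite /PAstep new_edgesS catA. Qed.

Lemma PAstep0 t : PAstep m x t.+1 0 = PA m x t.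
Proof. by rewrite /PAstep cats0. Qed.

Lemma PAstep_full t : 2 <= t -> PAstep m x t (m t) = PA m x t.
Proof. by case: t => [|[|t]]. Qed.

Definition Mtot n := \sum_(1 <= s < n.+1) m s.

Lemma MtotS n : Mtot n.+1 = Mtot n + m n.+1.
Proof. by rewrite /Mtot big_nat_recr. Qed.

Definition edge_sum {V : nmodType} n (f : nat -> nat -> V) : V :=
  (\sum_(2 <= t < n.+1) \sum_(1 <= i < (m t).+1) f t i)%R.

Hypothesis m_gt0 : forall t, 1 <= t -> 0 < m t.
Hypothesis x_lt : forall t i, 2 <= t -> 1 <= i <= m t -> x t i < t.

Lemma leq_Mtot n : n <= Mtot n.
Proof.
by elim: n => [//|n IH]; rewrite MtotS -[n.+1 in leqLHS]addn1 leq_add// m_gt0.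
Qed.

Lemma degree_stepE t i j : j < t ->
  degree (PAstep m x t i.+1) j = degree (PAstep m x t i) j + (x t i.+1 == j).
Proof. by move=> jt; rewrite PAstepS degree_cat degree_seq1 /= gtn_eqF. Qed.

Lemma degree_step_new t i : 2 <= t -> i <= m t -> degree (PA m x t.-1) t = 0 ->
  degree (PAstep m x t i) t = i.
Proof.
move=> t2 + d0; elim: i => [_|i IH it].
  by case: t t2 d0 => // t _; rewrite PAstep0.
rewrite PAstepS degree_cat degree_seq1 /= eqxx IH 1?ltnW// ltn_eqF ?addn0 ?addn1//.
by apply: x_lt; rewrite ?it.
Qed.

Lemma degree_step_future t i v : 2 <= t -> i <= m t -> t < v ->
  degree (PAstep m x t i) v = degree (PA m x t.-1) v.
Proof.
move=> t2 + tv; elim: i => [_|i IH it]; first by case: t t2 tv => // t _ _; rewrite PAstep0.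
rewrite PAstepS degree_cat degree_seq1 /= IH 1?ltnW// ltn_eqF// ltn_eqF ?addn0//.
by rewrite (leq_trans _ tv)// ltnW// ltnS x_lt// it.
Qed.

Lemma degree_future t v : t < v -> degree (PA m x t) v = 0.
Proof.
elim: t v => [|t IH] v tv; first by [].
case: t IH tv => [_|t IH] tv.
  by rewrite /= /degree !count_nseq /= !ltn_eqF//; case: v tv.
rewrite -PAstep_full// degree_step_future//= IH//.
exact: ltnW.
Qed.

Lemma degree_new t : 2 <= t -> degree (PA m x t) t = m t.
Proof.
move=> t2; rewrite -PAstep_full// degree_step_new//.
by apply: degree_future; case: t t2.
Qed.

Lemma degree_PA_gt0 t j : 1 <= t -> j <= t -> 0 < degree (PA m x t) j.
Proof.
elim: t j => // t IH j _; case: t IH => [_|t IH] jt.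
  rewrite /= /degree !count_nseq /=.
  by have := m_gt0 (leqnn 1); case: j jt => [|[|//]] _ /=; rewrite mul1n mul0n ?addn0 ?add0n.
move: jt; rewrite leq_eqVlt => /orP[/eqP ->|jt].
  by rewrite degree_new// m_gt0.
by rewrite PAS// degree_cat ltn_addr// IH.
Qed.

Lemma degree_PAstep_gt0 t i j : 2 <= t -> j < t -> 0 < degree (PAstep m x t i) j.
Proof.
case: t => [//|[//|t]] _ jt.
by rewrite /PAstep degree_cat ltn_addr// degree_PA_gt0.
Qed.

Lemma chosen_degree_gt0 t i : 2 <= t -> 1 <= i <= m t -> 0 < chosen_degree m x t i.
Proof. by move=> t2 it; rewrite /chosen_degree degree_PAstep_gt0// x_lt. Qed.

Lemma size_PA_le s t : s <= t -> size (PA m x s) <= size (PA m x t).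
Proof.
elim: t => [|t IH]; first by rewrite leqn0 => /eqP ->.
rewrite leq_eqVlt => /orP[/eqP -> //|st]; apply: leq_trans (IH st) _.
by case: t {IH st} => // t; rewrite [PA m x t.+2]PAS// size_cat leq_addr.
Qed.

(** A bound uniform in the edges: beyond it the series over the degrees in the score is constant. *)
Lemma chosen_degree_le n t i : 2 <= t <= n -> 1 <= i <= m t ->
  chosen_degree m x t i <= 2 * size (PA m x n).
Proof.
move=> /andP[t2 tn] it; apply: leq_trans (degree_le_size _ _) _.
rewrite leq_mul2l /=; apply: leq_trans (size_PA_le tn).
case: t t2 it {tn} => [//|[//|t]] _ it.
rewrite PAS// /PAstep !size_cat leq_add2l /new_edges !size_map !size_iota; lia.
Qed.

End network.

Section degree_sums.
Context {R : realType}.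
Variables (m : nat -> nat) (x : nat -> nat -> nat).
Hypothesis m_gt0 : forall t, (1 <= t)%N -> (0 < m t)%N.
Hypothesis x_lt : forall t i, (2 <= t)%N -> (1 <= i <= m t)%N -> (x t i < t)%N.
Implicit Types (phi psi : nat -> R) (delta : R) (t i j k n : nat).

(** The vertex [v_t] under construction is left out; its own degree enters in [degree_sum_next],
    once all its edges are laid. *)
Definition degree_sum phi t i : R := \sum_(j < t) phi (degree (PAstep m x t i) j).

Local Notation D := (chosen_degree m x).

Lemma degree_sumS phi t i : (2 <= t)%N -> (i < m t)%N ->
  degree_sum phi t i.+1 = degree_sum phi t i + (phi (D t i.+1).+1 - phi (D t i.+1)).
Proof.
move=> t2 it; have xt : (x t i.+1 < t)%N by apply: x_lt.
rewrite /degree_sum (bigD1 (Ordinal xt))//= [in RHS](bigD1 (Ordinal xt))//=.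
rewrite degree_stepE// eqxx addn1 /chosen_degree /=.
under eq_bigr => j jx.
  rewrite degree_stepE// (_ : (x t i.+1 == j) = false) ?addn0; last first.
    by apply/negbTE; rewrite eq_sym; apply: contra jx => /eqP jx; apply/eqP/val_inj.
  over.
by ring.
Qed.

Lemma degree_sum_next phi t : (2 <= t)%N ->
  degree_sum phi t.+1 0 = degree_sum phi t (m t) + phi (m t).
Proof.
move=> t2; rewrite /degree_sum big_ord_recr /= PAstep0 (degree_new x_lt)//.
by rewrite -PAstep_full.
Qed.

Lemma degree_sum_telescope phi t i : (2 <= t)%N -> (i <= m t)%N ->
  degree_sum phi t i = degree_sum phi t 0 + \sum_(1 <= l < i.+1) (phi (D t l).+1 - phi (D t l)).
Proof.
move=> t2; elim: i => [|i IH] it; first by rewrite big_geq ?addr0.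
by rewrite degree_sumS// IH 1?ltnW// [in RHS]big_nat_recr//= [RHS]addrA.
Qed.

Lemma degree_sum_2 phi : degree_sum phi 2 0 = phi (m 1%N) + phi (m 1%N).
Proof.
rewrite /degree_sum !big_ord_recl big_ord0 addr0 PAstep0 /=.
by rewrite /degree !count_nseq /= !mul1n !mul0n add0n addn0.
Qed.

(** Every vertex contributes at its birth, [v_0] and [v_1] both with degree [m 1], and every later
    edge raises the degree of one old vertex by one. The choice [phi k = k + delta] yields the total
    weight; indicators yield the degree counts and the score. *)
Lemma degree_sumE phi n : (1 <= n)%N ->
  degree_sum phi n.+1 0 = phi (m 1%N) + phi (m 1%N) + \sum_(2 <= t < n.+1) phi (m t)
    + edge_sum m n (fun t i => phi (D t i).+1 - phi (D t i)).
Proof.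
case: n => // n _; elim: n => [|n IH].
  by rewrite degree_sum_2 /edge_sum !big_geq// !addr0.
rewrite degree_sum_next// degree_sum_telescope// IH /edge_sum.
rewrite [in RHS]big_nat_recr//= [X in _ = _ + X]big_nat_recr//=; ring.
Qed.

Lemma total_weight_degree_sum delta t i :
  total_weight m x delta t i = degree_sum (fun k => k%:R + delta) t i.
Proof. by []. Qed.

Let succ_diff k delta : k.+1%:R + delta - (k%:R + delta) = 1.
Proof. by rewrite -natr1; ring. Qed.

(** The increment of [k + delta] along each edge is 1, so the weight does not depend on the vertices
    chosen. *)
Lemma total_weightE delta t i : (2 <= t)%N -> (i <= m t)%N ->
  total_weight m x delta t i = t%:R * delta + 2 * (Mtot m t.-1)%:R + i%:R.
Proof.
move=> t2 it; rewrite total_weight_degree_sum degree_sum_telescope//.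
under [X in _ + X]eq_bigr do rewrite succ_diff.
rewrite sumr_const_nat subn1 /=; congr (_ + _).
case: t t2 it => [//|[//|t]] _ it /=; rewrite degree_sumE//.
have -> : edge_sum m t.+1 (fun t i => ((D t i).+1%:R : R) + delta - ((D t i)%:R + delta))
   = \sum_(2 <= s < t.+2) (m s)%:R.
  apply: eq_bigr => s _; under eq_bigr do rewrite succ_diff.
  by rewrite sumr_const_nat subn1.
rewrite big_split /= sumr_const_nat /Mtot natr_sum [in RHS]big_ltn//.
rewrite -[delta *+ _]mulr_natl !subSS subn0 -natr1 -[t.+1%:R]natr1; ring.
Qed.

(** Every initial degree is at least 1, and [2 * (t - 1) >= t] when [t >= 2]. *)
Lemma total_weight_ge delta t i : -1 < delta -> (2 <= t)%N -> (i <= m t)%N ->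
  t%:R * (1 + delta) <= total_weight m x delta t i.
Proof.
move=> d1 t2 it; rewrite total_weightE//.
have : t.-1%:R <= (Mtot m t.-1)%:R :> R by rewrite ler_nat; exact: (leq_Mtot m_gt0).
have i0 : 0 <= i%:R :> R by [].
case: t t2 it => [//|[//|t]] _ _; rewrite -!natr1 /=.
have : 0 <= t%:R :> R by [].
by move: (Mtot _ _)%:R => M; move: t%:R i0; move: i%:R => *; lra.
Qed.

Lemma degree_countE E N k : (degree_count E N k)%:R = \sum_(j < N) (degree E j == k)%:R :> R.
Proof.
rewrite /degree_count -sum1_card natr_sum big_mkcond /=.
apply: eq_bigr => j _; rewrite (_ : (j \in _) = (degree E j == k)); first by case: eqP.
by apply/idP/idP; rewrite inE.
Qed.

Lemma NkE k n : (1 <= n)%N -> (Nk m x k n)%:R = degree_sum (fun j => (j == k)%:R) n.+1 0 :> R.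
Proof. by move=> n1; rewrite /Nk degree_countE /degree_sum PAstep0. Qed.

(** All degrees are at most twice the number of edges, so the partial sums are eventually constant
    and the limit is a finite count. *)
Lemma NgtE k n : (1 <= n)%N -> Ngt m x k n = degree_sum (fun j => (k < j)%:R) n.+1 0 :> R.
Proof.
move=> n1; apply: lim_near_cst => //.
exists (2 * size (PA m x n)).+1%N => // J /= HJ.
under eq_bigr do rewrite NkE//.
rewrite exchange_big /=; apply: eq_bigr => v _; rewrite PAstep0.
set g := degree _ _; have gJ : (g < J)%N.
  by apply: leq_ltn_trans HJ; exact: degree_le_size.
case: ltnP => kg.
  rewrite (bigD1_seq g) ?mem_index_iota ?iota_uniq ?kg//= eqxx big1 ?addr0// => j jg.
  by rewrite eq_sym (negbTE jg).
rewrite big_nat_cond big1// => j /andP[/andP[kj _] _].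
by rewrite ltn_eqF//; lia.
Qed.

(** With [phi] the indicator of degrees above [k], a jump occurs exactly along an edge that finds
    its target at degree [k], and the values at birth add up to [Rgt]. *)
Lemma Ngt_sub_Rgt k n : (1 <= n)%N ->
  Ngt m x k n - (Rgt m k n)%:R = edge_sum m n (fun t i => (D t i == k)%:R) :> R.
Proof.
move=> n1; rewrite NgtE// degree_sumE// /Rgt natrD natrM natr_sum.
rewrite (_ : edge_sum _ _ _ = edge_sum m n (fun t i => (D t i == k)%:R)); first by ring.
apply: eq_bigr => t _; apply: eq_bigr => i _.
by rewrite ltnS leq_eqVlt eq_sym; case: ltngtP; rewrite ?subrr ?subr0.
Qed.

Lemma edge_sumB n (f g : nat -> nat -> R) :
  edge_sum m n (fun t i => f t i - g t i) = edge_sum m n f - edge_sum m n g.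
Proof.
by rewrite /edge_sum -sumrB; apply: eq_bigr => t _; rewrite sumrB.
Qed.

Lemma edge_sumZ n (c : R) (f : nat -> nat -> R) :
  edge_sum m n (fun t i => c * f t i) = c * edge_sum m n f.
Proof.
by rewrite /edge_sum mulr_sumr; apply: eq_bigr => t _; rewrite mulr_sumr.
Qed.

Lemma scoreE n delta : (1 <= n)%N ->
  score m x n delta = n.+1%:R^-1 *
    edge_sum m n (fun t i => ((D t i)%:R + delta)^-1 - t%:R / total_weight m x delta t i.-1).
Proof.
move=> n1; rewrite edge_sumB mulrBr /score; congr (_ - _).
apply: lim_near_cst => //.
exists (2 * size (PA m x n)).+1%N => // K /= HK.
under eq_bigr do rewrite Ngt_sub_Rgt// mulrA mulrC /edge_sum mulr_sumr.
rewrite -mulr_sumr; congr (_ * _).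
rewrite exchange_big /=; apply: eq_big_nat => t tn.
under eq_bigr do rewrite mulr_sumr.
rewrite exchange_big /=; apply: eq_big_nat => i im.
have D0 : (0 < D t i)%N by apply: chosen_degree_gt0 => //; lia.
have DK : (D t i < K)%N.
  by apply: leq_ltn_trans HK; apply: chosen_degree_le => //; lia.
rewrite (bigD1_seq (D t i)) ?mem_index_iota ?iota_uniq ?D0//= eqxx mulr1 big1 ?addr0// => j jg.
by rewrite eq_sym (negbTE jg) mulr0.
Qed.

Lemma ln_prod (I : Type) (s : seq I) (Q : pred I) (f : I -> R) :
  (forall u, Q u -> 0 < f u) -> 0 < \prod_(u <- s | Q u) f u /\
  ln (\prod_(u <- s | Q u) f u) = \sum_(u <- s | Q u) ln (f u).
Proof.
move=> f0; elim: s => [|u s [p0 IH]]; first by rewrite !big_nil ln1.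
rewrite !big_cons; case: ifP => // Qu.
by rewrite mulr_gt0 ?f0// lnM ?posrE ?f0// IH.
Qed.

(** The counts [N_k] cancel between the two likelihoods, and the total weight is affine in the
    parameter with slope [t]. What is left per edge is a logarithm for the chosen degree minus one
    for the normalization. *)
Lemma log_likelihood_ratioE n (delta delta' : R) : -1 < delta -> -1 < delta' ->
  ln (likelihood m x n delta' / likelihood m x n delta) =
  edge_sum m n (fun t i => ln (1 + (delta' - delta) / ((D t i)%:R + delta))
    - ln (1 + (delta' - delta) * (t%:R / total_weight m x delta t i.-1))).
Proof.
move=> d1 d1'.
rewrite /likelihood -prodf_div.
pose r t i : R := (1 + (delta' - delta) / ((D t i)%:R + delta)) /
    (1 + (delta' - delta) * (t%:R / total_weight m x delta t i.-1)).
have pos t i : (2 <= t)%N -> (1 <= i <= m t)%N ->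
  [/\ 0 < 1 + (delta' - delta) / ((D t i)%:R + delta),
      0 < 1 + (delta' - delta) * (t%:R / total_weight m x delta t i.-1) &
      ((D t i)%:R + delta') * (degree_count (PAstep m x t i.-1) t (D t i))%:R / total_weight m x delta' t i.-1
      / (((D t i)%:R + delta) * (degree_count (PAstep m x t i.-1) t (D t i))%:R / total_weight m x delta t i.-1) = r t i].
  move=> t2 it; have im : (i.-1 <= m t)%N by lia.
  have t0 : 0 < t%:R :> R by rewrite ltr0n; lia.
  have D1 : 1 <= (D t i)%:R :> R by rewrite ler1n chosen_degree_gt0.
  have W0 : 0 < total_weight m x delta t i.-1.
    by apply: lt_le_trans (total_weight_ge d1 t2 im); rewrite mulr_gt0//; lra.
  have W0' : 0 < total_weight m x delta' t i.-1.
    by apply: lt_le_trans (total_weight_ge d1' t2 im); rewrite mulr_gt0//; lra.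
  have WW : total_weight m x delta' t i.-1 = total_weight m x delta t i.-1 + (delta' - delta) * t%:R.
    by rewrite !total_weightE//; ring.
  (* The chosen vertex is itself counted, so the common factor is nonzero and may be cancelled. *)
  have N0 : 0 < (degree_count (PAstep m x t i.-1) t (D t i))%:R :> R.
    rewrite degree_countE (bigD1 (Ordinal (x_lt t2 it)))//= eqxx ltr_pwDl//.
    by apply: sumr_ge0.
  have e1 : 1 + (delta' - delta) / ((D t i)%:R + delta) = ((D t i)%:R + delta') / ((D t i)%:R + delta).
    by field; lra.
  have e2 : 1 + (delta' - delta) * (t%:R / total_weight m x delta t i.-1) =
     total_weight m x delta' t i.-1 / total_weight m x delta t i.-1.
    by rewrite WW; field; lra.
  rewrite /r e1 e2; split.
  - by rewrite divr_gt0//; lra.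
  - by rewrite divr_gt0//; lra.
  - by field; rewrite !gt_eqF//; lra.
have -> : \prod_(2 <= t < n.+1) (\prod_(1 <= i < (m t).+1)
    (((D t i)%:R + delta') * (degree_count (PAstep m x t i.-1) t (D t i))%:R / total_weight m x delta' t i.-1) /
    \prod_(1 <= i < (m t).+1)
    (((D t i)%:R + delta) * (degree_count (PAstep m x t i.-1) t (D t i))%:R / total_weight m x delta t i.-1))
  = \prod_(2 <= t < n.+1 | (2 <= t)%N) \prod_(1 <= i < (m t).+1 | (1 <= i <= m t)%N) r t i.
  rewrite big_nat [RHS]big_nat_cond; apply: eq_big => [t|t tn]; first by lia.
  rewrite -prodf_div big_nat [RHS]big_nat_cond; apply: eq_big => [i|i im]; first by lia.
  by have [|| _ _ <-] := pos t i => //; lia.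
have r0 t i : (2 <= t)%N -> (1 <= i <= m t)%N -> 0 < r t i.
  by move=> t2 it; have [? ? _] := pos t i t2 it; rewrite divr_gt0.
have [|_ ->] := @ln_prod _ (index_iota 2 n.+1) (fun t => 2 <= t)%N (fun t => \prod_(1 <= i < (m t).+1 | (1 <= i <= m t)%N) r t i).
  by move=> t t2; have [|] := @ln_prod _ (index_iota 1 (m t).+1) (fun i => 1 <= i <= m t)%N (r t) => // i; exact: r0.
rewrite /edge_sum big_nat_cond [RHS]big_nat; apply: eq_big => [t|t tn]; first by lia.
have [|_ ->] := @ln_prod _ (index_iota 1 (m t).+1) (fun i => 1 <= i <= m t)%N (r t) => [i|].
  by apply: r0; lia.
rewrite big_nat_cond [RHS]big_nat; apply: eq_big => [i|i im]; first by lia.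
have [||? ? _] := pos t i; [lia|lia|].
by rewrite /r ln_div.
Qed.

End degree_sums.

(** * Histories *)

Section fibers.
Context {d : measure_display} {T : measurableType d}.

Lemma measurable_fibers_comp (C C' : countType) (F : T -> C) (g : C -> C') :
  measurable_fibers F -> measurable_fibers (g \o F).
Proof.
move=> mF c; pose S n := [set w | pickle (F w) = n /\ g (F w) = c].
have -> : (g \o F) @^-1` [set c] = \bigcup_n S n.
  by apply/seteqP; split => w /=; [move=> gc; exists (pickle (F w))|case=> n _ []].
apply: bigcup_measurable => n _.
have [[w [wn wc]]|Sn] := pselect (exists w, S n w).
  suff -> : S n = F @^-1` [set F w] by exact: mF.
  apply/seteqP; split => w'; rewrite /S /= -wn; first by case=> /(pcan_inj pickleK).
  by move=> ->.
suff -> : S n = set0 by exact: measurable0.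
by rewrite -subset0 => w wS; apply: Sn; exists w.
Qed.

Lemma measurable_fibers_pair (C C' : countType) (F : T -> C) (F' : T -> C') :
  measurable_fibers F -> measurable_fibers F' -> measurable_fibers (fun w => (F w, F' w)).
Proof.
move=> mF mF' [a b].
have -> : (fun w => (F w, F' w)) @^-1` [set (a, b)] = F @^-1` [set a] `&` F' @^-1` [set b].
  by apply/seteqP; split => w /= [-> ->].
exact: measurableI.
Qed.

Lemma measurable_fibers_choose (C : countType) (F : nat -> T -> C) (K : T -> nat) :
  (forall k, measurable_fibers (F k)) -> measurable_fibers K ->
  measurable_fibers (fun w => F (K w) w).
Proof.
move=> mF mK c.
have -> : (fun w => F (K w) w) @^-1` [set c] =
    \bigcup_k (K @^-1` [set k] `&` F k @^-1` [set c]).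
  apply/seteqP; split => w /=; first by move=> Fc; exists (K w).
  by move=> [k _ [-> ->]].
by apply: bigcup_measurable => k _; apply: measurableI; [exact: mK|exact: mF].
Qed.

Lemma measurable_fibers_cst (C : countType) (c : C) : measurable_fibers (fun _ : T => c).
Proof.
move=> a; have [->|ca] := eqVneq c a.
  suff -> : (fun _ : T => a) @^-1` [set a] = setT by exact: measurableT.
  by apply/seteqP.
suff -> : (fun _ : T => c) @^-1` [set a] = set0 by exact: measurable0.
by rewrite -subset0 => w /= /eqP; rewrite (negbTE ca).
Qed.

Lemma measurable_fibers_nat (f : T -> nat) : measurable_fun setT f -> measurable_fibers f.
Proof. by move=> mf a; rewrite -[X in measurable X]setTI; exact: mf. Qed.

Lemma measurable_fibers_map (C : countType) (I : Type) (s : seq I) (F : I -> T -> C) :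
  (forall i, measurable_fibers (F i)) -> measurable_fibers (fun w => [seq F i w | i <- s]).
Proof.
move=> mF; elim: s => [|i s IH] /=; first exact: measurable_fibers_cst.
exact: (measurable_fibers_comp (fun c => c.1 :: c.2) (measurable_fibers_pair (mF i) IH)).
Qed.

End fibers.

(** * Reconstructing the past from an ordered list of edges *)

Section same_history.
Variables (m m' : nat -> nat) (x x' : nat -> nat -> nat).
Implicit Types (t i s l n : nat).

(* same edges up to PA_{t,i} *)
Definition agree t i := forall s l, (2 <= s)%N ->
  ((s < t) && (l <= m s) || (s == t) && (l <= i))%N ->
  PAstep m x s l = PAstep m' x' s l /\ ((0 < l)%N -> x s l = x' s l).

Lemma PAstepS_inj t i : PAstep m x t i.+1 = PAstep m' x' t i.+1 ->
  PAstep m x t i = PAstep m' x' t i /\ x t i.+1 = x' t i.+1.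
Proof. by rewrite !PAstepS !cats1 => /rcons_inj[-> ->]. Qed.

(** The edges are listed in order of creation, so the last one can be peeled off. Once [v_t] has no
    edge left, the list is the full network of the previous vertex, and the known initial degrees
    tell how many of its edges that vertex brought. *)
Lemma PAstep_agree t i : (2 <= t)%N -> (forall s, (1 <= s < t)%N -> m s = m' s) ->
  PAstep m x t i = PAstep m' x' t i -> agree t i.
Proof.
elim: t i => // t IHt i t2 mm; elim: i => [|i IHi] E s l s2.
  rewrite leqn0 => /orP[/andP[st lm]|/andP[/eqP -> /eqP ->//]].
  case: t IHt t2 mm E st => [|[|t]] IHt t2 mm; rewrite !PAstep0 => E st.
  - by lia.
  - by lia.
  - rewrite -!PAstep_full// -mm ?leqnn// in E.
    apply: (IHt _ _ _ E) => //.
      by move=> u /andP[u1 u2]; apply: mm; rewrite u1 ltnW.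
    move: st; rewrite ltnS leq_eqVlt => /orP[/eqP sE|->]; last by rewrite lm.
    by move: lm; rewrite sE eqxx => ->; rewrite orbT.
have [E1 E2] := PAstepS_inj E.
move=> /orP[st|/andP[/eqP -> ]]; first by apply: IHi => //; rewrite st.
rewrite leq_eqVlt => /orP[/eqP -> //|]; rewrite ltnS => li.
by apply: IHi => //; rewrite eqxx li orbT.
Qed.

End same_history.

Lemma agree_likelihood {R : realType} (m m' : nat -> nat) (x x' : nat -> nat -> nat) (n : nat) :
  (forall s, (1 <= s <= n)%N -> m s = m' s) -> PA m x n = PA m' x' n ->
  likelihood m x n =1 likelihood m' x' n :> (R -> R).
Proof.
move=> mm E delta; apply: eq_big_nat => t /andP[t2 tn].
have A : agree m m' x x' n.+1 0.
  by apply: PAstep_agree => //; [lia|rewrite !PAstep0].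
rewrite -(mm t) ?tn 1?ltnW//; apply: eq_big_nat => i im.
have [|E1 _] := A t i.-1 t2; first by apply/orP; left; lia.
have xE : x t i = x' t i.
  by have [|_] := A t i t2; [apply/orP; left; lia|apply; lia].
by rewrite /chosen_degree /total_weight E1 xE.
Qed.

Section random_network.
Context {R : realType} {d : measure_display} {T : measurableType d}.
Variable P : probability T R.
Variables (m : nat -> {RV P >-> nat}) (x : nat -> nat -> {RV P >-> nat}).
Implicit Types (t i n : nat).

Definition degs w t := m t w.
Definition choices w t i := x t i w.

Lemma fibers_PAstep t i : measurable_fibers (fun w => PAstep (degs w) (choices w) t i).
Proof.
have fm s : measurable_fibers (m s : T -> nat) by exact: measurable_fibers_nat.
have fx s l : measurable_fibers (x s l : T -> nat) by exact: measurable_fibers_nat.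
have fnew s k : measurable_fibers (fun w => new_edges (choices w) s k).
  apply: measurable_fibers_map => l.
  exact: (measurable_fibers_comp (fun c => (s, c)) (fx s l)).
have fPA s : measurable_fibers (fun w => PA (degs w) (choices w) s).
  elim: s => [|s IH]; first exact: measurable_fibers_cst.
  case: s IH => [_|s IH].
    exact: (measurable_fibers_comp (fun c => nseq c (1%N, 0%N)) (fm 1%N)).
  have H := measurable_fibers_choose (fun k => fnew s.+2 k) (fm s.+2).
  exact: (measurable_fibers_comp (fun c => c.1 ++ c.2) (measurable_fibers_pair IH H)).
exact: (measurable_fibers_comp (fun c => c.1 ++ c.2) (measurable_fibers_pair (fPA _) (fnew t i))).
Qed.

Definition history_type : countType := (seq nat * seq (nat * nat))%type.

(* (m_1, ..., m_n) together with PA_{t, min(i, m_t)}: a countable code of the past, in place of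
   the sigma-algebra [past]. *)
Definition hist n t i (w : T) : history_type :=
  ([seq degs w s | s <- iota 1 n], PAstep (degs w) (choices w) t (minn i (degs w t))).

Lemma fibers_hist n t i : measurable_fibers (hist n t i).
Proof.
apply: measurable_fibers_pair.
  by apply: measurable_fibers_map => s; exact: measurable_fibers_nat.
apply: (@measurable_fibers_choose _ _ _ (fun k w => PAstep (degs w) (choices w) t (minn i k))) => [k|].
  exact: fibers_PAstep.
exact: measurable_fibers_nat.
Qed.

Lemma hist_degs n t i w w' s : hist n t i w = hist n t i w' -> (1 <= s <= n)%N ->
  degs w s = degs w' s.
Proof.
move=> [E _] sn.
have := congr1 (fun l => nth 0%N l s.-1) E.
have sn1 : (s.-1 < n)%N by lia.
suff H u : nth 0%N [seq degs u s | s <- iota 1 n] s.-1 = degs u s by rewrite !H.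
by rewrite (nth_map 0%N) ?size_iota// nth_iota// add1n prednK//; lia.
Qed.

Lemma hist_agree n t i w w' : (2 <= t)%N -> (t <= n.+1)%N ->
  hist n t i w = hist n t i w' -> (minn i (degs w t) = minn i (degs w' t))%N ->
  agree (degs w) (degs w') (choices w) (choices w') t (minn i (degs w t)).
Proof.
move=> t2 tn E mi; apply: PAstep_agree => //.
  by move=> s st; apply: (hist_degs E); lia.
by case: E => _; rewrite -mi.
Qed.

End random_network.

(** * The martingale differences of the network *)

Section increments.
Context {R : realType} {d : measure_display} {T : measurableType d}.
Variable P : probability T R.
Variables (m : nat -> {RV P >-> nat}) (x : nat -> nat -> {RV P >-> nat}).
Variable delta : R.
Hypothesis d1 : -1 < delta.
Let delta1_gt0 : 0 < 1 + delta. Proof. by rewrite addrC -ltrBlDr sub0r. Qed.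
Hypothesis HPA : is_preferential_attachment delta m x.
Implicit Types (t i j n k : nat) (w : T) (psi phi : nat -> R).
Local Notation Ex := (Ex P).
Local Notation L1 := (L1 P).
Local Notation degs := (degs m).
Local Notation choices := (choices x).
Local Notation hist := (hist m x).

Definition chosen t i w := chosen_degree (degs w) (choices w) t i.
Definition weight t i w : R := total_weight (degs w) (choices w) delta t i.
Definition dsum phi t i w : R := degree_sum (degs w) (choices w) phi t i.
(** Slots are numbered from 0: slot [i] of [v_t] carries the edge [i.+1], which exists when
    [i < m_t]. *)
Definition ind t i w : R := (i < degs w t)%N%:R.

Lemma degs_gt0 w t : (1 <= t)%N -> (0 < degs w t)%N.
Proof. by case: HPA => [[H _ _ _] _ _]; exact: H. Qed.

Lemma choices_lt w t i : (2 <= t)%N -> (1 <= i <= degs w t)%N -> (choices w t i < t)%N.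
Proof. by case: HPA => [_ H _]; exact: H. Qed.

Lemma weight_ge t i w : (2 <= t)%N -> (i <= degs w t)%N -> t%:R * (1 + delta) <= weight t i w.
Proof. exact: (total_weight_ge (@degs_gt0 w) (@choices_lt w)). Qed.

Lemma weight_gt0 t i w : (2 <= t)%N -> (i <= degs w t)%N -> 0 < weight t i w.
Proof.
move=> t2 im; apply: lt_le_trans (weight_ge t2 im).
by apply: mulr_gt0; [rewrite ltr0n; lia|exact: delta1_gt0].
Qed.

Lemma ind_sqr t i w : ind t i w * ind t i w = ind t i w.
Proof. by rewrite /ind; case: ltnP; rewrite ?mul1r ?mul0r. Qed.

Definition prob_choice t i j w : R :=
  ((degree (PAstep (degs w) (choices w) t i) j)%:R + delta) / weight t i w.

Lemma degree_ge1 t i j w : (2 <= t)%N -> (j < t)%N ->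
  1 <= (degree (PAstep (degs w) (choices w) t i) j)%:R :> R.
Proof. by move=> t2 jt; rewrite ler1n (degree_PAstep_gt0 (@degs_gt0 w) (@choices_lt w)). Qed.

Lemma prob_choice_ge0 t i j w : (2 <= t)%N -> (j < t)%N -> (i <= degs w t)%N ->
  0 <= prob_choice t i j w.
Proof.
move=> t2 jt im; rewrite divr_ge0//; last exact/ltW/weight_gt0.
by have := degree_ge1 i w t2 jt; move: d1; lra.
Qed.

Lemma sum_prob_choice t i w : (2 <= t)%N -> (i <= degs w t)%N ->
  \sum_(j < t) prob_choice t i j w = 1.
Proof.
by move=> t2 im; rewrite -mulr_suml -/(weight t i w) divff// gt_eqF// weight_gt0.
Qed.

Lemma prob_choice_le1 t i j w : (2 <= t)%N -> (j < t)%N -> (i <= degs w t)%N ->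
  prob_choice t i j w <= 1.
Proof.
move=> t2 jt im; rewrite -(sum_prob_choice t2 im) (bigD1 (Ordinal jt))//= lerDl.
by apply: sumr_ge0 => l _; exact: prob_choice_ge0.
Qed.

(** This quotient is the conditional mean of [psi] at the degree of the next chosen vertex. *)
Lemma dsum_weight psi t i w :
  dsum (fun k => psi k * (k%:R + delta)) t i w / weight t i w =
  \sum_(j < t) psi (degree (PAstep (degs w) (choices w) t i) j) * prob_choice t i j w.
Proof. by rewrite /dsum mulr_suml; apply: eq_bigr => j _; rewrite mulrA. Qed.

Lemma dsum_weight_norm psi (c : R) t i w : (2 <= t)%N -> (i <= degs w t)%N ->
  (forall k, (0 < k)%N -> `|psi k| <= c) ->
  `|dsum (fun k => psi k * (k%:R + delta)) t i w / weight t i w| <= c.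
Proof.
move=> t2 im psic; rewrite dsum_weight (le_trans (ler_norm_sum _ _ _))//.
rewrite -[leRHS]mulr1 -(sum_prob_choice t2 im) mulr_sumr; apply: ler_sum => j _.
rewrite normrM (ger0_norm (prob_choice_ge0 _ _ _))// ler_wpM2r ?prob_choice_ge0// psic//.
by rewrite -(ler1n R) degree_ge1.
Qed.

Definition hist_eq n t i w w' := hist n t i w = hist n t i w'.

Lemma hist_eq_degs n t i w w' : (1 <= t)%N -> (t <= n)%N -> hist_eq n t i w w' ->
  degs w t = degs w' t.
Proof. by move=> t1 tn /hist_degs; apply; rewrite t1. Qed.

Lemma hist_eq_agree n t i w w' : (2 <= t)%N -> (t <= n)%N -> hist_eq n t i w w' ->
  agree (degs w) (degs w') (choices w) (choices w') t (minn i (degs w t)).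
Proof.
move=> t2 tn E; apply: (hist_agree t2 (leqW tn) E).
by rewrite (hist_eq_degs _ tn E)//; exact: ltnW.
Qed.

Lemma hist_eq_PAstep n t i w w' : (2 <= t)%N -> (t <= n)%N -> hist_eq n t i w w' ->
  (i < degs w t)%N ->
  PAstep (degs w) (choices w) t i = PAstep (degs w') (choices w') t i.
Proof.
move=> t2 tn E im; have := hist_eq_agree t2 tn E.
rewrite (minn_idPl (ltnW im)) => A; have [|//] := A t i t2.
by rewrite eqxx leqnn orbT.
Qed.

Lemma ind_determined n t i : (1 <= t)%N -> (t <= n)%N -> determined_by (hist n t i) (ind t i).
Proof. by move=> t1 tn w w' E; rewrite /ind (hist_eq_degs t1 tn E). Qed.

(** The code stops at [min(i, m_t)]. Where the slot is occupied, the network at step [i] can be read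
    from it; elsewhere the factor [ind] makes the value 0. *)
Lemma determined_ind n t i (f : seq (nat * nat) -> R) : (2 <= t)%N -> (t <= n)%N ->
  determined_by (hist n t i) (fun w => ind t i w * f (PAstep (degs w) (choices w) t i)).
Proof.
move=> t2 tn w w' E; rewrite (ind_determined (ltnW t2) tn E).
rewrite /ind -(hist_eq_degs (ltnW t2) tn E); case: ltnP => im; last by rewrite !mul0r.
by rewrite (hist_eq_PAstep t2 tn E).
Qed.

(** Connects the countable code with the model: on an occupied slot its fibre is an event of [past],
    so the conditional law of the choice applies to it. *)
Lemma fiber_hist_past n t i w : (2 <= t)%N -> (t <= n)%N -> (i < degs w t)%N ->
  past m x t i (hist n t i @^-1` [set hist n t i w]).
Proof.
move=> t2 tn im; rewrite /past.
set G := (X in <<s X>>).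
pose TG := g_sigma_algebraType G.
have mG A : G A -> @measurable _ TG A by exact: sub_sigma_algebra.
have mdegs k : @measurable _ TG [set w' | forall s, (1 <= s <= k)%N -> degs w' s = degs w s].
  elim: k => [|k IH].
    rewrite (_ : mkset _ = setT); first exact: (@measurableT _ TG).
    by apply/seteqP; split => // w' _ s; lia.
  rewrite (_ : mkset _ = [set w' | forall s, (1 <= s <= k)%N -> degs w' s = degs w s] `&`
    [set w' | m k.+1 w' = m k.+1 w]).
    apply: (@measurableI _ TG) => //; apply: mG; left.
    by exists k.+1, (m k.+1 w).
  apply/seteqP; split => w' /=.
    by move=> E; split => [s sk|]; apply: E; lia.
  move=> [E1 E2] s sk; have [->//|sk1] := eqVneq s k.+1.
  by apply: E1; lia.
have -> : hist n t i @^-1` [set hist n t i w] =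
  [set w' | forall s, (1 <= s <= n)%N -> degs w' s = degs w s] `&`
  [set w' | PAstep (degs w') (choices w') t i = PAstep (degs w) (choices w) t i].
  apply/seteqP; split => w' /=.
    move=> E; split => [s sn|]; first exact: (hist_degs E).
    by symmetry; apply: (hist_eq_PAstep t2 tn (esym E)).
  move=> [E1 E2]; rewrite /hist; congr pair.
    by apply/eq_in_map => s; rewrite mem_iota => sn; apply: E1; lia.
  by rewrite (E1 t) ?tn 1?ltnW// (minn_idPl (ltnW im)).
apply: (@measurableI _ TG) => //; apply: mG; right.
by exists (PAstep (degs w) (choices w) t i).
Qed.

Lemma measurable_determined2 n t i (g : T -> R) :
  (forall w w', hist n t i w = hist n t i w' -> x t i.+1 w = x t i.+1 w' -> g w = g w') ->
  measurable_fun setT g.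
Proof.
move=> Hg; pose Z w := (hist n t i w, (x t i.+1 w : nat)).
apply: (@determined_measurable _ _ _ _ Z).
  apply: measurable_fibers_pair; first exact: fibers_hist.
  exact: measurable_fibers_nat.
by move=> w w' [/= *]; apply: Hg => //; congr pair.
Qed.

(** On a fibre where the slot is occupied, [g] and the attachment probability are constant, and the
    model gives the choice of [v_j] a mass equal to that probability times the mass of the fibre. On
    the other fibres the integrand is 0. *)
Lemma Ex_choice_orth n t i j (g : T -> R) (b : R) : (2 <= t)%N -> (t <= n)%N -> (j < t)%N ->
  determined_by (hist n t i) g -> (forall w, `|g w| <= b) ->
  L1 (fun w => g w * (ind t i w * ((x t i.+1 w == j)%:R - prob_choice t i j w))) /\
  Ex (fun w => g w * (ind t i w * ((x t i.+1 w == j)%:R - prob_choice t i j w))) = 0.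
Proof.
move=> t2 tn jt Hg gb.
have pdet w w' : hist n t i w = hist n t i w' ->
    ind t i w * prob_choice t i j w = ind t i w' * prob_choice t i j w'.
  move=> E; apply: (determined_ind (fun F => ((degree F j)%:R + delta) /
     (\sum_(l < t) ((degree F l)%:R + delta))) t2 tn E).
have iX : L1 (fun w => g w * (ind t i w * ((x t i.+1 w == j)%:R - prob_choice t i j w))).
  apply: (@L1_bounded _ _ _ _ _ (b * 1)).
    apply: (@measurable_determined2 n t i) => w w' E Ex.
    by rewrite !mulrBr (pdet _ _ E) (ind_determined (ltnW t2) tn E) Ex (Hg _ _ E).
  move=> w; rewrite normrM ler_pM// /ind; case: ltnP => im; last by rewrite mul0r normr0.
  rewrite mul1r ler_norml.
  have := prob_choice_ge0 t2 jt (ltnW im); have := prob_choice_le1 t2 jt (ltnW im).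
  by case: eqP => _ /=; lra.
split => //; apply: (@Ex_eq0_fibers _ _ _ _ _ (hist n t i)) => //; first exact: fibers_hist.
move=> w; set A := _ @^-1` _.
have mA : measurable A by exact: fibers_hist.
have [mi|im] := leqP (degs w t) i.
  rewrite integral0_eq// => w' /= E.
  by rewrite /ind (hist_eq_degs (ltnW t2) tn E) ltnNge mi mul0r mulr0.
have EA w' : A w' -> [/\ g w' = g w, ind t i w' = 1 & prob_choice t i j w' = prob_choice t i j w].
  move=> E; have Ei : ind t i w' = 1 by rewrite (ind_determined (ltnW t2) tn E) /ind im.
  have := pdet _ _ E; rewrite Ei (_ : ind t i w = 1) ?mul1r; last by rewrite /ind im.
  by move=> ->; rewrite (Hg _ _ E).
set p0 := prob_choice t i j w in EA *; set g0 := g w in EA *.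
pose B := [set w' | x t i.+1 w' = j].
have mB : measurable B by exact: (measurable_fibers_nat (measurable_funPT (x t i.+1))).
have AE : A `&` [set w' | (i.+1 <= m t w')%N] = A.
  apply/seteqP; split => w' /=; first by case.
  by move=> E; split => //; have [_ + _] := EA _ E; rewrite /ind /degs; case: ltnP => // _ /esym/eqP; rewrite oner_eq0.
have [_ _ H3] := HPA.
(* The edge is number [i.+1], hence its past is that of [PA_{t,i}]. *)
have := H3 t i.+1 j A t2 isT jt (fiber_hist_past t2 tn im).
rewrite AE -/B => PAB.
have {}PAB : P (A `&` B) = (p0%:E * P A)%E.
  rewrite PAB -integral_cst//; apply: eq_integral => w' /set_mem /EA[_ _ <-].
  by [].
have XE : (\int[P]_(w' in A) (g w' * (ind t i w' * ((x t i.+1 w' == j)%:R - prob_choice t i j w')))%:E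
   = \int[P]_(w' in A) (g0 * (\1_B w' - p0))%:E)%E.
  apply: eq_integral => w' /set_mem /EA[-> -> ->]; rewrite mul1r indicE.
  suff -> : (w' \in B) = (x t i.+1 w' == j) by [].
  by apply/idP/idP; rewrite inE => /eqP.
rewrite XE -[LHS]fineK; last first.
  apply: integrable_fin_num => //; apply: (integrableS measurableT) => //.
  by apply: (L1Z g0); apply: L1B; [exact: L1_indic|exact: L1_cst].
rewrite -/(Rintegral P A (fun w' => g0 * (\1_B w' - p0))).
have i1 : P.-integrable A (EFin \o (fun w' => \1_B w' : R)).
  by apply: (integrableS measurableT) => //; exact: (L1_indic P mB).
have i2 : P.-integrable A (EFin \o (fun w' => p0)).
  by apply: (integrableS measurableT) => //; exact: (L1_cst P p0).
rewrite RintegralZl//; last first.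
  by apply: (integrableS measurableT) => //; apply: L1B; [exact: L1_indic|exact: L1_cst].
have -> : Rintegral P A (fun w' => \1_B w' - p0) = fine (P (A `&` B)) - p0 * fine (P A).
  by rewrite RintegralB// Rintegral_cst// {1}/Rintegral integral_indic// (setIC B).
by rewrite PAB fineM ?fin_num_measure//= subrr mulr0.
Qed.

(** The martingale difference for a general test function [psi]. The score is the case
    [psi k = 1 / (k + delta)]; indicators serve for the degree counts. *)
Definition incr psi t i w : R := ind t i w *
  (psi (chosen t i.+1 w) - dsum (fun k => psi k * (k%:R + delta)) t i w / weight t i w).

Definition cvar psi t i w : R := ind t i w *
  (dsum (fun k => psi k ^+ 2 * (k%:R + delta)) t i w / weight t i w
   - (dsum (fun k => psi k * (k%:R + delta)) t i w / weight t i w) ^+ 2).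

Lemma chosen_gt0 t i w : (2 <= t)%N -> (i < degs w t)%N -> (0 < chosen t i.+1 w)%N.
Proof.
by move=> t2 im; exact: (chosen_degree_gt0 (@degs_gt0 w) (@choices_lt w)).
Qed.

(** A sum over the vertices of centred indicators with predictable coefficients, so that
    [Ex_choice_orth] applies to each term. The factor [ind] is duplicated by idempotence to make
    each coefficient a function of the code. *)
Lemma incrE psi t i w : (2 <= t)%N ->
  incr psi t i w = \sum_(j < t) (ind t i w * psi (degree (PAstep (degs w) (choices w) t i) j)) *
    (ind t i w * ((x t i.+1 w == j)%:R - prob_choice t i j w)).
Proof.
move=> t2; under eq_bigr => j _ do rewrite mulrACA ind_sqr.
rewrite -mulr_sumr /incr /ind; case: ltnP => im; last by rewrite !mul0r.
rewrite !mul1r dsum_weight; under [RHS]eq_bigr do rewrite mulrBr.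
rewrite sumrB; congr (_ - _).
have xt : (x t i.+1 w < t)%N by apply: (@choices_lt w) => //; rewrite im.
rewrite (bigD1 (Ordinal xt))//= eqxx mulr1 big1 ?addr0// => j jx.
rewrite (_ : (x t i.+1 w == j) = false) ?mulr0//.
by apply/negbTE; rewrite eq_sym; apply: contra jx => /eqP jx; apply/eqP/val_inj.
Qed.

Lemma incr_norm psi (c : R) t i w : 0 <= c -> (2 <= t)%N ->
  (forall k, (0 < k)%N -> `|psi k| <= c) -> `|incr psi t i w| <= 2 * c.
Proof.
move=> c0 t2 psic; rewrite /incr /ind; case: ltnP => im; last first.
  by rewrite mul0r normr0 mulr_ge0.
rewrite mul1r (le_trans (ler_normB _ _))// mulr2n mulrDl mul1r lerD//.
  by rewrite psic// chosen_gt0.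
by apply: dsum_weight_norm => //; exact: ltnW.
Qed.

Lemma incr_orth psi (c : R) n t i (g : T -> R) (b : R) : (2 <= t)%N -> (t <= n)%N ->
  (forall k, (0 < k)%N -> `|psi k| <= c) ->
  determined_by (hist n t i) g -> (forall w, `|g w| <= b) ->
  L1 (fun w => g w * incr psi t i w) /\ Ex (fun w => g w * incr psi t i w) = 0.
Proof.
move=> t2 tn psic Hg gb.
pose X (j : 'I_t) w := (g w * (ind t i w * psi (degree (PAstep (degs w) (choices w) t i) j))) *
    (ind t i w * ((x t i.+1 w == j)%:R - prob_choice t i j w)).
have XE : (fun w => g w * incr psi t i w) = (fun w => \sum_(j < t) X j w).
  by apply/funext => w; rewrite incrE// mulr_sumr; apply: eq_bigr => j _; rewrite mulrA.
have HX (j : 'I_t) : L1 (X j) /\ Ex (X j) = 0.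
  apply: (@Ex_choice_orth n _ _ _ _ (b * c)) => // [w w' E|w].
    by rewrite (Hg _ _ E) (determined_ind (fun F => psi (degree F j)) t2 tn E).
  rewrite normrM ler_pM// /ind; case: ltnP => im; last first.
    by rewrite mul0r normr0 (le_trans (normr_ge0 _) (psic 1%N isT)).
  by rewrite mul1r psic// -(ler1n R) degree_ge1.
rewrite XE; split; first by apply: L1_sum => j; have [] := HX j.
by rewrite Ex_sum ?big1// => j; have [] := HX j.
Qed.

(** The variance is rewritten as a sum of squared deviations from the mean, weighted by the
    attachment probabilities. *)
Lemma cvar_ge0 psi t i w : (2 <= t)%N -> 0 <= cvar psi t i w.
Proof.
move=> t2; rewrite /cvar /ind; case: ltnP => im; last by rewrite mul0r.
rewrite mul1r; set a := (X in _ - X ^+ 2).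
rewrite (_ : _ - _ = \sum_(j < t) (psi (degree (PAstep (degs w) (choices w) t i) j) - a) ^+ 2 * prob_choice t i j w).
  by apply: sumr_ge0 => j _; rewrite mulr_ge0 ?sqr_ge0 ?prob_choice_ge0// ltnW.
rewrite dsum_weight.
have H (f : nat -> R) (p : nat -> R) : \sum_(j < t) p j = 1 -> \sum_(j < t) f j * p j = a ->
    \sum_(j < t) f j ^+ 2 * p j - a ^+ 2 = \sum_(j < t) (f j - a) ^+ 2 * p j.
  move=> p1 fa; under [RHS]eq_bigr => j _.
    rewrite (_ : (f j - a) ^+ 2 * p j = f j ^+ 2 * p j - (2 * a) * (f j * p j) + a ^+ 2 * p j); last by ring.
    over.
  by rewrite big_split sumrB -!mulr_sumr /= p1 fa; ring.
apply: (H (fun j => psi (degree (PAstep (degs w) (choices w) t i) j)) (fun j => prob_choice t i j w)).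
  by apply: sum_prob_choice => //; exact: ltnW.
by rewrite -dsum_weight.
Qed.

Lemma cvar_le psi (c : R) t i w : 0 <= c -> (2 <= t)%N ->
  (forall k, (0 < k)%N -> `|psi k| <= c) -> cvar psi t i w <= c ^+ 2.
Proof.
move=> c0 t2 psic; rewrite /cvar /ind; case: ltnP => im; last by rewrite mul0r sqr_ge0.
rewrite mul1r; apply: (@le_trans _ _ (dsum (fun k => psi k ^+ 2 * (k%:R + delta)) t i w / weight t i w)).
  by rewrite gerBl sqr_ge0.
apply: (le_trans (ler_norm _)); apply: dsum_weight_norm => //; first exact: ltnW.
by move=> k k0; rewrite normrX lerXn2r ?nnegrE// psic.
Qed.

(** Where the slot is occupied, [(q - a)^2 - (s - a^2) = (q^2 - s) - 2 a (q - a)], with [a] and [s]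
    the conditional means of [psi] and its square. The left side is thus an increment for [psi ^+ 2]
    minus a predictable multiple of the increment for [psi]. *)
Lemma cvar_orth psi (c : R) n t i (g : T -> R) (b : R) : (2 <= t)%N -> (t <= n)%N -> 0 <= c ->
  (forall k, (0 < k)%N -> `|psi k| <= c) ->
  determined_by (hist n t i) g -> (forall w, `|g w| <= b) ->
  Ex (fun w => g w * (incr psi t i w ^+ 2 - cvar psi t i w)) = 0.
Proof.
move=> t2 tn c0 psic Hg gb.
pose a w := dsum (fun k => psi k * (k%:R + delta)) t i w / weight t i w.
have E : (fun w => g w * (incr psi t i w ^+ 2 - cvar psi t i w)) =
   (fun w => g w * incr (fun k => psi k ^+ 2) t i w - 2 * ((g w * (ind t i w * a w)) * incr psi t i w)).
  apply/funext => w; rewrite /incr /cvar -/(a w).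
  move: (dsum (fun k => psi k ^+ 2 * _) t i w / _) (psi _) (ind_sqr t i w) => s q.
  move: (g w) (a w) (ind t i w) => gw aw I II.
  rewrite exprMn [I ^+ 2]expr2 II.
  have -> : gw * (I * (q - aw) ^+ 2 - I * (s - aw ^+ 2)) = gw * I * (q ^+ 2 - s) - 2 * (gw * I * aw * (q - aw)) by ring.
  by rewrite -{2}II; ring.
have [|i1 e1] := @incr_orth (fun k => psi k ^+ 2) (c ^+ 2) n t i g b t2 tn _ Hg gb.
  by move=> k k0; rewrite normrX lerXn2r ?nnegrE// psic.
have [||i2 e2] := @incr_orth psi c n t i (fun w => g w * (ind t i w * a w)) (b * c) t2 tn psic.
- move=> w w' e; rewrite (Hg _ _ e); congr (_ * _).
  exact: (determined_ind (fun F => (\sum_(j < t) (psi (degree F j) * ((degree F j)%:R + delta))) /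
     (\sum_(l < t) ((degree F l)%:R + delta))) t2 tn e).
- move=> w; rewrite normrM ler_pM// /ind; case: ltnP => im; last by rewrite mul0r normr0.
  by rewrite mul1r; apply: dsum_weight_norm => //; exact: ltnW.
by rewrite E ExB ?ExZ//; [rewrite e1 e2 mulr0 subr0|exact: L1Z].
Qed.

Section grid.
Variables (n B : nat).
Hypotheses (B0 : (0 < B)%N).

(* A random number m_t of edges is fitted into a deterministic number B of martingale steps per
   vertex: step k is the slot (t, i) with k = (t - 2) B + i, idle when m_t <= i. Edges beyond the
   B-th are left out, at a cost of order m_t^2 / B. *)
Definition grid_t k := (2 + k %/ B)%N.
Definition grid_i k := (k %% B)%N.
Definition grid_hist k := hist n (grid_t k) (grid_i k).
Definition grid_size := (n.-1 * B)%N.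

Lemma grid_t_le k : (k < grid_size)%N -> (2 <= grid_t k <= n)%N.
Proof.
rewrite /grid_size /grid_t => kN; have : (k %/ B < n.-1)%N by rewrite ltn_divLR.
by move: (k %/ B)%N => a {kN}; lia.
Qed.

Lemma grid_next k : grid_t k.+1 = grid_t k /\ grid_i k.+1 = (grid_i k).+1 \/
  grid_t k.+1 = (grid_t k).+1 /\ grid_i k.+1 = 0%N.
Proof.
rewrite /grid_t /grid_i; have [H|H] := boolP (B %| k.+1)%N.
  by right; rewrite divnS// modnS H add1n addnS.
left; rewrite divnS// modnS (negbTE H) add0n; split => //.
Qed.

(** The next code already contains the edge laid at step [k], also when step [k.+1] opens a new
    vertex and records only the completed network. *)
Lemma grid_hist_next k w w' : (k < grid_size)%N -> grid_hist k.+1 w = grid_hist k.+1 w' ->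
  forall l, (l <= (grid_i k).+1)%N -> (l <= degs w (grid_t k))%N ->
  PAstep (degs w) (choices w) (grid_t k) l = PAstep (degs w') (choices w') (grid_t k) l /\
  ((0 < l)%N -> choices w (grid_t k) l = choices w' (grid_t k) l).
Proof.
move=> kN E l li lm; have /andP[t2 tn] := grid_t_le kN.
have Em : degs w (grid_t k) = degs w' (grid_t k) by apply: (hist_degs E); rewrite tn ltnW.
move: E; rewrite /grid_hist; case: (grid_next k) => [[-> ->]|[-> ->]] E.
  apply: (hist_eq_agree t2 tn E) => //.
  by rewrite eqxx leq_min li lm orbT.
have A := @hist_agree _ _ _ _ m x n (grid_t k).+1 0 w w' (leqW t2) tn E.
by apply: A => //; rewrite ?min0n// ltnSn lm.
Qed.

Lemma grid_history : history grid_hist grid_size.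
Proof.
split => [k _|k w w' kN E]; first exact: fibers_hist.
have /andP[t2 tn] := grid_t_le kN.
have Es s : (1 <= s <= n)%N -> degs w s = degs w' s by move=> sn; exact: (hist_degs E).
have [|| EP _] := grid_hist_next kN E (l := minn (grid_i k) (degs w (grid_t k))).
- by rewrite (leq_trans (geq_minl _ _)).
- exact: geq_minr.
rewrite /grid_hist /hist -(Es (grid_t k)) ?EP; last by rewrite tn ltnW.
by congr pair; apply/eq_in_map => s; rewrite mem_iota => sn; apply: Es; lia.
Qed.

Lemma grid_mart_diff psi (c : R) : 0 <= c -> (forall k, (0 < k)%N -> `|psi k| <= c) ->
  mart_diff P grid_hist grid_size (fun k => incr psi (grid_t k) (grid_i k)) (2 * c).
Proof.
move=> c0 psic; split => [|k kN w w' E|k w kN|k g b kN Hg gb].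
- exact: mulr_ge0.
- have /andP[t2 tn] := grid_t_le kN.
  have Em : degs w (grid_t k) = degs w' (grid_t k) by apply: (hist_degs E); rewrite tn ltnW.
  rewrite /incr /ind -Em; case: ltnP => im; last by rewrite !mul0r.
  have [|EP _] := grid_hist_next kN E (l := grid_i k) (leqnSn _); first exact: ltnW.
  have [_ /(_ isT) Ex] := grid_hist_next kN E (l := (grid_i k).+1) (leqnn _) im.
  by rewrite /chosen /chosen_degree /dsum /degree_sum /weight /total_weight /= EP Ex.
- by have /andP[t2 tn] := grid_t_le kN; exact: incr_norm.
- by have /andP[t2 tn] := grid_t_le kN; have [] := incr_orth t2 tn psic Hg gb.
Qed.

Lemma grid_cond_variance psi (c : R) : 0 <= c -> (forall k, (0 < k)%N -> `|psi k| <= c) ->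
  cond_variance P grid_hist grid_size (fun k => incr psi (grid_t k) (grid_i k))
    (fun k => cvar psi (grid_t k) (grid_i k)) (2 * c).
Proof.
move=> c0 psic; split => [k kN|k w kN|k w kN|k g b kN Hg gb]; have /andP[t2 tn] := grid_t_le kN.
- exact: (determined_ind (fun F =>
    (\sum_(j < grid_t k) (psi (degree F j) ^+ 2 * ((degree F j)%:R + delta))) /
     (\sum_(l < grid_t k) ((degree F l)%:R + delta)) -
    ((\sum_(j < grid_t k) (psi (degree F j) * ((degree F j)%:R + delta))) /
     (\sum_(l < grid_t k) ((degree F l)%:R + delta))) ^+ 2) t2 tn).
- exact: cvar_ge0.
- apply: (le_trans (cvar_le _ _ c0 t2 psic)).
  by rewrite lerXn2r ?nnegrE ?mulr_ge0//; lra.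
- exact: (cvar_orth t2 tn c0 psic Hg gb).
Qed.

Lemma grid_sum (V : nmodType) (f : nat -> nat -> V) :
  \sum_(k < grid_size) f (grid_t k) (grid_i k) = \sum_(2 <= t < n.+1) \sum_(i < B) f t i.
Proof.
rewrite /grid_size /grid_t /grid_i -(big_mkord xpredT (fun k => f (2 + k %/ B)%N (k %% B)%N)).
case: n => [|N]; first by rewrite mul0n !big_geq.
rewrite /=; elim: N => [|N IH]; first by rewrite mul0n !big_geq.
rewrite mulSn addnC (big_cat_nat (n := (N * B)%N))//= ?leq_addr// IH.
rewrite [in RHS]big_nat_recr//=; congr (_ + _).
rewrite -{1}[(N * B)%N]add0n big_addn addnC addnK big_mkord.
apply: eq_bigr => i _; rewrite [(_ + N * B)%N]addnC divnMDl// modnMDl modn_small ?divn_small//.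
by rewrite addn0 add2n.
Qed.

End grid.

End increments.

(** * Initial degrees *)

Section second_moments.
Context {R : realType} {d : measure_display} {T : measurableType d}.
Variable P : probability T R.
Local Notation Ex := (Ex P).
Local Notation L1 := (L1 P).

Lemma L1_mul (X Y : T -> R) : measurable_fun setT X -> measurable_fun setT Y ->
  L1 (fun w => X w ^+ 2) -> L1 (fun w => Y w ^+ 2) -> L1 (fun w => X w * Y w).
Proof.
move=> mX mY iX iY; apply: (@L1_le _ _ _ _ _ (fun w => X w ^+ 2 + Y w ^+ 2)).
- exact: measurable_funM.
- exact: L1D.
- move=> w; rewrite normrM -(real_normK (num_real (X w))) -(real_normK (num_real (Y w))).
  have := sqr_ge0 (`|X w| - `|Y w|); have := mulr_ge0 (normr_ge0 (X w)) (normr_ge0 (Y w)).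
  by move: `|X w| `|Y w| => a b; rewrite !expr2; lra.
Qed.

(** From [2 |X| <= k + X^2 / k]. With [k = sqrt n] it turns a second moment of order [n] into a
    first moment of order [sqrt n]. *)
Lemma Ex_norm_le_sqr (X : T -> R) (k : R) : 0 < k -> L1 X -> L1 (fun w => X w ^+ 2) ->
  Ex (fun w => `|X w|) <= (k + Ex (fun w => X w ^+ 2) / k) / 2.
Proof.
move=> k0 iX iX2.
have -> : (k + Ex (fun w => X w ^+ 2) / k) / 2 = Ex (fun w => k / 2 + (k^-1 / 2) * X w ^+ 2).
  by rewrite ExD; [rewrite Ex_cst ExZ//; field; lra|exact: L1_cst|exact: L1Z].
apply: Ex_le; [exact: L1_norm|by apply: L1D; [exact: L1_cst|exact: L1Z]|move=> w].
rewrite -(real_normK (num_real (X w))); set a := `|X w|.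
have -> : k / 2 + k^-1 / 2 * a ^+ 2 = a + (a - k) ^+ 2 / (2 * k) by field; lra.
by rewrite lerDl divr_ge0 ?sqr_ge0// mulr_ge0// ltW.
Qed.

(** Nonpositive cross terms suffice, which matches the one-sided estimate [Ex_mr_mul] for products
    of initial degrees. *)
Lemma orthogonal_sum_sqr (Z : nat -> T -> R) (c : R) n :
  (forall s, (1 <= s)%N -> measurable_fun setT (Z s)) ->
  (forall s, (1 <= s)%N -> L1 (fun w => Z s w ^+ 2)) ->
  (forall s, (1 <= s)%N -> Ex (fun w => Z s w ^+ 2) <= c) ->
  (forall s t, (1 <= s)%N -> (s < t)%N -> Ex (fun w => Z s w * Z t w) <= 0) ->
  L1 (fun w => (\sum_(1 <= s < n.+1) Z s w) ^+ 2) /\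
  Ex (fun w => (\sum_(1 <= s < n.+1) Z s w) ^+ 2) <= n%:R * c.
Proof.
move=> mZ iZ cZ oZ.
have mS k : measurable_fun setT (fun w => \sum_(1 <= s < k.+1) Z s w).
  elim: k => [|k IH]; first by under eq_fun do rewrite big_geq//; exact: measurable_cst.
  under eq_fun do rewrite big_nat_recr//=.
  by apply: measurable_funD => //; exact: mZ.
elim: n => [|n [i1 IH]].
  under eq_fun do rewrite big_geq// expr0n /=.
  by split; [exact: L1_cst|rewrite Ex_cst mul0r].
set S := fun w => \sum_(1 <= s < n.+1) Z s w.
have iM s : (1 <= s)%N -> L1 (fun w => Z s w * Z n.+1 w).
  by move=> s1; apply: L1_mul; [exact: mZ|exact: mZ|exact: iZ|exact: iZ].
have cross : Ex (fun w => S w * Z n.+1 w) <= 0.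
  have -> : (fun w => S w * Z n.+1 w) = (fun w => \sum_(s < n) Z s.+1 w * Z n.+1 w).
    by apply/funext => w; rewrite /S big_add1 /= big_mkord mulr_suml.
  rewrite Ex_sum => [|s]; last exact: iM.
  by apply: sumr_le0 => s _; apply: oZ => //; rewrite ltnS.
have iSZ : L1 (fun w => S w * Z n.+1 w).
  by apply: L1_mul; [exact: mS|exact: mZ|exact: i1|exact: iZ].
have E : (fun w => (\sum_(1 <= s < n.+2) Z s w) ^+ 2) =
  (fun w => S w ^+ 2 + 2 * (S w * Z n.+1 w) + Z n.+1 w ^+ 2).
  by apply/funext => w; rewrite big_nat_recr//= -/(S w); ring.
have i2 : L1 (fun w => S w ^+ 2 + 2 * (S w * Z n.+1 w)) by apply: L1D => //; exact: L1Z.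
have iZn := iZ n.+1 isT.
rewrite E; split; first exact: L1D.
rewrite ExD// ExD//; last exact: L1Z.
rewrite ExZ// -[n.+1%:R]natr1 [leRHS]mulrDl mul1r; apply: lerD; last exact: cZ.
by apply: ler_wnDr => //; rewrite pmulr_rle0.
Qed.

End second_moments.

Section initial_degrees.
Context {R : realType} {d : measure_display} {T : measurableType d}.
Variable P : probability T R.
Variable m : nat -> {RV P >-> nat}.
Hypothesis Hm : is_initial_degrees m.
Local Notation Ex := (Ex P).
Local Notation L1 := (L1 P).
Implicit Types (s t k n : nat) (w : T).

Definition mr t w : R := (m t w)%:R.
Definition second_moment : R := Ex (fun w => mr 1 w ^+ 2).
Local Notation mu := (degree_mean m).
Local Notation s2 := second_moment.

Lemma measurable_degree t (f : nat -> R) : measurable_fun setT (fun w => f (m t w)).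
Proof.
apply: (@determined_measurable _ _ _ _ (m t : T -> nat)) => [|w w' ->//].
move=> a; rewrite -[X in measurable X]setTI.
exact: (measurable_funPT (m t)).
Qed.

Lemma measurable_mr t : measurable_fun setT (mr t).
Proof. exact: (measurable_degree t (fun k => k%:R)). Qed.

Lemma mr_ge1 t w : (1 <= t)%N -> 1 <= mr t w.
Proof. by case: Hm => H _ _ _ t1; rewrite ler1n H. Qed.

Lemma mr_le_sqr t w : (1 <= t)%N -> mr t w <= mr t w ^+ 2.
Proof. by move=> t1; have := mr_ge1 w t1; rewrite expr2 => m1; rewrite ler_peMl//; lra. Qed.

Lemma identical_integral t (f : nat -> R) : (1 <= t)%N -> (forall k, 0 <= f k) ->
  (\int[P]_w (f (m t w))%:E = \int[P]_w (f (m 1%N w))%:E)%E.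
Proof.
case: t => // t _ f0; have [_ _ H _] := Hm.
rewrite -(@ge0_integral_distribution _ _ _ _ _ P (m t.+1) (EFin \o f))//.
rewrite -(@ge0_integral_distribution _ _ _ _ _ P (m 1%N) (EFin \o f))//.
by apply: eq_measure_integral => A mA _; exact: (H t 0%N A mA).
Qed.

Lemma L1_mr_sqr t : (1 <= t)%N -> L1 (fun w => mr t w ^+ 2).
Proof.
move=> t1; apply/integrableP; split.
  by apply/measurable_EFinP; exact: (measurable_degree t (fun k => k%:R ^+ 2)).
under eq_integral do rewrite /= ger0_norm ?sqr_ge0//.
rewrite (@identical_integral t (fun k => k%:R ^+ 2))//.
by have [_ _ _ +] := Hm; rewrite unlock.
Qed.

Lemma L1_mr t : (1 <= t)%N -> L1 (mr t).
Proof.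
move=> t1; apply: (L1_le (measurable_mr t) (L1_mr_sqr t1)) => w.
by rewrite ger0_norm ?mr_le_sqr// ler0n.
Qed.

Lemma Ex_mr t : (1 <= t)%N -> Ex (mr t) = mu.
Proof. by move=> t1; rewrite /Ex /Rintegral /degree_mean (@identical_integral t (fun k => k%:R))// unlock. Qed.

Lemma Ex_mr_sqr t : (1 <= t)%N -> Ex (fun w => mr t w ^+ 2) = s2.
Proof.
move=> t1; rewrite /second_moment /Ex /Rintegral.
by rewrite (@identical_integral t (fun k => k%:R ^+ 2))// => k; exact: sqr_ge0.
Qed.

Lemma mean_ge1 : 1 <= mu.
Proof.
rewrite -(@Ex_mr 1)// -[X in X <= _](Ex_cst P 1); apply: Ex_le => [||w]; [exact: L1_cst|exact: L1_mr|exact: mr_ge1].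
Qed.

(** The independent family is indexed by [t] with members [m t.+1], hence the passage to
    predecessors. *)
Lemma independent2 s t (A B : set nat) : (1 <= s)%N -> (1 <= t)%N -> s != t ->
  P (m s @^-1` A `&` m t @^-1` B) = (P (m s @^-1` A) * P (m t @^-1` B))%E.
Proof.
case: s t => [//|s] [//|t] _ _; rewrite eqSS => st; have [_ H _ _] := Hm.
have := H [:: s; t] (fun i => if i == s then A else B).
rewrite /= inE andbT (_ : s != t)// => /(_ isT) E.
rewrite !big_cons big_nil mule1 eqxx (negbTE (_ : t != s)) in E; last by rewrite eq_sym.
rewrite -E => [|i]; last by case: ifP.
congr (P _); apply/seteqP; split => w /=.
  by move=> [Aw Bw] i /=; rewrite !inE => /orP[/eqP ->|/eqP ->]; rewrite ?eqxx// eq_sym (negbTE st).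
move=> H'; split; first by have := H' s; rewrite /= !inE eqxx; apply.
by have := H' t; rewrite /= !inE eqxx orbT eq_sym (negbTE st); apply.
Qed.

Lemma Ex_indic_mul s t (A B : set nat) : (1 <= s)%N -> (1 <= t)%N -> s != t ->
  Ex (fun w => \1_A (m s w) * \1_B (m t w)) = Ex (fun w => \1_A (m s w)) * Ex (fun w => \1_B (m t w)).
Proof.
move=> s1 t1 st.
have mA k C : measurable (m k @^-1` C) by rewrite -[X in measurable X]setTI; exact: (measurable_funPT (m k)).
have E (C : set nat) k : (fun w => \1_C (m k w) : R) = \1_(m k @^-1` C) by [].
rewrite !E !Ex_indic// -fineM ?fin_num_measure// -independent2//.
rewrite -Ex_indic; last exact: measurableI.
by congr (Ex _); apply/funext => w; rewrite indicI.
Qed.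

Let trunc K t w : R := (minn (m t w) K)%:R.

(** Layer-cake formula: a truncated degree is a finite sum of indicators, to which independence
    applies directly. *)
Let truncE K t w : trunc K t w = \sum_(a < K) \1_[set k | (a < k)%N] (m t w).
Proof.
rewrite /trunc; elim: K => [|K IH]; first by rewrite big_ord0 minn0.
rewrite big_ord_recr /= -IH indicE.
have -> : (m t w \in [set k | (K < k)%N]) = (K < m t w)%N by apply/idP/idP; rewrite inE.
by rewrite -natrD; congr (_%:R); case: ltnP => /=; lia.
Qed.

Let trunc_L1 K t : L1 (trunc K t).
Proof.
apply: (@L1_bounded _ _ _ _ _ K%:R).
  exact: (measurable_degree t (fun k => (minn k K)%:R)).
by move=> w; rewrite ger0_norm ?ler0n// ler_nat geq_minr.
Qed.

Let Ex_trunc_mul K s t : (1 <= s)%N -> (1 <= t)%N -> s != t ->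
  Ex (fun w => trunc K s w * trunc K t w) = Ex (trunc K s) * Ex (trunc K t).
Proof.
move=> s1 t1 st.
have iI (A : set nat) u : L1 (fun w => \1_A (m u w)).
  apply: (@L1_bounded _ _ _ _ _ 1); first exact: (measurable_degree u (\1_A)).
  by move=> w; rewrite indicE; case: (_ \in _); rewrite ?normr1 ?normr0.
have iII (A B : set nat) : L1 (fun w => \1_A (m s w) * \1_B (m t w)).
  apply: (@L1_bounded _ _ _ _ _ 1).
    by apply: measurable_funM; [exact: (measurable_degree s (\1_A))|exact: (measurable_degree t (\1_B))].
  by move=> w; rewrite !indicE; case: (_ \in _); case: (_ \in _); rewrite ?mulr1 ?mulr0 ?normr1 ?normr0.
have E u : trunc K u = fun w => \sum_(a < K) \1_[set k | (a < k)%N] (m u w).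
  by apply/funext => w; exact: truncE.
have -> : (fun w => trunc K s w * trunc K t w) = (fun w => \sum_(a < K) \sum_(b < K)
   (\1_[set k | (a < k)%N] (m s w) * \1_[set k | (b < k)%N] (m t w))).
  apply/funext => w; rewrite !truncE mulr_suml; apply: eq_bigr => a _.
  by rewrite mulr_sumr.
rewrite Ex_sum => [|a]; last by apply: L1_sum => b; exact: iII.
rewrite !E !Ex_sum// mulr_suml; apply: eq_bigr => a _.
rewrite Ex_sum// mulr_sumr; apply: eq_bigr => b _.
exact: Ex_indic_mul.
Qed.

(** The truncated product has mean at most [mu ^+ 2] by independence, and monotone convergence
    removes the truncation. *)
Lemma Ex_mr_mul s t : (1 <= s)%N -> (1 <= t)%N -> s != t ->
  Ex (fun w => mr s w * mr t w) <= mu ^+ 2.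
Proof.
move=> s1 t1 st.
have iM : L1 (fun w => mr s w * mr t w).
  by apply: L1_mul; [exact: measurable_mr|exact: measurable_mr|exact: L1_mr_sqr|exact: L1_mr_sqr].
have tr_le u K : (1 <= u)%N -> 0 <= Ex (trunc K u) <= mu.
  move=> u1; rewrite Ex_ge0//= -(Ex_mr u1); apply: Ex_le => // [|w]; first exact: L1_mr.
  by rewrite ler_nat geq_minl.
pose g K w : \bar R := (trunc K s w * trunc K t w)%:E.
have mg K : measurable_fun setT (g K).
  apply/measurable_EFinP; apply: measurable_funM.
    exact: (measurable_degree s (fun k => (minn k K)%:R)).
  exact: (measurable_degree t (fun k => (minn k K)%:R)).
have g0 K w : (0 <= g K w)%E by rewrite lee_fin mulr_ge0.
have ndg w : {homo g ^~ w : a b / (a <= b)%N >-> (a <= b)%E}.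
  move=> a b ab; rewrite lee_fin ler_pM// ler_nat; lia.
have := @monotone_convergence _ _ _ P setT measurableT g mg (fun K w _ => g0 K w) (fun w _ => ndg w).
have -> : (fun w => limn (g ^~ w)) = (fun w => (mr s w * mr t w)%:E).
  apply/funext => w; apply: lim_near_cst => //; exists (m s w + m t w)%N => // K /= HK.
  by rewrite /g /trunc /mr (minn_idPl _) ?(minn_idPl _)//; lia.
move=> E; rewrite /Ex /Rintegral -lee_fin fineK; last exact: (integrable_fin_num measurableT iM).
rewrite E; apply: lime_le.
  by apply: ereal_nondecreasing_is_cvgn => a b ab; apply: ge0_le_integral => // w _; exact: ndg.
near=> K.
have iK : L1 (fun w => trunc K s w * trunc K t w).
  apply: (@L1_bounded _ _ _ _ _ (K%:R * K%:R)); first exact/measurable_EFinP/mg.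
  move=> w; rewrite normrM ler_pM// ger0_norm ?ler0n// ler_nat geq_minr//.
rewrite -[leLHS]fineK; last exact: (integrable_fin_num measurableT iK).
rewrite lee_fin -[leLHS]/(Ex (fun w => trunc K s w * trunc K t w)) Ex_trunc_mul//.
have /andP[? ?] := tr_le s K s1; have /andP[? ?] := tr_le t K t1.
by rewrite expr2 ler_pM.
Unshelve. all: by end_near. Qed.

Definition centered n w : R := (Mtot (fun s => m s w) n)%:R - n%:R * mu.

Lemma centeredE n w : centered n w = \sum_(1 <= s < n.+1) (mr s w - mu).
Proof. by rewrite sumrB sumr_const_nat subn1 /= -mulr_natl /centered /Mtot natr_sum. Qed.

(** The variance of one degree is at most its second moment, and the covariances are nonpositive by
    [Ex_mr_mul]. *)
Lemma centered_sqr n : L1 (fun w => centered n w ^+ 2) /\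
  Ex (fun w => centered n w ^+ 2) <= n%:R * s2.
Proof.
have -> : (fun w => centered n w ^+ 2) = (fun w => (\sum_(1 <= s < n.+1) (mr s w - mu)) ^+ 2).
  by apply/funext => w; rewrite centeredE.
have E s : (fun w => (mr s w - mu) ^+ 2) = (fun w => mr s w ^+ 2 - (2 * mu) * mr s w + mu ^+ 2).
  by apply/funext => w; ring.
have i1 s : (1 <= s)%N -> L1 (fun w => mr s w ^+ 2 - (2 * mu) * mr s w).
  by move=> s1; apply: L1B; [exact: L1_mr_sqr|apply: L1Z; exact: L1_mr].
have ic := L1_cst P.
apply: (@orthogonal_sum_sqr _ _ _ P (fun s w => mr s w - mu)) => [s s1|s s1|s s1|s t s1 st].
- by apply: measurable_funB => //; exact: measurable_mr.
- by rewrite E; apply: L1D => //; exact: i1.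
- rewrite E ExD//; last exact: i1.
  rewrite ExB ?ExZ ?Ex_cst ?Ex_mr ?Ex_mr_sqr//; [|exact: L1_mr|exact: L1_mr_sqr|by apply: L1Z; exact: L1_mr].
  by have := sqr_ge0 mu; lra.
- have t1 : (1 <= t)%N by exact: leq_trans (ltnW st).
  have iM : L1 (fun w => mr s w * mr t w).
    by apply: L1_mul; [exact: measurable_mr|exact: measurable_mr|exact: L1_mr_sqr|exact: L1_mr_sqr].
  have -> : (fun w => (mr s w - mu) * (mr t w - mu)) =
     (fun w => mr s w * mr t w - mu * mr s w - mu * mr t w + mu ^+ 2).
    by apply/funext => w; ring.
  have is_ := L1Z mu (L1_mr s1); have it := L1Z mu (L1_mr t1).
  have j1 := L1B iM is_; have j2 := L1B j1 it.
  rewrite ExD// (ExB j1 it) (ExB iM is_) ?ExZ ?Ex_cst ?Ex_mr//; [|exact: L1_mr|exact: L1_mr].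
  by have := Ex_mr_mul s1 t1 (negbT (ltn_eqF st)); rewrite expr2; lra.
Qed.

Lemma measurable_centered n : measurable_fun setT (centered n).
Proof.
have -> : centered n = (fun w => \sum_(1 <= s < n.+1) (mr s w - mu)).
  by apply/funext => w; rewrite centeredE.
elim: n => [|n IH]; first by under eq_fun do rewrite big_geq//; exact: measurable_cst.
under eq_fun do rewrite big_nat_recr//=.
by apply: measurable_funD => //; apply: measurable_funB => //; exact: measurable_mr.
Qed.

Lemma L1_centered n : L1 (centered n).
Proof.
have [i _] := centered_sqr n.
apply: (L1_le (measurable_centered n) (L1D (L1_cst P 1) i)) => w.
rewrite -(real_normK (num_real (centered n w))).
have := sqr_ge0 (`|centered n w| - 1); have := normr_ge0 (centered n w).
by move: `|_| => a; rewrite !expr2; lra.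
Qed.

Definition centered_count k n w : R := \sum_(1 <= s < n.+1) ((m s w == k)%:R - degree_prob m k).

Lemma centered_count_le k n : (1 <= n)%N ->
  L1 (centered_count k n) /\
  Ex (fun w => `|centered_count k n w|) <= Num.sqrt n%:R.
Proof.
move=> n1; set r := degree_prob m k.
have mA t : measurable (m t @^-1` [set k]) by rewrite -[X in measurable X]setTI; exact: (measurable_funPT (m t)).
have EI t : (fun w => (m t w == k)%:R : R) = (fun w => \1_[set k] (m t w)).
  apply/funext => w; rewrite indicE.
  by have -> : (m t w \in [set k]) = (m t w == k) by apply/idP/idP; rewrite inE => /eqP.
have EP t : (1 <= t)%N -> Ex (fun w => (m t w == k)%:R) = r.
  case: t => // t _; rewrite EI -[LHS]/(Ex (\1_(m t.+1 @^-1` [set k]))) Ex_indic// /r /degree_prob.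
  by have [_ _ H _] := Hm; rewrite (H t 0%N [set k] _).
have r01 : 0 <= r <= 1 by rewrite fineP_ge0 (fineP_le1 _ (mA 1%N)).
have mZ s : measurable_fun setT (fun w => (m s w == k)%:R - r).
  exact: (measurable_degree s (fun j => (j == k)%:R - r)).
have Zb s w : `|(m s w == k)%:R - r| <= 1.
  by rewrite ler_norml; move: r01 => /andP[? ?]; case: eqP => _ /=; apply/andP; split; lra.
have iI s : L1 (fun w => (m s w == k)%:R).
  apply: (@L1_bounded _ _ _ _ _ 1); first exact: (measurable_degree s (fun j => (j == k)%:R)).
  by move=> w; case: eqP; rewrite ?normr1 ?normr0.
have ic := L1_cst P.
have iZ2 s : L1 (fun w => ((m s w == k)%:R - r) ^+ 2).
  apply: (@L1_bounded _ _ _ _ _ 1); first by apply: measurable_funX; exact: mZ.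
  by move=> w; rewrite normrX exprn_ile1.
have [||||i2 E2] := @orthogonal_sum_sqr _ _ _ P (fun s w => (m s w == k)%:R - r) 1 n.
- by move=> *; exact: mZ.
- by move=> *; exact: iZ2.
- move=> s _; apply: Ex_le_cst => // w; rewrite -(real_normK (num_real _)) exprn_ile1//.
- move=> s t s1 st; have t1 : (1 <= t)%N by exact: leq_trans (ltnW st).
  have iM : L1 (fun w => (m s w == k)%:R * (m t w == k)%:R).
    apply: (@L1_bounded _ _ _ _ _ 1); last by move=> w; do 2 case: eqP => _; rewrite ?mulr1 ?mulr0 ?normr1 ?normr0.
    by apply: measurable_funM; [exact: (measurable_degree s (fun j => (j == k)%:R))|exact: (measurable_degree t (fun j => (j == k)%:R))].
  have -> : (fun w => ((m s w == k)%:R - r) * ((m t w == k)%:R - r)) =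
     (fun w => (m s w == k)%:R * (m t w == k)%:R - r * (m s w == k)%:R - r * (m t w == k)%:R + r ^+ 2).
    by apply/funext => w; ring.
  have is_ := L1Z r (iI s); have it := L1Z r (iI t).
  have j1 := L1B iM is_; have j2 := L1B j1 it.
  rewrite ExD// (ExB j1 it) (ExB iM is_) ?ExZ ?Ex_cst ?EP//.
  have -> : Ex (fun w => (m s w == k)%:R * (m t w == k)%:R) = r * r.
    have -> : (fun w => (m s w == k)%:R * (m t w == k)%:R : R) = (fun w => \1_[set k] (m s w) * \1_[set k] (m t w)).
      by apply/funext => w; rewrite -(congr1 (fun f => f w) (EI s)) -(congr1 (fun f => f w) (EI t)).
    rewrite Ex_indic_mul//; last by rewrite ltn_eqF.
    by rewrite -!EI !EP.
  by lra.
rewrite mulr1 in E2.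
have mC : measurable_fun setT (centered_count k n).
  rewrite /centered_count; elim: n {n1 i2 E2} => [|n IH].
    by under eq_fun do rewrite big_geq//; exact: measurable_cst.
  by under eq_fun do rewrite big_nat_recr//=; exact: measurable_funD.
have iC : L1 (centered_count k n).
  apply: (@L1_bounded _ _ _ _ _ n%:R) => // w.
  rewrite (le_trans (ler_norm_sum _ _ _))// (le_trans (ler_sum _ (fun s _ => Zb s w)))//.
  by rewrite sumr_const_nat subn1.
split => //.
have n0 : 0 < Num.sqrt n%:R :> R by rewrite sqrtr_gt0 ltr0n.
apply: (le_trans (Ex_norm_le_sqr n0 iC i2)).
have : Ex (fun w => centered_count k n w ^+ 2) / Num.sqrt n%:R <= Num.sqrt n%:R.
  by rewrite ler_pdivrMr// -expr2 sqr_sqrtr.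
lra.
Qed.

End initial_degrees.

(** * Averages over the edges *)

Section numeric.
Context {R : realType}.

(** With [a] and [b] the roots of [n + 1] and [n], [a^2 = b^2 + 1] and [(a - b)^2 >= 0] give
    [1 <= 2 a (a - b)]. *)
Lemma sqrt_step n : (Num.sqrt n.+1%:R)^-1 <= 2 * (Num.sqrt n.+1%:R - Num.sqrt n%:R) :> R.
Proof.
have a0 : 0 < Num.sqrt n.+1%:R :> R by rewrite sqrtr_gt0 ltr0n.
have b0 : 0 <= Num.sqrt n%:R :> R by exact: sqrtr_ge0.
have ab : Num.sqrt n%:R <= Num.sqrt n.+1%:R :> R by rewrite ler_wsqrtr// ler_nat.
have E : Num.sqrt n.+1%:R ^+ 2 = Num.sqrt n%:R ^+ 2 + 1 :> R by rewrite !sqr_sqrtr// -natr1.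
rewrite -div1r ler_pdivrMr//; move: E a0 b0 ab.
move: (Num.sqrt _) (Num.sqrt _) => a b; rewrite !expr2 => E a0 b0 ab.
have : 0 <= (a - b) * (a - b) by rewrite -expr2 sqr_ge0.
lra.
Qed.

Lemma sum_inv_sqrt n : \sum_(2 <= t < n.+1) (Num.sqrt t%:R)^-1 <= 2 * Num.sqrt n%:R :> R.
Proof.
elim: n => [|n IH]; first by rewrite big_geq// sqrtr0 mulr0.
case: n IH => [_|n IH]; first by rewrite big_geq// mulr_ge0.
rewrite big_nat_recr//=; have := sqrt_step n.+1; move: IH.
by move: (Num.sqrt n.+1%:R) => a; lra.
Qed.

Lemma sqrt_nat_ge1 n : (1 <= n)%N -> 1 <= Num.sqrt n%:R :> R.
Proof. by move=> n1; rewrite -[X in X <= _]sqrtr1 ler_wsqrtr// ler1n. Qed.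

(** Nothing is lost if [k <= B]; otherwise [k - B <= k^2 / B] terms are. A square of the number of
    edges is what the second moment can pay for. *)
Lemma truncated_sum (f : nat -> R) (c : R) k B : (0 < B)%N -> 0 <= c ->
  (forall i, (1 <= i <= k)%N -> `|f i| <= c) ->
  `|\sum_(1 <= i < k.+1) f i - \sum_(i < B) (i < k)%N%:R * f i.+1| <= c * (k%:R ^+ 2 / B%:R).
Proof.
move=> B0 c0 fc; have B0' : 0 < B%:R :> R by rewrite ltr0n.
rewrite big_add1 /= -(big_mkord xpredT (fun i => (i < k)%N%:R * f i.+1)).
have [kB|Bk] := leqP k B.
  rewrite [X in _ - X](big_cat_nat (n := k))//= [X in _ - (_ + X)]big_nat_cond.
  rewrite [X in _ - (_ + X)]big1 ?addr0; last first.
    by move=> i /andP[/andP[ki _] _]; rewrite ltnNge ki mul0r.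
  rewrite (eq_big_nat _ _ (F2 := fun i => (i < k)%N%:R * f i.+1)) ?subrr ?normr0; last first.
    by move=> i /andP[_ ik]; rewrite ik mul1r.
  by rewrite mulr_ge0// divr_ge0// exprn_ge0.
rewrite (big_cat_nat (n := B))//=; last exact: ltnW.
rewrite (eq_big_nat _ _ (F2 := fun i => f i.+1) (m := 0) (n := B) (F1 := fun i => (i < k)%N%:R * _)); last first.
  by move=> i /andP[_ iB]; rewrite (ltn_trans iB Bk) mul1r.
rewrite addrC addrK (le_trans (ler_norm_sum _ _ _))//.
apply: (@le_trans _ _ (\sum_(B <= i < k) c)).
  by apply: ler_sum_nat => i /andP[_ ik]; apply: fc.
rewrite sumr_const_nat -[c *+ _]mulr_natr ler_wpM2l// natrB 1?ltnW// ler_pdivlMr//.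
have Bk' : B%:R <= k%:R :> R by rewrite ler_nat ltnW.
rewrite expr2 mulrBl; have : k%:R * B%:R <= k%:R * k%:R :> R by rewrite ler_wpM2l.
by have := mulr_ge0 (ltW B0') (ltW B0'); lra.
Qed.

End numeric.

Section edge_sums.
Context {R : realType} {d : measure_display} {T : measurableType d}.
Variable P : probability T R.
Variables (m : nat -> {RV P >-> nat}) (x : nat -> nat -> {RV P >-> nat}).
Variable delta : R.
Hypothesis d1 : -1 < delta.
Hypothesis HPA : is_preferential_attachment delta m x.
Implicit Types (t i j n k : nat) (w : T) (psi phi : nat -> R).
Local Notation Ex := (Ex P).
Local Notation L1 := (L1 P).
Local Notation degs := (degs m).
Local Notation choices := (choices x).
Local Notation hist := (hist m x).
Local Notation s2 := (second_moment m).
Local Notation weight := (weight m x delta).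
Local Notation dsum := (dsum m x).
Local Notation chosen := (chosen m x).

Let Hm : is_initial_degrees m. Proof. by case: HPA. Qed.

Definition esum n (f : nat -> nat -> T -> R) w : R := edge_sum (degs w) n (fun t i => f t i w).

(** What edge [i] of [v_t] may depend on: [m_t], the network just before it, and its target. Sums of
    such terms are functions of the countable code, hence measurable. *)
Definition local_functional (f : nat -> nat -> T -> R) := forall t i w w',
  (2 <= t)%N -> (1 <= i <= degs w t)%N -> degs w t = degs w' t ->
  PAstep (degs w) (choices w) t i.-1 = PAstep (degs w') (choices w') t i.-1 ->
  choices w t i = choices w' t i -> f t i w = f t i w'.

Lemma esum_determined n (f : nat -> nat -> T -> R) : local_functional f ->
  determined_by (hist n n.+1 0) (esum n f).
Proof.
case: n => [|n] Hf w w' E; first by rewrite /esum /edge_sum !big_geq.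
have Ed t : (1 <= t <= n.+1)%N -> degs w t = degs w' t by exact: (hist_degs E).
have A := @hist_agree _ _ _ _ m x n.+1 n.+2 0 w w' isT (leqnn _) E.
rewrite !min0n in A; have {}A := A erefl.
apply: eq_big_nat => t /andP[t2 tn]; rewrite -Ed ?tn 1?ltnW//.
apply: eq_big_nat => i im; apply: Hf => //; first by apply: Ed; lia.
  by have [|] := A t i.-1 t2; first by apply/orP; left; lia.
have [|_] := A t i t2; first by apply/orP; left; lia.
by apply; lia.
Qed.

Lemma measurable_esum n f : local_functional f -> measurable_fun setT (esum n f).
Proof.
move=> Hf; apply: (determined_measurable _ (esum_determined (n := n) Hf)).
exact: fibers_hist.
Qed.

Lemma esum_norm n f (c : R) w :
  (forall t i w, (2 <= t)%N -> (1 <= i <= degs w t)%N -> `|f t i w| <= c) ->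
  `|esum n f w| <= \sum_(2 <= t < n.+1) c * mr m t w.
Proof.
move=> fc; rewrite (le_trans (ler_norm_sum _ _ _))//; apply: ler_sum_nat => t /andP[t2 _].
rewrite (le_trans (ler_norm_sum _ _ _))// (@le_trans _ _ (\sum_(1 <= i < (degs w t).+1) c))//.
  by apply: ler_sum_nat => i im; apply: fc.
by rewrite sumr_const_nat subn1 /= mulr_natr.
Qed.

Lemma L1_sum_nat a b (F : nat -> T -> R) : (forall t, (a <= t)%N -> L1 (F t)) ->
  L1 (fun w => \sum_(a <= t < b) F t w).
Proof.
move=> iF; rewrite (_ : (fun w => _) = (fun w => \sum_(0 <= t < b - a) F (t + a)%N w)).
  by apply: L1_sum => t; apply: iF; exact: leq_addl.
by apply/funext => w; rewrite -{1}[a]add0n big_addn.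
Qed.

Lemma Ex_sum_nat a b (F : nat -> T -> R) : (forall t, (a <= t)%N -> L1 (F t)) ->
  Ex (fun w => \sum_(a <= t < b) F t w) = \sum_(a <= t < b) Ex (F t).
Proof.
move=> iF; rewrite (_ : (fun w => _) = (fun w => \sum_(0 <= t < b - a) F (t + a)%N w)).
  rewrite Ex_sum => [|t]; last by apply: iF; exact: leq_addl.
  by rewrite -[in RHS](add0n a) [in RHS]big_addn.
by apply/funext => w; rewrite -{1}[a]add0n big_addn.
Qed.

Lemma L1_esum n f (c : R) : local_functional f ->
  (forall t i w, (2 <= t)%N -> (1 <= i <= degs w t)%N -> `|f t i w| <= c) ->
  L1 (esum n f).
Proof.
move=> Hf fc; apply: (L1_le (measurable_esum n Hf) _ (fun w => esum_norm n w fc)).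
by apply: L1_sum_nat => t t2; apply: L1Z; apply: (L1_mr Hm); exact: ltnW.
Qed.

Lemma local_dsum phi : local_functional (fun t i w => dsum phi t i.-1 w).
Proof. by move=> t i w w' t2 im _ EP _; rewrite /dsum /degree_sum EP. Qed.

Lemma local_weight : local_functional (fun t i w => weight t i.-1 w).
Proof. by move=> t i w w' t2 im _ EP _; rewrite /weight /total_weight EP. Qed.

Lemma local_chosen psi : local_functional (fun t i w => psi (chosen t i w)).
Proof. by move=> t i w w' t2 im _ EP Ec; rewrite /chosen /chosen_degree EP Ec. Qed.

Lemma local_comp (F : nat -> nat -> nat -> R -> R -> R -> R) f g h : local_functional f ->
  local_functional g -> local_functional h ->
  local_functional (fun t i w => F t i (degs w t) (f t i w) (g t i w) (h t i w)).
Proof.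
move=> Hf Hg Hh t i w w' t2 im Em EP Ec.
by rewrite -Em (Hf t i w w')// (Hg t i w w')// (Hh t i w w').
Qed.

(* sum over the grid; edge i.+1 of v_t sits in slot i *)
Definition gsum n B (f : nat -> nat -> T -> R) w : R :=
  \sum_(2 <= t < n.+1) \sum_(i < B) ind m t i w * f t i.+1 w.

Lemma esum_gsum n B f (c : R) w : (0 < B)%N -> 0 <= c ->
  (forall t i w, (2 <= t)%N -> (1 <= i <= degs w t)%N -> `|f t i w| <= c) ->
  `|esum n f w - gsum n B f w| <= \sum_(2 <= t < n.+1) c / B%:R * mr m t w ^+ 2.
Proof.
move=> B0 c0 fc; rewrite /esum /edge_sum /gsum -sumrB (le_trans (ler_norm_sum _ _ _))//.
apply: ler_sum_nat => t /andP[t2 _].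
rewrite -mulrA [B%:R^-1 * _]mulrC; apply: truncated_sum => // i im; exact: fc.
Qed.

Lemma Ex_sum_mr_sqr n (c : R) : 0 <= c ->
  L1 (fun w => \sum_(2 <= t < n.+1) c * mr m t w ^+ 2) /\
  Ex (fun w => \sum_(2 <= t < n.+1) c * mr m t w ^+ 2) <= c * (n%:R * s2).
Proof.
move=> c0; have i1 t : (2 <= t)%N -> L1 (fun w => c * mr m t w ^+ 2).
  by move=> t2; apply: L1Z; apply: (L1_mr_sqr Hm); exact: ltnW.
split; first exact: L1_sum_nat.
rewrite Ex_sum_nat// (eq_big_nat _ _ (F2 := fun _ => c * s2)); last first.
  move=> t /andP[t2 _]; rewrite ExZ; last by apply: (L1_mr_sqr Hm); exact: ltnW.
  by rewrite (Ex_mr_sqr Hm)// ltnW.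
rewrite sumr_const_nat -[_ *+ (_ - _)]mulr_natr -mulrA [s2 * _]mulrC ler_wpM2l// ler_wpM2r//.
  by apply: Ex_ge0 => w; exact: sqr_ge0.
by rewrite ler_nat; lia.
Qed.

Lemma measurable_gsum n B f : local_functional f ->
  measurable_fun setT (gsum n B f).
Proof.
move=> Hf.
have -> : gsum n B f = esum n (fun t i w => (i <= B)%N%:R * f t i w).
  apply/funext => w; apply: eq_big_nat => t /andP[t2 _].
  rewrite [in RHS]big_add1 /=.
  have [mB|Bm] := leqP (degs w t) B.
    rewrite -(big_mkord xpredT (fun i => ind m t i w * f t i.+1 w)) (big_cat_nat (n := degs w t))//=.
    rewrite [X in _ + X]big_nat_cond [X in _ + X]big1 ?addr0; last first.
      by move=> i /andP[/andP[ki _] _]; rewrite /ind ltnNge ki mul0r.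
    by apply: eq_big_nat => i /andP[_ im]; rewrite /ind im (leq_trans im mB).
  rewrite [in RHS](big_cat_nat (n := B))//=; last exact: ltnW.
  rewrite [X in _ = _ + X]big_nat_cond [X in _ = _ + X]big1 ?addr0; last first.
    by move=> i /andP[/andP[ki _] _]; rewrite ltnNge ki mul0r.
  rewrite -(big_mkord xpredT (fun i => ind m t i w * f t i.+1 w)).
  by apply: eq_big_nat => i /andP[_ iB]; rewrite /ind (ltn_trans iB Bm) iB.
apply: measurable_esum.
exact: (local_comp (fun t i _ a _ _ => (i <= B)%N%:R * a) Hf Hf Hf).
Qed.

Definition compensated psi t i w : R :=
  psi (chosen t i w) - dsum (fun k => psi k * (k%:R + delta)) t i.-1 w / weight t i.-1 w.

Lemma local_compensated psi : local_functional (compensated psi).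
Proof.
exact: (local_comp (fun _ _ _ a b c => a - b / c) (local_chosen psi) (local_dsum _) local_weight).
Qed.

Lemma compensated_norm psi (c : R) t i w : (forall k, (0 < k)%N -> `|psi k| <= c) ->
  (2 <= t)%N -> (1 <= i <= degs w t)%N -> `|compensated psi t i w| <= 2 * c.
Proof.
move=> psic t2; case: i => // i im; rewrite /compensated /=.
rewrite (le_trans (ler_normB _ _))// mulr2n mulrDl mul1r lerD//.
  by rewrite psic// (chosen_gt0 HPA).
by apply: (dsum_weight_norm d1 HPA) => //; exact: ltnW.
Qed.

Lemma gsum_compensated n B psi w : (0 < B)%N ->
  gsum n B (compensated psi) w = \sum_(k < grid_size n B) incr m x delta psi (grid_t B k) (grid_i B k) w.
Proof.
by move=> B0; rewrite (grid_sum n B0 (fun t i => incr m x delta psi t i w)).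
Qed.

(** By orthogonality only the squares remain, at most [(2c)^2] for each of at most [m_t] occupied
    slots; [m_t <= m_t^2] brings in the second moment. *)
Lemma Ex_gsum_compensated_sqr n B psi (c : R) : (0 < B)%N -> 0 <= c ->
  (forall k, (0 < k)%N -> `|psi k| <= c) ->
  L1 (fun w => gsum n B (compensated psi) w ^+ 2) /\
  Ex (fun w => gsum n B (compensated psi) w ^+ 2) <= 4 * c ^+ 2 * (n%:R * s2).
Proof.
move=> B0 c0 psic.
have hH := grid_history m x d1 n B0.
have mY := grid_mart_diff d1 HPA n B0 c0 psic.
have E : (fun w => gsum n B (compensated psi) w ^+ 2) =
  (fun w => (\sum_(k < grid_size n B) incr m x delta psi (grid_t B k) (grid_i B k) w) ^+ 2).
  by apply/funext => w; rewrite gsum_compensated.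
split.
  apply: (@L1_bounded _ _ _ _ _ (((grid_size n B)%:R * (2 * c)) ^+ 2)).
    by apply: measurable_funX; apply: measurable_gsum; exact: local_compensated.
  move=> w; rewrite gsum_compensated// normrX lerXn2r ?nnegrE ?mulr_ge0//.
  exact: (norm_sum_le (leqnn (grid_size n B)) (fun k => md_bounded mY w (k:=k))).
rewrite E (mart_sum_sqr hH mY).
have [i1 E1] := Ex_sum_mr_sqr n (c := 4 * c ^+ 2) (mulr_ge0 (ler0n _ _) (sqr_ge0 c)).
apply: le_trans E1.
have iI (k : 'I_(grid_size n B)) : L1 (fun w => incr m x delta psi (grid_t B k) (grid_i B k) w ^+ 2).
  apply: (@L1_bounded _ _ _ _ _ ((2 * c) ^+ 2)).
    apply: measurable_funX; apply: (determined_measurable _ (md_adapted mY (ltn_ord k))).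
    exact: (hist_fibers hH (ltn_ord k)).
  by move=> w; rewrite normrX lerXn2r ?nnegrE ?mulr_ge0// (md_bounded mY).
rewrite -Ex_sum//; apply: Ex_le => // [|w]; first exact: L1_sum.
rewrite (grid_sum n B0 (fun t i => incr m x delta psi t i w ^+ 2)).
apply: ler_sum_nat => t /andP[t2 _].
apply: (@le_trans _ _ (\sum_(i < B) 4 * c ^+ 2 * ind m t i w)).
  apply: ler_sum => i _; rewrite /incr exprMn [ind m t i w ^+ 2]expr2 ind_sqr.
  rewrite [leRHS]mulrC /ind; case: ltnP => im; rewrite ?mul0r// !mul1r.
  rewrite -(real_normK (num_real _)) (_ : 4 * c ^+ 2 = (2 * c) ^+ 2); last by ring.
  by rewrite lerXn2r ?nnegrE ?mulr_ge0//; exact: (compensated_norm psic t2 (i := i.+1)).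
rewrite -mulr_sumr ler_wpM2l ?mulr_ge0 ?sqr_ge0//.
apply: le_trans (mr_le_sqr Hm w (ltnW t2)).
have H : forall b, \sum_(i < b) ind m t i w = (minn b (degs w t))%:R.
  elim=> [|b IH]; first by rewrite big_ord0 min0n.
  by rewrite big_ord_recr /= IH /ind -natrD; congr (_%:R); case: ltnP => /=; lia.
by rewrite H ler_nat geq_minr.
Qed.

(* The increments are bounded and orthogonal. *)
Lemma Ex_norm_compensated psi (c : R) : 0 <= c -> (forall k, (0 < k)%N -> `|psi k| <= c) ->
  exists2 K, 0 <= K & forall n, (1 <= n)%N -> L1 (esum n (compensated psi)) /\
    Ex (fun w => `|esum n (compensated psi) w|) <= K * Num.sqrt n%:R.
Proof.
move=> c0 psic; have s20 : 0 <= s2 by apply: Ex_ge0 => w; exact: sqr_ge0.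
exists (2 * c * s2 + (1 + 4 * c ^+ 2 * s2) / 2).
  by rewrite addr_ge0 ?mulr_ge0 ?divr_ge0 ?addr_ge0 ?mulr_ge0 ?sqr_ge0.
move=> n n1.
have fb t i w : (2 <= t)%N -> (1 <= i <= degs w t)%N -> `|compensated psi t i w| <= 2 * c.
  exact: compensated_norm.
have iE := L1_esum n (local_compensated psi) fb.
split => //.
have c2 : 0 <= 2 * c by rewrite mulr_ge0.
have n0 : 0 < n%:R :> R by rewrite ltr0n.
have r0 : 0 < Num.sqrt n%:R :> R by rewrite sqrtr_gt0.
have r1 := @sqrt_nat_ge1 R n n1.
(* The grid has [B = n] slots per vertex: truncation costs [O(1)] in mean, against [sqrt n] for the
   martingale. *)
have [i1 E1] := Ex_sum_mr_sqr n (c := 2 * c / n%:R) (divr_ge0 c2 (ltW n0)).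
have [i2 E2] := Ex_gsum_compensated_sqr n n1 c0 psic.
have mG := measurable_gsum n n (local_compensated psi).
have iG : L1 (gsum n n (compensated psi)).
  apply: (L1_le mG (L1D (L1_cst P 1) i2)) => w.
  rewrite -(real_normK (num_real (gsum n n (compensated psi) w))).
  have := sqr_ge0 (`|gsum n n (compensated psi) w| - 1); have := normr_ge0 (gsum n n (compensated psi) w).
  by move: `|_| => a; rewrite !expr2; lra.
apply: (@le_trans _ _ (Ex (fun w => (\sum_(2 <= t < n.+1) 2 * c / n%:R * mr m t w ^+ 2) + `|gsum n n (compensated psi) w|))).
  apply: Ex_le; [exact: L1_norm|by apply: L1D => //; exact: L1_norm|move=> w].
  rewrite -{1}[esum n _ w](subrK (gsum n n (compensated psi) w)) (le_trans (ler_normD _ _))// lerD2r.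
  by apply: esum_gsum.
rewrite ExD//; last exact: L1_norm.
have E3 := Ex_norm_le_sqr r0 iG i2.
rewrite [leRHS]mulrDl; apply: lerD.
  apply: (le_trans E1); rewrite (_ : 2 * c / n%:R * (n%:R * s2) = 2 * c * s2); last by field; rewrite gt_eqF.
  by rewrite ler_peMr// mulr_ge0.
apply: (le_trans E3).
have -> : (1 + 4 * c ^+ 2 * s2) / 2 * Num.sqrt n%:R = (Num.sqrt n%:R + 4 * c ^+ 2 * s2 * Num.sqrt n%:R) / 2 by ring.
rewrite ler_pM2r// lerD2l ler_pdivrMr//.
rewrite [leRHS](_ : _ = 4 * c ^+ 2 * s2 * Num.sqrt n%:R ^+ 2); last by ring.
by rewrite sqr_sqrtr ?ler0n// (le_trans E2)// [n%:R * _]mulrC mulrA.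
Qed.

End edge_sums.

(** * Replacing the random weights by their limits *)

Lemma abel_summation {R : realType} (X al : nat -> R) n : (1 <= n)%N ->
  \sum_(2 <= t < n.+1) (X t - X t.-1) * al t.-1 =
  X n * al n - X 1%N * al 1%N - \sum_(2 <= t < n.+1) X t * (al t - al t.-1).
Proof.
case: n => // n _; elim: n => [|n IH]; first by rewrite !big_geq// subrr subr0.
by rewrite big_nat_recr//= IH [in RHS]big_nat_recr//=; ring.
Qed.

(** Here [A / W] is the size-biased mean at step [i], and [A0 / (t a)] its proxy at the start of
    vertex [t]. Each edge moves [A] by at most [2C], and [W - t a] is twice the centred sum [X] up
    to a constant and [i]. *)
Lemma ratio_dev_aux {R : realType} (A A0 W t a b C i mm X mu : R) :
  0 < t -> 0 < a -> 0 < b -> 0 <= C -> 0 <= i -> i <= mm -> 1 <= mm -> 0 <= mu ->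
  t * b <= W -> `|A - A0| <= i * (2 * C) -> `|A0| <= t * C -> W - t * a = 2 * X - 2 * mu + i ->
  `|A / W - A0 / (t * a)| <= (2 * C / b + C * (3 + 2 * mu) / (a * b)) * ((mm + `|X|) / t).
Proof.
move=> t0 a0 b0 C0 i0 im m1 mu0 Wb AA A0t Wa.
have tb : 0 < t * b by rewrite mulr_gt0.
have ta : 0 < t * a by rewrite mulr_gt0.
have W0 : 0 < W by exact: lt_le_trans Wb.
have -> : A / W - A0 / (t * a) = (A - A0) / W - A0 * (W - t * a) / (W * (t * a)).
  by field; rewrite !gt_eqF.
have X0 := normr_ge0 X.
have h1 : `|(A - A0) / W| <= mm * (2 * C) / (t * b).
  rewrite normrM normfV (gtr0_norm W0); apply: ler_pM => //; first by rewrite invr_ge0 ltW.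
    by apply: (le_trans AA); apply: ler_wpM2r => //; apply: mulr_ge0.
  by rewrite lef_pV2.
have dW : `|W - t * a| <= (3 + 2 * mu) * (mm + `|X|).
  rewrite Wa (le_trans (ler_normD _ _))// (ger0_norm i0).
  have : `|2 * X - 2 * mu| <= 2 * `|X| + 2 * mu.
    by rewrite (le_trans (ler_normB _ _))// !normrM !normr_nat (ger0_norm mu0).
  have : mu * 1 <= mu * mm by rewrite ler_wpM2l.
  have : 0 <= mu * `|X| by rewrite mulr_ge0.
  by lra.
have h2 : `|A0 * (W - t * a) / (W * (t * a))| <= t * C * ((3 + 2 * mu) * (mm + `|X|)) / (t * b * (t * a)).
  rewrite normrM normfV (gtr0_norm (mulr_gt0 W0 ta)); apply: ler_pM => //.
  - by rewrite invr_ge0 ltW// mulr_gt0.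
  - by rewrite normrM ler_pM.
  - by rewrite lef_pV2 ?posrE ?mulr_gt0// ler_wpM2r// ltW.
rewrite (le_trans (ler_normB _ _))// (le_trans (lerD h1 h2))//.
have -> : mm * (2 * C) / (t * b) + t * C * ((3 + 2 * mu) * (mm + `|X|)) / (t * b * (t * a))
  = (2 * C / b) * (mm / t) + C * (3 + 2 * mu) / (a * b) * ((mm + `|X|) / t).
  by field; rewrite !gt_eqF.
rewrite [leRHS]mulrDl lerD2r ler_wpM2l//; first by rewrite divr_ge0 ?mulr_ge0// ltW.
by apply: ler_wpM2r; [rewrite invr_ge0 ltW|rewrite lerDl].
Qed.

Section averages.
Context {R : realType} {d : measure_display} {T : measurableType d}.
Variable P : probability T R.
Variables (m : nat -> {RV P >-> nat}) (x : nat -> nat -> {RV P >-> nat}).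
Variable delta : R.
Hypothesis d1 : -1 < delta.
Hypothesis HPA : is_preferential_attachment delta m x.
Implicit Types (t i j n k : nat) (w : T) (psi phi : nat -> R).
Local Notation Ex := (Ex P).
Local Notation L1 := (L1 P).
Local Notation degs := (degs m).
Local Notation choices := (choices x).
Local Notation mu := (degree_mean m).
Local Notation s2 := (second_moment m).
Local Notation weight := (weight m x delta).
Local Notation dsum := (dsum m x).
Local Notation X := (centered m).

Let Hm : is_initial_degrees m. Proof. by case: HPA. Qed.
Let mg w := @degs_gt0 _ _ _ _ _ _ _ HPA w.
Let xl w := @choices_lt _ _ _ _ _ _ _ HPA w.
Let a : R := 2 * mu + delta.
Let b : R := 1 + delta.

Let mu1 : 1 <= mu := mean_ge1 Hm.
Let a0 : 0 < a. Proof. by rewrite /a; have := mu1; move: d1; lra. Qed.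
Let b0 : 0 < b. Proof. by rewrite /b; move: d1; lra. Qed.

Lemma second_moment_ge0 : 0 <= s2.
Proof. by apply: Ex_ge0 => w; exact: sqr_ge0. Qed.

Section functional.
Variables (phi : nat -> R) (C : R).
Hypothesis C0 : 0 <= C.
Hypothesis phiC : forall k, (0 < k)%N -> `|phi k| <= C.

Lemma dsum_norm t i w : (2 <= t)%N -> `|dsum phi t i w| <= t%:R * C.
Proof.
move=> t2; rewrite (le_trans (ler_norm_sum _ _ _))//.
apply: (@le_trans _ _ (\sum_(j < t) C)); last by rewrite sumr_const card_ord mulr_natl.
apply: ler_sum => j _; apply: phiC.
exact: (degree_PAstep_gt0 (@mg w) (@xl w)).
Qed.

Lemma dsum_diff t i w : (2 <= t)%N -> (i <= degs w t)%N ->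
  `|dsum phi t i w - dsum phi t 0 w| <= i%:R * (2 * C).
Proof.
move=> t2; elim: i => [|i IH] im; first by rewrite subrr normr0 mul0r.
rewrite /dsum (degree_sumS (@xl w))// -!/(dsum _ _ _ _) addrAC.
rewrite (le_trans (ler_normD _ _))// -natr1 [leRHS]mulrDl mul1r lerD//; first by apply: IH; exact: ltnW.
have D0 := chosen_gt0 HPA t2 im.
by rewrite (le_trans (ler_normB _ _))// mulr2n mulrDl mul1r lerD// phiC.
Qed.

Lemma dsum_next_diff t w : (2 <= t)%N ->
  `|dsum phi t.+1 0 w - dsum phi t 0 w| <= 3 * C * mr m t w.
Proof.
move=> t2; rewrite /dsum (degree_sum_next (@xl w))// addrAC.
rewrite (le_trans (ler_normD _ _))//.
have h1 := dsum_diff t2 (leqnn (degs w t)).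
have h2 : `|phi (degs w t)| <= C by rewrite phiC// mg// ltnW.
have := mr_ge1 Hm w (ltnW t2); rewrite /mr => m1.
have Cm : C * 1 <= C * (degs w t)%:R by rewrite ler_wpM2l.
apply: (le_trans (lerD h1 h2)); move: Cm; rewrite mulr1 /degs.
by move: (m t w)%:R => M ?; lra.
Qed.

Definition ratio_const : R := 2 * C / b + C * (3 + 2 * mu) / (a * b).

Lemma ratio_const_ge0 : 0 <= ratio_const.
Proof.
have : 0 <= 3 + 2 * mu by have := mu1; lra.
by move=> ?; rewrite addr_ge0 ?divr_ge0 ?mulr_ge0// ltW.
Qed.

Lemma ratio_dev t i w : (2 <= t)%N -> (i <= degs w t)%N ->
  `|dsum phi t i w / weight t i w - dsum phi t 0 w / (t%:R * a)|
  <= ratio_const * ((mr m t w + `|X t.-1 w|) / t%:R).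
Proof.
move=> t2 im; apply: (@ratio_dev_aux _ _ _ _ _ _ _ _ i%:R _ _ mu) => //.
- by rewrite ltr0n; lia.
- by rewrite ler_nat.
- exact: (mr_ge1 Hm w (ltnW t2)).
- by have := mu1; lra.
- exact: (weight_ge d1 HPA).
- exact: dsum_diff.
- exact: dsum_norm.
- rewrite /weight (total_weightE (@xl w))// /centered /a.
  by case: t t2 {im} => // t _; rewrite /= -[t.+1%:R]natr1 /degs; ring.
Qed.

Let al w t : R := dsum phi t.+1 0 w / t.+1%:R.

Let al_norm w t : (1 <= t)%N -> `|al w t| <= C.
Proof.
move=> t1; rewrite /al normrM normfV (ger0_norm (ler0n _ _)) ler_pdivrMr ?ltr0n// mulrC.
exact: dsum_norm.
Qed.

(** Adding [v_t] changes a sum over the vertices by [O(m_t)], so the average moves by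
    [O(m_t / t)]. *)
Let al_diff w t : (2 <= t)%N -> `|al w t - al w t.-1| <= 4 * C * (mr m t w / t%:R).
Proof.
case: t => // t t2; rewrite /al /=.
have t0 : 0 < t.+1%:R :> R by rewrite ltr0n.
have t0' : 0 < t.+2%:R :> R by rewrite ltr0n.
have tt : t.+2%:R = t.+1%:R + 1 :> R by rewrite natr1.
have -> : dsum phi t.+2 0 w / t.+2%:R - dsum phi t.+1 0 w / t.+1%:R =
  (dsum phi t.+2 0 w - dsum phi t.+1 0 w) / t.+2%:R - (dsum phi t.+1 0 w / t.+1%:R) / t.+2%:R.
  move: t0 t0'; rewrite tt; move: t.+1%:R (dsum phi t.+2 0 w) (dsum phi t.+1 0 w) => q A B q0 q1.
  by field; rewrite !gt_eqF.
have h1 := dsum_next_diff w t2.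
have h2 : `|dsum phi t.+1 0 w / t.+1%:R| <= C by exact: (al_norm w).
have m1 := mr_ge1 Hm w (ltnW t2).
have Cm : C * 1 <= C * mr m t.+1 w by rewrite ler_wpM2l.
rewrite -mulrBl normrM normfV (gtr0_norm t0').
apply: (@le_trans _ _ (4 * C * mr m t.+1 w / t.+2%:R)).
  rewrite ler_wpM2r ?invr_ge0// (le_trans (ler_normB _ _))// (le_trans (lerD h1 h2))//.
  by move: Cm; move: (mr m t.+1 w) => M; lra.
rewrite -mulrA; apply: ler_wpM2l; first by rewrite mulr_ge0.
apply: ler_wpM2l; first by rewrite (le_trans _ m1).
by rewrite lef_pV2 ?posrE// tt lerDl.
Qed.

(** Two replacements. Within vertex [t] the ratio is frozen at its initial proxy by [ratio_dev];
    then [m_t] is replaced by [mu]. The second error is a sum of [X t - X t.-1] times averages, and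
    summation by parts moves the difference onto the averages, which vary slowly, leaving [X t] of
    order [sqrt t]. *)
Lemma ratio_sum_dev n w : (1 <= n)%N ->
  `|esum m n (fun t i w => dsum phi t i.-1 w / weight t i.-1 w) w
    - mu / a * \sum_(2 <= t < n.+1) dsum phi t 0 w / t%:R| <=
  \sum_(2 <= t < n.+1) (ratio_const * (mr m t w * (mr m t w + `|X t.-1 w|) / t%:R)
      + 4 * C / a * (`|X t w| * mr m t w / t%:R)) + C / a * (`|X n w| + `|X 1 w|).
Proof.
move=> n1.
have S1 t : (2 <= t)%N -> `|\sum_(1 <= i < (degs w t).+1) dsum phi t i.-1 w / weight t i.-1 w
    - mr m t w * (dsum phi t 0 w / (t%:R * a))| <= ratio_const * (mr m t w * (mr m t w + `|X t.-1 w|) / t%:R).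
  move=> t2.
  have -> : mr m t w * (dsum phi t 0 w / (t%:R * a)) = \sum_(1 <= i < (degs w t).+1) dsum phi t 0 w / (t%:R * a).
    by rewrite sumr_const_nat subn1 /= /mr mulr_natl.
  rewrite -sumrB (le_trans (ler_norm_sum _ _ _))//.
  apply: (@le_trans _ _ (\sum_(1 <= i < (degs w t).+1) ratio_const * ((mr m t w + `|X t.-1 w|) / t%:R))).
    by apply: ler_sum_nat => i im; apply: ratio_dev => //; lia.
  rewrite sumr_const_nat subn1 /= -[_ *+ degs w t]mulr_natl /mr /degs.
  by move: (m t w)%:R => M; rewrite le_eqVlt; apply/orP; left; apply/eqP; ring.
have S2 : \sum_(2 <= t < n.+1) mr m t w * (dsum phi t 0 w / (t%:R * a)) - mu / a * \sum_(2 <= t < n.+1) dsum phi t 0 w / t%:R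
   = a^-1 * (X n w * al w n - X 1 w * al w 1 - \sum_(2 <= t < n.+1) X t w * (al w t - al w t.-1)).
  rewrite -(abel_summation (fun t => X t w) (al w) n1) mulr_sumr -sumrB mulr_sumr.
  apply: eq_big_nat => t /andP[t2 _].
  have -> : X t w - X t.-1 w = mr m t w - mu.
    by case: t t2 => // t _; rewrite /= /centered MtotS -natr1 natrD /mr; ring.
  rewrite /al prednK; last exact: ltnW.
  by field; rewrite !gt_eqF// ?ltr0n//; lia.
have S3 : `|a^-1 * (X n w * al w n - X 1 w * al w 1 - \sum_(2 <= t < n.+1) X t w * (al w t - al w t.-1))| <=
   \sum_(2 <= t < n.+1) 4 * C / a * (`|X t w| * mr m t w / t%:R) + C / a * (`|X n w| + `|X 1 w|).
  have -> : \sum_(2 <= t < n.+1) 4 * C / a * (`|X t w| * mr m t w / t%:R) + C / a * (`|X n w| + `|X 1 w|)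
     = a^-1 * (C * `|X n w| + C * `|X 1 w| + \sum_(2 <= t < n.+1) `|X t w| * (4 * C * (mr m t w / t%:R))).
    rewrite [RHS]mulrDr [RHS]addrC; congr (_ + _); last by field; rewrite gt_eqF.
    rewrite mulr_sumr; apply: eq_big_nat => t /andP[t2 _].
    by field; rewrite !gt_eqF// ?ltr0n//; lia.
  rewrite normrM normfV (gtr0_norm a0); apply: ler_wpM2l; first by rewrite invr_ge0 ltW.
  rewrite (le_trans (ler_normB _ _))// lerD//.
    have Xal t : (1 <= t)%N -> `|X t w * al w t| <= C * `|X t w|.
      by move=> t1; rewrite normrM [leRHS]mulrC; apply: ler_wpM2l => //; exact: al_norm.
    by rewrite (le_trans (ler_normB _ _))// lerD// Xal.
  rewrite (le_trans (ler_norm_sum _ _ _))//; apply: ler_sum_nat => t /andP[t2 _].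
  by rewrite normrM ler_wpM2l// al_diff.
rewrite /esum /edge_sum.
rewrite -[X in `|X - _|](subrK (\sum_(2 <= t < n.+1) mr m t w * (dsum phi t 0 w / (t%:R * a)))) -addrA S2.
rewrite (le_trans (ler_normD _ _))// big_split /= -[leRHS]addrA lerD//.
rewrite -sumrB (le_trans (ler_norm_sum _ _ _))//; apply: ler_sum_nat => t /andP[t2 _].
exact: S1.
Qed.

End functional.

(** By [2 M A / r <= M^2 + A^2 / r^2] with [r = sqrt t], where both squares have bounded mean. As
    [m_t] and [X s] are not separated by independence, the case [s = t] is covered. *)
Lemma Ex_mr_centered t s : (1 <= t)%N -> (s <= t)%N ->
  L1 (fun w => mr m t w * `|X s w| / t%:R) /\
  Ex (fun w => mr m t w * `|X s w| / t%:R) <= s2 * (Num.sqrt t%:R)^-1.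
Proof.
move=> t1 st; have [iX EX] := centered_sqr Hm s.
have iM := L1_mr_sqr Hm t1.
have t0 : 0 < t%:R :> R by rewrite ltr0n.
have r0 : 0 < Num.sqrt t%:R :> R by rewrite sqrtr_gt0.
have rr : Num.sqrt t%:R ^+ 2 = t%:R :> R by rewrite sqr_sqrtr// ltW.
have iZ : L1 (fun w => (Num.sqrt t%:R)^-1 / 2 * mr m t w ^+ 2 + (Num.sqrt t%:R)^-1 / 2 / t%:R * X s w ^+ 2).
  by apply: L1D; exact: L1Z.
have bnd w : `|mr m t w * `|X s w| / t%:R| <= (Num.sqrt t%:R)^-1 / 2 * mr m t w ^+ 2 + (Num.sqrt t%:R)^-1 / 2 / t%:R * X s w ^+ 2.
  rewrite ger0_norm; last by rewrite !mulr_ge0 ?invr_ge0// ltW.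
  rewrite -(real_normK (num_real (X s w))); move: rr r0; set r := Num.sqrt _ => <- {t0 iZ}.
  move: r (mr m t w) (`|X s w|) => r M A r0.
  rewrite -subr_ge0.
  have -> : r^-1 / 2 * M ^+ 2 + r^-1 / 2 / r ^+ 2 * A ^+ 2 - M * A / r ^+ 2 = (M - A / r) ^+ 2 / (2 * r).
    by field; rewrite gt_eqF.
  by rewrite divr_ge0 ?sqr_ge0// mulr_ge0// ltW.
have iL : L1 (fun w => mr m t w * `|X s w| / t%:R).
  apply: (L1_le _ iZ bnd).
  apply: measurable_funM => //; apply: measurable_funM; first exact: measurable_mr.
  by apply: measurableT_comp => //; exact: measurable_centered.
split => //.
apply: (@le_trans _ _ (Ex (fun w => (Num.sqrt t%:R)^-1 / 2 * mr m t w ^+ 2 + (Num.sqrt t%:R)^-1 / 2 / t%:R * X s w ^+ 2))).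
  by apply: Ex_le => // w; rewrite (le_trans (ler_norm _)).
rewrite ExD; [|exact: L1Z|exact: L1Z].
rewrite !ExZ// (Ex_mr_sqr Hm)//.
have E2 : Ex (fun w => X s w ^+ 2) / t%:R <= s2.
  rewrite ler_pdivrMr// (le_trans EX)// mulrC ler_wpM2l ?second_moment_ge0// ler_nat//.
have ri : 0 <= (Num.sqrt t%:R)^-1 / 2 :> R by rewrite divr_ge0// invr_ge0 ltW.
have := ler_wpM2l ri E2; move: ri.
by move: (Num.sqrt _)^-1 (Ex _) (t%:R^-1) s2 => r A B S; rewrite mulrA -(mulrA _ B) (mulrC B) mulrA; lra.
Qed.

Lemma Ex_norm_centered n : (1 <= n)%N ->
  Ex (fun w => `|X n w|) <= (1 + s2) / 2 * Num.sqrt n%:R.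
Proof.
move=> n1; have [iX EX] := centered_sqr Hm n.
have r0 : 0 < Num.sqrt n%:R :> R by rewrite sqrtr_gt0 ltr0n.
apply: (le_trans (Ex_norm_le_sqr r0 (L1_centered Hm n) iX)).
have : Ex (fun w => X n w ^+ 2) / Num.sqrt n%:R <= s2 * Num.sqrt n%:R.
  rewrite ler_pdivrMr// (_ : s2 * _ * _ = Num.sqrt n%:R ^+ 2 * s2); last by ring.
  by rewrite sqr_sqrtr ?ler0n.
by move: (Num.sqrt _) (_ / _) => r q; lra.
Qed.

(** The summands have means of order [1 / sqrt t], and [sum_inv_sqrt] adds them up to order
    [sqrt n]. *)
Lemma Ex_error_sum (k1 k2 k3 : R) n : 0 <= k1 -> 0 <= k2 -> 0 <= k3 -> (1 <= n)%N ->
  let E w := \sum_(2 <= t < n.+1) (k1 * (mr m t w * (mr m t w + `|X t.-1 w|) / t%:R)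
      + k2 * (`|X t w| * mr m t w / t%:R)) + k3 * (`|X n w| + `|X 1 w|) in
  L1 E /\ Ex E <= ((2 * k1 + k2) * s2 * 2 + k3 * (1 + s2)) * Num.sqrt n%:R.
Proof.
move=> k10 k20 k30 n1 E.
have s20 := second_moment_ge0.
have i1 t : (2 <= t)%N -> L1 (fun w => mr m t w * (mr m t w + `|X t.-1 w|) / t%:R) /\
   Ex (fun w => mr m t w * (mr m t w + `|X t.-1 w|) / t%:R) <= 2 * s2 * (Num.sqrt t%:R)^-1.
  move=> t2; have t1 := ltnW t2.
  have [iA EA] := Ex_mr_centered t1 (leq_pred t).
  have -> : (fun w => mr m t w * (mr m t w + `|X t.-1 w|) / t%:R) =
     (fun w => t%:R^-1 * mr m t w ^+ 2 + mr m t w * `|X t.-1 w| / t%:R).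
    by apply/funext => w; ring.
  have iB := L1Z t%:R^-1 (L1_mr_sqr Hm t1).
  split; first exact: L1D.
  rewrite ExD// ExZ; last exact: (L1_mr_sqr Hm).
  rewrite (Ex_mr_sqr Hm)//.
  have r1 := @sqrt_nat_ge1 R t t1.
  have it : t%:R^-1 <= (Num.sqrt t%:R)^-1 :> R.
    rewrite lef_pV2 ?posrE ?sqrtr_gt0 ?ltr0n// -[leRHS](@sqr_sqrtr R) ?ler0n// expr2.
    by apply: ler_peMr => //; exact: le_trans r1.
  have := ler_wpM2r s20 it; move: EA.
  by set A := Ex _; lra.
have i2 t : (2 <= t)%N -> L1 (fun w => `|X t w| * mr m t w / t%:R) /\
   Ex (fun w => `|X t w| * mr m t w / t%:R) <= s2 * (Num.sqrt t%:R)^-1.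
  move=> t2; have := Ex_mr_centered (ltnW t2) (leqnn t).
  have -> : (fun w => mr m t w * `|X t w| / t%:R) = (fun w => `|X t w| * mr m t w / t%:R) => //.
  by apply/funext => w; rewrite (mulrC (mr _ _ _)).
pose F t w := k1 * (mr m t w * (mr m t w + `|X t.-1 w|) / t%:R) + k2 * (`|X t w| * mr m t w / t%:R).
have iF t : (2 <= t)%N -> L1 (F t).
  by move=> t2; apply: L1D; apply: L1Z; [have [] := i1 t t2|have [] := i2 t t2].
have iN k : L1 (fun w => `|X k w|) by apply: L1_norm; exact: (L1_centered Hm).
have iNN : L1 (fun w => `|X n w| + `|X 1 w|) by exact: L1D.
split; first by apply: L1D; [exact: L1_sum_nat|exact: L1Z].
rewrite ExD; [|exact: L1_sum_nat|exact: L1Z].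
rewrite Ex_sum_nat// ExZ// ExD// [leRHS]mulrDl; apply: lerD.
  apply: (@le_trans _ _ (\sum_(2 <= t < n.+1) (2 * k1 + k2) * s2 * (Num.sqrt t%:R)^-1)).
    apply: ler_sum_nat => t /andP[t2 _]; have [j1 e1] := i1 t t2; have [j2 e2] := i2 t t2.
    rewrite ExD; [|exact: L1Z|exact: L1Z].
    rewrite !ExZ//; have := ler_wpM2l k10 e1; have := ler_wpM2l k20 e2.
    by move: (Ex _) (Ex _) (Num.sqrt _)^-1 s2 => A B r S; lra.
  rewrite -mulr_sumr -[leRHS]mulrA ler_wpM2l//; last exact: sum_inv_sqrt.
  by rewrite mulr_ge0// addr_ge0// mulr_ge0.
rewrite -[leRHS]mulrA ler_wpM2l//.
have e1 := Ex_norm_centered n1; have e2 := Ex_norm_centered (leqnn 1).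
rewrite sqrtr1 mulr1 in e2.
have : (1 + s2) / 2 * 1 <= (1 + s2) / 2 * Num.sqrt n%:R.
  by rewrite ler_wpM2l ?divr_ge0 ?addr_ge0// sqrt_nat_ge1.
by move: e1 e2; move: (Ex _) (Ex _) (Num.sqrt _) => A B r; lra.
Qed.

Lemma Ex_ratio_sum phi (C : R) : 0 <= C -> (forall k, (0 < k)%N -> `|phi k| <= C) ->
  exists2 K, 0 <= K & forall n, (1 <= n)%N ->
    let Z w := esum m n (fun t i w => dsum phi t i.-1 w / weight t i.-1 w) w
      - mu / a * \sum_(2 <= t < n.+1) dsum phi t 0 w / t%:R in
    L1 Z /\ Ex (fun w => `|Z w|) <= K * Num.sqrt n%:R.
Proof.
move=> C0 phiC; have s20 := second_moment_ge0.
have k1 := ratio_const_ge0 C0.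
have k2 : 0 <= 4 * C / a by rewrite divr_ge0 ?mulr_ge0// ltW.
have k3 : 0 <= C / a by rewrite divr_ge0// ltW.
exists ((2 * ratio_const C + 4 * C / a) * s2 * 2 + C / a * (1 + s2)).
  apply: addr_ge0; last by apply: mulr_ge0 => //; exact: addr_ge0.
  by apply: mulr_ge0 => //; apply: mulr_ge0 => //; apply: addr_ge0 => //; exact: mulr_ge0.
move=> n n1 Z.
have [iE EE] := Ex_error_sum k1 k2 k3 n1.
have bnd w := ratio_sum_dev C0 phiC w n1.
have mZ : measurable_fun setT Z.
  have HF : local_functional m x (fun t i w => dsum phi t i.-1 w / weight t i.-1 w).
    exact: (local_comp (fun _ _ _ u v _ => u / v) (local_dsum phi) (local_weight delta) (local_weight delta)).
  apply: measurable_funB; first exact: (measurable_esum d1 n HF).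
  apply: measurable_funM => //.
  have md t : measurable_fun setT (fun w => dsum phi t 0 w / t%:R).
    apply: (@determined_measurable _ _ _ _ (fun w => PAstep (degs w) (choices w) t 0)).
      exact: fibers_PAstep.
    by move=> w w' E; rewrite /dsum /degree_sum E.
  elim: {n1 Z iE EE bnd} n => [|n IH]; first by under eq_fun do rewrite big_geq//; exact: measurable_cst.
  case: n IH => [_|n IH]; first by under eq_fun do rewrite big_geq//; exact: measurable_cst.
  by under eq_fun do rewrite big_nat_recr//=; exact: measurable_funD.
have iZ : L1 Z by exact: L1_le iE bnd.
split => //; apply: le_trans EE.
by apply: Ex_le => //; exact: L1_norm.
Qed.

(** The edge sum is its martingale part plus its compensator, handled by [Ex_norm_compensated] and
    [Ex_ratio_sum]. Boundedness of [psi k * (k + delta)] is what the compensator requires. *)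
Lemma Ex_chosen_sum psi (c C : R) : 0 <= c -> 0 <= C ->
  (forall k, (0 < k)%N -> `|psi k| <= c) ->
  (forall k, (0 < k)%N -> `|psi k * (k%:R + delta)| <= C) ->
  exists2 K, 0 <= K & forall n, (1 <= n)%N ->
    let Z w := esum m n (fun t i w => psi (chosen m x t i w)) w
      - mu / a * \sum_(2 <= t < n.+1) dsum (fun k => psi k * (k%:R + delta)) t 0 w / t%:R in
    L1 Z /\ Ex (fun w => `|Z w|) <= K * Num.sqrt n%:R.
Proof.
move=> c0 C0 psic psiC.
have [K1 K10 H1] := Ex_norm_compensated d1 HPA c0 psic.
have [K2 K20 H2] := Ex_ratio_sum C0 psiC.
exists (K1 + K2); first exact: addr_ge0.
move=> n n1 Z; have [i1 e1] := H1 n n1; have [i2 e2] := H2 n n1.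
set Z2 := (fun w => _ - _) in i2 e2.
have ZE : Z = (fun w => esum m n (compensated m x delta psi) w + Z2 w).
  apply/funext => w; rewrite /Z /Z2 addrA; congr (_ - _).
  by rewrite /esum /edge_sum -big_split /=; apply: eq_bigr => t _; rewrite -big_split /=; apply: eq_bigr => i _; rewrite subrK.
rewrite ZE; have iZ := L1D i1 i2; split => //.
rewrite mulrDl (le_trans _ (lerD e1 e2))// -ExD; [|exact: L1_norm|exact: L1_norm].
apply: Ex_le => [||w]; [exact: L1_norm|by apply: L1D; exact: L1_norm|exact: ler_normD].
Qed.

End averages.

(** * Degree counts *)

(** Past the index [n0 >= c] the factor is at most 1, which already gives growth [2 * K1 * sqrt n]
    by [sqrt_step]; the finitely many earlier values are absorbed in [S]. *)
Lemma contraction_bound {R : realType} (u : nat -> R) (c K1 : R) : 0 <= c -> 0 <= K1 ->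
  (forall n, 0 <= u n) ->
  (forall n, (1 <= n)%N -> u n.+1 <= `|1 - c / n.+1%:R| * u n + K1 / Num.sqrt n.+1%:R) ->
  exists2 K, 0 <= K & forall n, (1 <= n)%N -> u n <= K * Num.sqrt n%:R.
Proof.
move=> c0 K10 u0 Hu; pose n0 := (Num.bound c).+1.
have cn0 : c <= n0%:R by rewrite -natr1 ler_wpDr// ltW// archi_boundP.
pose S := \sum_(j < n0.+1) u j.
have S0 : 0 <= S by apply: sumr_ge0.
have uS n : (n <= n0)%N -> u n <= S.
  rewrite -ltnS => nn0; rewrite /S (bigD1 (Ordinal nn0))//= lerDl.
  by apply: sumr_ge0.
exists (S + 2 * K1); first by rewrite addr_ge0// mulr_ge0.
suff H n : (1 <= n)%N -> u n <= S + 2 * K1 * Num.sqrt n%:R.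
  move=> n n1; apply: (le_trans (H n n1)); rewrite [leRHS]mulrDl lerD2r.
  by rewrite ler_peMr// sqrt_nat_ge1.
elim: n => // n IH _; have [/uS un|nn0] := leqP n.+1 n0.
  by rewrite (le_trans un)// lerDl mulr_ge0 ?mulr_ge0.
have n1 : (1 <= n)%N by rewrite -ltnS (leq_ltn_trans _ nn0).
have c1 : `|1 - c / n.+1%:R| <= 1.
  have : c / n.+1%:R <= 1.
    by rewrite ler_pdivrMr ?ltr0n// mul1r (le_trans cn0)// ler_nat ltnW.
  have : 0 <= c / n.+1%:R by rewrite divr_ge0.
  by move: (c / _) => q *; rewrite ler_norml; apply/andP; split; lra.
apply: (le_trans (Hu n n1)).
have := ler_piMl (u0 n) c1; have := IH n1; have := ler_wpM2l K10 (@sqrt_step R n).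
by move: (`|_| * u n) => A; move: (Num.sqrt n.+1%:R) => r; lra.
Qed.

Lemma inv_sqrtM {R : realType} (t : R) : 0 < t -> (Num.sqrt t)^-1 * t = Num.sqrt t.
Proof.
move=> t0; rewrite -[X in _ * X](sqr_sqrtr (ltW t0)) expr2 mulKf//.
by rewrite gt_eqF// sqrtr_gt0.
Qed.

(** Evaluated at [t ^ 2], the hypothesis reads [t * (A - B) <= K], which fails for large [t] if
    [B < A]. It passes from expectations at finite times to the limit law. *)
Lemma le_of_sqrt_error {R : realType} (A B K : R) :
  (forall t, (2 <= t)%N -> t%:R * A <= t%:R * B + K * Num.sqrt t%:R) -> A <= B.
Proof.
move=> H; rewrite leNgt; apply/negP => BA.
pose t := (Num.bound (`|K| / (A - B))).+2.
have AB : 0 < A - B by rewrite subr_gt0.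
have KAB : `|K| / (A - B) < t%:R.
  apply: (@lt_trans _ _ (Num.bound (`|K| / (A - B)))%:R); last by rewrite ltr_nat /t; lia.
  by rewrite archi_boundP// divr_ge0// ltW.
have := H (t ^ 2)%N; have -> : (2 <= t ^ 2)%N by rewrite -mulnn (@leq_mul 2 1).
move=> /(_ isT); rewrite natrX sqrtr_sqr (ger0_norm (ler0n _ _)).
have t0 : 0 < t%:R :> R by rewrite ltr0n.
move=> Hle; have {}Hle : t%:R * (A - B) <= K.
  rewrite -(ler_pM2l t0) mulrA -expr2 mulrBr [t%:R * K]mulrC.
  by rewrite lerBlDl.
rewrite ltr_pdivrMr// in KAB.
by have := le_lt_trans Hle (le_lt_trans (ler_norm K) KAB); rewrite ltxx.
Qed.

Section degree_counts.
Context {R : realType} {d : measure_display} {T : measurableType d}.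
Variable P : probability T R.
Variables (m : nat -> {RV P >-> nat}) (x : nat -> nat -> {RV P >-> nat}).
Variable delta : R.
Hypothesis d1 : -1 < delta.
Hypothesis HPA : is_preferential_attachment delta m x.
Implicit Types (t i j n k : nat) (w : T) (psi phi : nat -> R).
Local Notation Ex := (Ex P).
Local Notation L1 := (L1 P).
Local Notation degs := (degs m).
Local Notation choices := (choices x).
Local Notation mu := (degree_mean m).
Local Notation dsum := (dsum m x).

Variable p : nat -> R.
Hypothesis Hp : is_limit_degree_law (degree_prob m) mu delta p.

Let Hm : is_initial_degrees m. Proof. by case: HPA. Qed.
Let mg w := @degs_gt0 _ _ _ _ _ _ _ HPA w.
Let xl w := @choices_lt _ _ _ _ _ _ _ HPA w.
Let mu1 : 1 <= mu := mean_ge1 Hm.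
Let a_gt0 : 0 < 2 * mu + delta. Proof. by have := mu1; move: d1; lra. Qed.

Definition count_deg k t w : R := dsum (fun j => (j == k)%:R) t 0 w.

Lemma measurable_dsum phi t : measurable_fun setT (dsum phi t 0).
Proof.
apply: (@determined_measurable _ _ _ _ (fun w => PAstep (degs w) (choices w) t 0)).
  exact: fibers_PAstep.
by move=> w w' E; rewrite /dsum /degree_sum E.
Qed.

Lemma count_deg_ge0 k t w : 0 <= count_deg k t w.
Proof. exact: sumr_ge0. Qed.

Lemma count_deg_le k t w : count_deg k t w <= t%:R.
Proof.
apply: (@le_trans _ _ (\sum_(j < t) 1)); last by rewrite sumr_const card_ord.
by apply: ler_sum => j _; rewrite lern1 leq_b1.
Qed.

Lemma L1_count_deg k t : L1 (count_deg k t).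
Proof.
apply: (@L1_bounded _ _ _ _ _ t%:R); first exact: measurable_dsum.
by move=> w; rewrite ger0_norm ?count_deg_ge0// count_deg_le.
Qed.

(** This is [(k + delta) / theta], since [theta = (2 mu + delta) / mu]. *)
Definition rate k : R := (k%:R + delta) * (mu / (2 * mu + delta)).

Lemma law_recursion k : (1 <= k)%N ->
  p k = rate k.-1 * p k.-1 - rate k * p k + degree_prob m k.
Proof.
move=> k1; have [_ H] := Hp; rewrite {1}(H k k1) /rate.
have -> : (theta mu delta)^-1 = mu / (2 * mu + delta).
  rewrite /theta; have m0 : 0 < mu by have := mu1; lra.
  have m2 : 2 + delta / mu = (2 * mu + delta) / mu by field; rewrite gt_eqF.
  by rewrite m2 invf_div.
by case: k k1 {H} => // k _; rewrite /= -natr1; ring.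
Qed.

Definition hits k n w : R := esum m n (fun t i w => (chosen m x t i w == k)%:R) w
  - rate k * \sum_(2 <= t < n.+1) count_deg k t w / t%:R.

Lemma Ex_hits k : exists2 K, 0 <= K & forall n, (1 <= n)%N ->
  L1 (hits k n) /\ Ex (fun w => `|hits k n w|) <= K * Num.sqrt n%:R.
Proof.
have [j _|j _|K K0 HK] := Ex_chosen_sum (psi := fun j => (j == k)%:R) d1 HPA ler01 (normr_ge0 (k%:R + delta)).
- by case: eqP; rewrite ?normr1 ?normr0.
- by case: eqP => [->|_]; rewrite ?mul1r ?mul0r ?normr0.
exists K => // n n1; have := HK n n1; set Z := (fun w => _).
suff -> : Z = hits k n by [].
apply/funext => w; rewrite /Z /hits; congr (_ - _).
rewrite /rate -mulrA mulr_sumr [in LHS]mulr_sumr mulr_sumr; apply: eq_bigr => t _.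
rewrite /count_deg.
have -> : dsum (fun k0 => (k0 == k)%:R * (k0%:R + delta)) t 0 w = (k%:R + delta) * dsum (fun j => (j == k)%:R) t 0 w.
  rewrite /dsum /degree_sum mulr_sumr; apply: eq_bigr => j _.
  by case: eqP => [->|_]; rewrite ?mul1r ?mulr1 ?mul0r ?mulr0.
by ring.
Qed.

(** The recursion closes on this accumulated deviation of the frequencies: the number of hits of
    degree [k] is governed by the sum of [count_deg k t / t], not by the current count. *)
Definition excess k n w : R := \sum_(2 <= t < n.+1) (count_deg k t w / t%:R - p k).

Lemma L1_excess k n : L1 (excess k n).
Proof.
apply: L1_sum_nat => // t t2; apply: L1B; last exact: L1_cst.
under eq_fun do rewrite mulrC; apply: L1Z; exact: L1_count_deg.
Qed.

(** Everything that drives level [k] except its own excess. The last constant comes from the sums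
    starting at [t = 2] while there are [n.+1] vertices at time [n]. *)
Definition innovation k n w : R := (m 1%N w == k)%:R + centered_count m k n w
  + hits k.-1 n w - hits k n w + rate k.-1 * excess k.-1 n w
  + (rate k * p k - rate k.-1 * p k.-1 - p k).

Lemma count_deg_next k n w : (1 <= k)%N -> (1 <= n)%N ->
  count_deg k n.+1 w - n.+1%:R * p k = innovation k n w - rate k * excess k n w.
Proof.
move=> k1 n1; rewrite /count_deg /dsum (degree_sumE (@xl w))//.
have E1 j : esum m n (fun t i w => (chosen m x t i w == j)%:R) w =
    hits j n w + rate j * (excess j n w + (n.-1)%:R * p j).
  rewrite /hits /excess sumrB sumr_const_nat subSS -subn1 mulr_natl.
  by rewrite subrK subrK.
have E2 : edge_sum (degs w) n (fun t i => ((chosen_degree (degs w) (choices w) t i).+1 == k)%:R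
      - (chosen_degree (degs w) (choices w) t i == k)%:R) =
   esum m n (fun t i w => (chosen m x t i w == k.-1)%:R) w - esum m n (fun t i w => (chosen m x t i w == k)%:R) w.
  rewrite edge_sumB; congr (_ - _); apply: eq_bigr => t _; apply: eq_bigr => i _.
  by case: k k1 => // k _; rewrite eqSS.
have E3 : (degs w 1 == k)%:R + \sum_(2 <= t < n.+1) (degs w t == k)%:R = centered_count m k n w + n%:R * degree_prob m k.
  rewrite /centered_count sumrB sumr_const_nat subSS subn0 mulr_natl subrK.
  by rewrite [in RHS]big_ltn.
have {}E3 : \sum_(2 <= t < n.+1) (degs w t == k)%:R = centered_count m k n w + n%:R * degree_prob m k - (degs w 1 == k)%:R.
  by rewrite -E3 addrC addKr.
rewrite E2 !E1 E3.
have := law_recursion k1; rewrite /innovation.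
have -> : n%:R = (n.-1)%:R + 1 :> R by rewrite natr1 prednK.
rewrite -natr1 (_ : n%:R = (n.-1)%:R + 1 :> R); last by rewrite natr1 prednK.
move: (hits _ _ _) (hits _ _ _) (excess _ _ _) (excess _ _ _) (centered_count _ _ _ _) => h h' s s' cc.
move: (n.-1)%:R (degree_prob m k) (p k) (p k.-1) (rate k) (rate k.-1) => N r pk pk' c c' E.
have -> : r = pk - c' * pk' + c * pk by rewrite {1}E; ring.
rewrite /degs; ring.
Qed.

(** After division of [count_deg_next] by [n.+1], the new term of the sum pulls the excess back with
    strength [rate k / n.+1]. *)
Lemma excess_next k n w : (1 <= k)%N -> (1 <= n)%N ->
  excess k n.+1 w = (1 - rate k / n.+1%:R) * excess k n w + innovation k n w / n.+1%:R.
Proof.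
move=> k1 n1; rewrite {1}/excess big_nat_recr//= -/(excess k n w).
have := count_deg_next w k1 n1; have : n.+1%:R != 0 :> R by [].
move: (count_deg _ _ _) (innovation _ _ _) n.+1%:R => A B N N0 E.
have -> : A = B - rate k * excess k n w + N * p k by rewrite -E subrK.
by field.
Qed.

Lemma rate_ge0 k : (1 <= k)%N -> 0 <= rate k.
Proof.
move=> k1; have k1' : 1 <= k%:R :> R by rewrite ler1n.
have m0 : 0 <= mu by rewrite (le_trans _ mu1).
apply: mulr_ge0; last by rewrite divr_ge0// ltW.
by move: d1; lra.
Qed.

Definition root_rate k := exists2 K, 0 <= K & forall t, (2 <= t)%N ->
  Ex (fun w => `|count_deg k t w - t%:R * p k|) <= K * Num.sqrt t%:R.

Lemma L1_count_dev k t : L1 (fun w => count_deg k t w - t%:R * p k).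
Proof. by apply: L1B; [exact: L1_count_deg|exact: L1_cst]. Qed.

Lemma Ex_excess k : root_rate k -> exists2 K, 0 <= K & forall n,
  Ex (fun w => `|excess k n w|) <= K * Num.sqrt n%:R.
Proof.
move=> [K K0 HK]; exists (K * 2); first exact: mulr_ge0.
move=> n.
have iD t : L1 (fun w => `|count_deg k t w / t%:R - p k|).
  apply: L1_norm; apply: L1B; last exact: L1_cst.
  by under eq_fun do rewrite mulrC; apply: L1Z; exact: L1_count_deg.
apply: (@le_trans _ _ (Ex (fun w => \sum_(2 <= t < n.+1) `|count_deg k t w / t%:R - p k|))).
  apply: Ex_le; [exact/L1_norm/L1_excess|exact: L1_sum|move=> w; exact: ler_norm_sum].
rewrite Ex_sum// -mulrA (le_trans _ (ler_wpM2l K0 (sum_inv_sqrt n)))// mulr_sumr.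
apply: ler_sum_nat => t /andP[t2 _]; have t0 : 0 < t%:R :> R by rewrite ltr0n; lia.
have -> : (fun w => `|count_deg k t w / t%:R - p k|) = (fun w => t%:R^-1 * `|count_deg k t w - t%:R * p k|).
  apply/funext => w; rewrite -{2}(@gtr0_norm _ t%:R^-1) ?invr_gt0// -normrM.
  by congr `|_|; field; rewrite gt_eqF.
rewrite ExZ; last exact/L1_norm/L1_count_dev.
rewrite mulrC ler_pdivrMr// (le_trans (HK t t2))// -mulrA ler_wpM2l//.
by rewrite inv_sqrtM.
Qed.

(** Induction on the degree: degree 0 never occurs, and the excess of level [k], of order [sqrt n]
    by induction, is part of the noise of level [k.+1]. Then [contraction_bound] applies to the mean
    absolute excess, and [count_deg_next] returns to the counts. *)
Theorem count_deg_root_rate k : root_rate k.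
Proof.
elim: k => [|k IH].
  exists 0 => // t t2; rewrite mul0r.
  have [p0 _] := Hp; rewrite p0 mulr0.
  have -> : (fun w => `|count_deg 0 t w - 0|) = fun=> 0.
    apply/funext => w; rewrite subr0 /count_deg /dsum /degree_sum big1 ?normr0// => j _.
    by rewrite gtn_eqF// (degree_PAstep_gt0 (@mg w) (@xl w)).
  by rewrite Ex_cst.
have [K K0 HK] := Ex_excess IH.
have [H1 H10 HH1] := Ex_hits k; have [H2 H20 HH2] := Ex_hits k.+1.
pose k0 := `|rate k.+1 * p k.+1 - rate k * p k - p k.+1|.
pose K1 := 1 + 1 + H1 + H2 + `|rate k| * K + k0.
have k00 : 0 <= k0 by exact: normr_ge0.
have rK0 : 0 <= `|rate k| * K by exact: mulr_ge0.
have K10 : 0 <= K1 by rewrite /K1; do 5 (apply: addr_ge0 => //).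
have Einn n : (1 <= n)%N -> L1 (innovation k.+1 n) /\
    Ex (fun w => `|innovation k.+1 n w|) <= K1 * Num.sqrt n%:R.
  move=> n1; have [i1 e1] := HH1 n n1; have [i2 e2] := HH2 n n1.
  have [i3 e3] := centered_count_le Hm k.+1 n1.
  have i4 := L1_excess k n; have e4 := HK n.
  have i0 : L1 (fun w => (m 1%N w == k.+1)%:R).
    apply: (@L1_bounded _ _ _ _ _ 1); first exact: (measurable_degree m 1 (fun j => (j == k.+1)%:R)).
    by move=> w; case: eqP; rewrite ?normr1 ?normr0.
  have ic := L1_cst P (rate k.+1 * p k.+1 - rate k * p k - p k.+1).
  have i03 := L1D i0 i3; have i013 := L1D i03 i1; have i0123 := L1B i013 i2.
  have i5 := L1Z (rate k) i4; have i6 := L1D i0123 i5; have iI := L1D i6 ic.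
  split; first exact: iI.
  have bnd w : `|innovation k.+1 n w| <= (1 + k0) + `|centered_count m k.+1 n w| + `|hits k n w| + `|hits k.+1 n w|
      + `|rate k| * `|excess k n w|.
    rewrite /innovation /= -normrM.
    have : `|(m 1%N w == k.+1)%:R| <= 1 :> R by case: eqP; rewrite ?normr1 ?normr0.
    rewrite /k0; move: (_ * p _ - _ - _) (_%:R) (centered_count _ _ _ _) (hits _ _ _) (hits _ _ _) (rate k * _) => A B C D E F B1.
    rewrite (le_trans (ler_normD _ _))// (le_trans (lerD (ler_normD _ _) (lexx _)))//.
    have := ler_normB (B + C + E) D; have := ler_normD (B + C) E; have := ler_normD B C.
    by move: B1; lra.
  have j1 := L1D (L1_cst P (1 + k0)) (L1_norm i3); have j2 := L1D j1 (L1_norm i1).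
  have j3 := L1D j2 (L1_norm i2); have j4 := L1Z `|rate k| (L1_norm i4); have j5 := L1D j3 j4.
  apply: (le_trans (Ex_le (L1_norm iI) j5 bnd)).
  rewrite (ExD j3 j4) (ExD j2 (L1_norm i2)) (ExD j1 (L1_norm i1)) (ExD (L1_cst P (1 + k0)) (L1_norm i3)).
  rewrite Ex_cst (ExZ _ (L1_norm i4)).
  have r1 := @sqrt_nat_ge1 R n n1.
  have e5 := ler_wpM2l (normr_ge0 (rate k)) e4.
  have k01 : (1 + k0) * 1 <= (1 + k0) * Num.sqrt n%:R by rewrite ler_wpM2l// addr_ge0.
  move: e1 e2 e3 e5 k01; rewrite /K1.
  move: (Ex _) (Ex _) (Ex _) (`|rate k| * Ex _) (Num.sqrt _) => A B C D r.
  by clearbody k0; lra.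
have c0 := rate_ge0 (isT : (1 <= k.+1)%N).
have u_rec n : (1 <= n)%N -> Ex (fun w => `|excess k.+1 n.+1 w|) <=
    `|1 - rate k.+1 / n.+1%:R| * Ex (fun w => `|excess k.+1 n w|) + K1 / Num.sqrt n.+1%:R.
  move=> n1; have [iI eI] := Einn n n1; have iS := L1_excess k.+1 n.
  have N0 : 0 < n.+1%:R :> R by rewrite ltr0n.
  have j1 := L1Z `|1 - rate k.+1 / n.+1%:R| (L1_norm iS).
  have j2 := L1Z n.+1%:R^-1 (L1_norm iI).
  apply: (@le_trans _ _ (Ex (fun w => `|1 - rate k.+1 / n.+1%:R| * `|excess k.+1 n w| + n.+1%:R^-1 * `|innovation k.+1 n w|))).
    apply: Ex_le; [exact/L1_norm/L1_excess|exact: L1D|move=> w].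
    rewrite excess_next// (le_trans (ler_normD _ _))// !normrM lerD2l mulrC.
    by rewrite normfV (gtr0_norm N0).
  rewrite ExD// !ExZ; [|exact: L1_norm|exact: L1_norm].
  rewrite lerD2l mulrC ler_pdivrMr// (le_trans eI)// -mulrA ler_wpM2l//.
  rewrite inv_sqrtM//.
  by rewrite ler_wsqrtr// ler_nat.
have [K2 K20 HK2] := contraction_bound c0 K10 (fun n => Ex_ge0 P (fun w => normr_ge0 (excess k.+1 n w))) u_rec.
exists (K1 + rate k.+1 * K2); first by rewrite addr_ge0// mulr_ge0.
case=> // n; rewrite ltnS => n1.
have [iI eI] := Einn n n1; have iS := L1_excess k.+1 n.
have j2 := L1Z (rate k.+1) (L1_norm iS).
apply: (@le_trans _ _ (Ex (fun w => `|innovation k.+1 n w| + rate k.+1 * `|excess k.+1 n w|))).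
  apply: Ex_le; [exact/L1_norm/L1_count_dev|by apply: L1D => //; exact: L1_norm|move=> w].
  rewrite count_deg_next// (le_trans (ler_normB _ _))// lerD2l normrM ler_wpM2r//.
  by rewrite ger0_norm.
rewrite ExD//; last exact: L1_norm.
rewrite ExZ; last exact: L1_norm.
have e2 := ler_wpM2l c0 (HK2 n n1).
have rn : Num.sqrt n%:R <= Num.sqrt n.+1%:R :> R by rewrite ler_wsqrtr// ler_nat.
apply: (le_trans (lerD eI e2)); rewrite mulrA -mulrDl ler_wpM2l//.
by rewrite addr_ge0// mulr_ge0.
Qed.

End degree_counts.

(** * The limit law of the degrees *)

Section limit_law.
Context {R : realType} {d : measure_display} {T : measurableType d}.
Variable P : probability T R.
Variables (m : nat -> {RV P >-> nat}) (x : nat -> nat -> {RV P >-> nat}).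
Variable delta : R.
Hypothesis d1 : -1 < delta.
Hypothesis HPA : is_preferential_attachment delta m x.
Implicit Types (t i j n k K : nat) (w : T) (psi phi : nat -> R).
Local Notation Ex := (Ex P).
Local Notation L1 := (L1 P).
Local Notation degs := (degs m).
Local Notation choices := (choices x).
Local Notation mu := (degree_mean m).
Local Notation dsum := (dsum m x).
Local Notation weight := (weight m x delta).
Local Notation count_deg := (count_deg m x).

Variable p : nat -> R.
Hypothesis Hp : is_limit_degree_law (degree_prob m) mu delta p.

Let Hm : is_initial_degrees m. Proof. by case: HPA. Qed.
Let mg w := @degs_gt0 _ _ _ _ _ _ _ HPA w.
Let xl w := @choices_lt _ _ _ _ _ _ _ HPA w.
Let mu1 : 1 <= mu := mean_ge1 Hm.
Let a : R := 2 * mu + delta.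
Let a_gt0 : 0 < a. Proof. by rewrite /a; have := mu1; move: d1; lra. Qed.
Let mu_gt0 : 0 < mu. Proof. by rewrite (lt_le_trans _ mu1). Qed.

Lemma kdelta_gt0 k : (1 <= k)%N -> 0 < k%:R + delta.
Proof. by move=> k1; have : 1 <= k%:R :> R by [rewrite ler1n]; move: d1; lra. Qed.

(** The device for inequalities on [p]: a linear bound on expected counts of finitely many degrees
    survives division by [t], because the counts are within order [sqrt t] of [t * p k] in mean. *)
Lemma law_le (al : nat -> R) K (be : R) :
  (forall t, (2 <= t)%N ->
     Ex (fun w => \sum_(k < K) al k * count_deg k t w) <= t%:R * be) ->
  \sum_(k < K) al k * p k <= be.
Proof.
move=> H.
have [C C0 HC] : exists2 C, 0 <= C & forall t, (2 <= t)%N ->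
    Ex (fun w => `|\sum_(k < K) al k * (count_deg k t w - t%:R * p k)|) <= C * Num.sqrt t%:R.
  elim: K {H} => [|K [C C0 HC]].
    by exists 0 => // t t2; under eq_fun do rewrite big_ord0 normr0; rewrite Ex_cst mul0r.
  have [D D0 HD] := count_deg_root_rate d1 HPA Hp K.
  exists (C + `|al K| * D); first by rewrite addr_ge0// mulr_ge0.
  move=> t t2.
  have i1 k : L1 (fun w => al k * (count_deg k t w - t%:R * p k)) by apply: L1Z; exact: L1_count_dev.
  have i2 := L1_norm (L1_count_dev m x p K t).
  have i3 := L1_norm (L1_sum (index_enum 'I_K) (fun k : 'I_K => i1 k)).
  apply: (@le_trans _ _ (Ex (fun w => `|\sum_(k < K) al k * (count_deg k t w - t%:R * p k)| + `|al K| * `|count_deg K t w - t%:R * p K|))).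
    apply: Ex_le => [||w]; [|apply: L1D => //; exact: L1Z|].
      exact: L1_norm (L1_sum (index_enum 'I_K.+1) (fun k : 'I_K.+1 => i1 k)).
    by rewrite big_ord_recr /= (le_trans (ler_normD _ _))// normrM.
  rewrite ExD//; last exact: L1Z.
  rewrite ExZ// [leRHS]mulrDl lerD ?HC// -mulrA ler_wpM2l//; exact: HD.
apply: (@le_of_sqrt_error _ _ _ C) => t t2.
have iD k := L1_count_dev m x p k t.
have iC k := L1_count_deg m x k t.
have iS : L1 (fun w => \sum_(k < K) al k * (count_deg k t w - t%:R * p k)).
  by apply: L1_sum => k; exact: L1Z.
have -> : t%:R * (\sum_(k < K) al k * p k) = Ex (fun w => \sum_(k < K) al k * count_deg k t w)
    - Ex (fun w => \sum_(k < K) al k * (count_deg k t w - t%:R * p k)).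
  rewrite -ExB//; last by apply: L1_sum => k; exact: L1Z.
  rewrite -[LHS](Ex_cst P); congr (Ex _); apply/funext => w.
  by rewrite -sumrB mulr_sumr; apply: eq_bigr => k _; ring.
apply: lerD; first exact: H.
by rewrite (le_trans _ (HC t t2))// (le_trans (ler_norm _))// normrN norm_Ex.
Qed.

Lemma law_ge0 k : 0 <= p k.
Proof.
have := @law_le (fun j => - (j == k)%:R) k.+1 0.
rewrite big_ord_recr /= eqxx mulN1r big1 ?add0r => [|j _]; last by rewrite ltn_eqF// oppr0 mul0r.
move=> H; rewrite -oppr_le0; apply: H => t t2; rewrite mulr0.
have -> : (fun w => \sum_(j < k.+1) - ((j : nat) == k)%:R * count_deg j t w) = (fun w => (-1) * count_deg k t w).
  apply/funext => w; rewrite big_ord_recr /= eqxx big1 ?add0r ?mulN1r// => j _.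
  by rewrite ltn_eqF// oppr0 mul0r.
rewrite ExZ; last exact: L1_count_deg.
by rewrite mulN1r oppr_le0 Ex_ge0// => w; exact: count_deg_ge0.
Qed.

Lemma dsum_split phi K t w : dsum phi t 0 w =
  \sum_(k < K) phi k * count_deg k t w + dsum (fun j => (K <= j)%N%:R * phi j) t 0 w.
Proof.
rewrite /count_deg /dsum /degree_sum.
under [X in _ = X + _]eq_bigr do rewrite mulr_sumr.
rewrite exchange_big /= -big_split /=; apply: eq_bigr => j _.
set g := degree _ _; case: leqP => Kg.
  rewrite mul1r big1 ?add0r// => k _; rewrite gtn_eqF ?mulr0//.
  exact: leq_trans (ltn_ord k) Kg.
rewrite mul0r addr0 (bigD1 (Ordinal Kg))//= eqxx mulr1 big1 ?addr0// => k kg.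
rewrite (_ : (g == k) = false) ?mulr0//; apply/negbTE; rewrite eq_sym.
by apply: contra kg => /eqP kg; apply/eqP/val_inj.
Qed.

Lemma law_sum_le1 K : \sum_(k < K) p k <= 1.
Proof.
suff : \sum_(k < K) 1 * p k <= 1 by under eq_bigr do rewrite mul1r.
apply: (@law_le (fun=> 1)) => t t2; rewrite mulr1; apply: Ex_le_cst => [|w].
  by apply: L1_sum => k; apply: L1Z; exact: L1_count_deg.
have := dsum_split (fun=> 1) K t w.
have -> : dsum (fun=> 1) t 0 w = t%:R by rewrite /dsum /degree_sum sumr_const card_ord.
by move=> ->; rewrite lerDl; apply: sumr_ge0 => j _; rewrite mulr_ge0.
Qed.

Lemma dsum_weight0 t w : (2 <= t)%N ->
  dsum (fun k => k%:R + delta) t 0 w = t%:R * delta + 2 * (\sum_(1 <= s < t) mr m s w).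
Proof.
move=> t2; rewrite -[LHS]/(total_weight (degs w) (choices w) delta t 0) (total_weightE (@xl w))//.
by case: t t2 => // t _; rewrite addr0 /Mtot natr_sum.
Qed.

Lemma Ex_sum_mr t : (2 <= t)%N -> L1 (fun w => \sum_(1 <= s < t) mr m s w) /\
  Ex (fun w => \sum_(1 <= s < t) mr m s w) = t.-1%:R * mu.
Proof.
move=> t2; have iM s : (1 <= s)%N -> L1 (mr m s) by exact: (L1_mr Hm).
split; first exact: L1_sum_nat.
rewrite Ex_sum_nat// (eq_big_nat _ _ (F2 := fun=> mu)) ?sumr_const_nat ?subn1 ?mulr_natl//.
by move=> s /andP[s1 _]; exact: (Ex_mr Hm).
Qed.

Lemma law_weighted_sum_le K : \sum_(k < K) (k%:R + delta) * p k <= a.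
Proof.
apply: (@law_le (fun k => k%:R + delta)) => t t2; have [iS eS] := Ex_sum_mr t2.
apply: (@le_trans _ _ (Ex (fun w => t%:R * delta + 2 * (\sum_(1 <= s < t) mr m s w)))).
  apply: Ex_le => [||w].
  - by apply: L1_sum => k; apply: L1Z; exact: L1_count_deg.
  - by apply: L1D; [exact: L1_cst|exact: L1Z].
  - rewrite -dsum_weight0// (dsum_split _ K) lerDl; apply: sumr_ge0 => j _.
    rewrite mulr_ge0//; apply/ltW/kdelta_gt0.
    exact: (degree_PAstep_gt0 (@mg w) (@xl w)).
rewrite ExD; [|exact: L1_cst|exact: L1Z].
rewrite Ex_cst ExZ// eS /a.
have : t.-1%:R * mu <= t%:R * mu by rewrite ler_wpM2r ?ler_nat ?leq_pred// ltW.
by move: (t.-1%:R * mu) => A; lra.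
Qed.

(** At most [2 M_{t-1} / K] vertices have degree [K] or more, as the degrees add up to [2 M_{t-1}];
    no mass escapes to infinity. *)
Lemma law_sum_ge K : (1 <= K)%N -> 1 - 2 * mu / K%:R <= \sum_(k < K) p k.
Proof.
move=> K1; have K0 : 0 < K%:R :> R by rewrite ltr0n.
have : \sum_(k < K) -1 * p k <= - (1 - 2 * mu / K%:R).
  apply: (@law_le (fun=> -1)) => t t2; have [iS eS] := Ex_sum_mr t2.
  apply: (@le_trans _ _ (Ex (fun w => - t%:R + 2 / K%:R * (\sum_(1 <= s < t) mr m s w)))).
    apply: Ex_le => [||w].
    - by apply: L1_sum => k; apply: L1Z; exact: L1_count_deg.
    - by apply: L1D; [exact: L1_cst|exact: L1Z].
    - have h1 := dsum_split (fun=> 1) K t w.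
      have e1 : dsum (fun=> 1) t 0 w = t%:R by rewrite /dsum /degree_sum sumr_const card_ord.
      have h2 : dsum (fun j => (K <= j)%N%:R * 1) t 0 w <= K%:R^-1 * dsum (fun j => j%:R) t 0 w.
        rewrite /dsum /degree_sum mulr_sumr; apply: ler_sum => j _.
        set g := degree _ _; case: leqP => Kg; last by rewrite mul0r mulr_ge0// invr_ge0.
        by rewrite mulr1 mulrC ler_pdivlMr// mul1r ler_nat.
      have h3 : dsum (fun j => j%:R) t 0 w = 2 * (\sum_(1 <= s < t) mr m s w).
        have := dsum_weight0 w t2; rewrite /dsum /degree_sum big_split /= sumr_const card_ord.
        by rewrite -[delta *+ t]mulr_natl addrC => h; apply: (addrI (t%:R * delta)).
      rewrite h3 in h2; rewrite e1 in h1; rewrite -mulr_sumr mulN1r.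
      have -> : 2 / K%:R * (\sum_(1 <= s < t) mr m s w) = K%:R^-1 * (2 * \sum_(1 <= s < t) mr m s w) by ring.
      move: h1 h2; under eq_bigr do rewrite mul1r.
      by move: (dsum _ _ _ _) (\sum_(k < K) _) (_^-1 * _) => A B D; lra.
  rewrite ExD; [|exact: L1_cst|exact: L1Z].
  rewrite Ex_cst ExZ// eS.
  have -> : t%:R * - (1 - 2 * mu / K%:R) = - t%:R + 2 / K%:R * (t%:R * mu) by field; rewrite gt_eqF.
  rewrite lerD2l ler_wpM2l ?divr_ge0// ler_wpM2r ?ler_nat ?leq_pred//.
  exact: ltW.
by rewrite -mulr_sumr mulN1r lerN2.
Qed.

(** Mass exists by [law_sum_ge], and the recursion passes it from [k] to [k.+1] because [rate k] is
    positive. Two consecutive degrees are wanted since at most one of them can make the square in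
    [nu_0] vanish. *)
Lemma law_gt0_ex : exists k, [/\ (1 <= k)%N, 0 < p k & 0 < p k.+1].
Proof.
pose K := (Num.bound (2 * mu)).+1.
have K0 : 2 * mu < K%:R.
  apply: (@lt_trans _ _ (Num.bound (2 * mu))%:R); last by rewrite ltr_nat.
  by rewrite archi_boundP// mulr_ge0// ltW.
have Kp : 0 < K%:R :> R by rewrite ltr0n.
have S0 : 0 < \sum_(k < K) p k.
  by apply: lt_le_trans (law_sum_ge (isT : (1 <= K)%N)); rewrite subr_gt0 ltr_pdivrMr// mul1r.
have [k kp] : exists k, 0 < p k.
  apply: contrapT => H; move: S0; rewrite big1 ?ltxx// => k _.
  apply/eqP; rewrite eq_le law_ge0 andbT leNgt; apply/negP => pk; apply: H.
  by exists k.
have [p0 _] := Hp.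
have k1 : (1 <= k)%N by case: k kp => //; rewrite p0 ltxx.
exists k; split => //.
have := law_recursion HPA Hp (isT : (1 <= k.+1)%N); rewrite /= => E.
have c0 := rate_ge0 d1 HPA (isT : (1 <= k.+1)%N).
have c1 : 0 < rate m delta k.
  by rewrite mulr_gt0 ?kdelta_gt0// divr_gt0.
have r0 : 0 <= degree_prob m k.+1 by exact: fineP_ge0.
have cp : 0 < rate m delta k * p k by rewrite mulr_gt0.
rewrite -(pmulr_rgt0 (p k.+1) (_ : 0 < 1 + rate m delta k.+1)); last by rewrite ltr_pwDl.
rewrite mulrDl mul1r {1}E; move: cp r0.
by move: (rate m delta k * _) (rate m delta k.+1 * _) => A B; lra.
Qed.

Definition inv_term k : R := p k / (k%:R + delta).
Definition inv_sum K : R := \sum_(1 <= k < K) inv_term k.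

Lemma inv_term_ge0 k : (1 <= k)%N -> 0 <= inv_term k.
Proof. by move=> k1; rewrite divr_ge0 ?law_ge0// ltW// kdelta_gt0. Qed.

(** The factor [1 / (k + delta)] is decreasing and the [p k] add up to at most 1. *)
Lemma inv_sum_tail K L : (1 <= K)%N -> (K <= L)%N ->
  0 <= inv_sum L - inv_sum K <= (K%:R + delta)^-1.
Proof.
move=> K1 KL; rewrite /inv_sum (big_cat_nat (n := K))//= addrAC subrr add0r.
have kd := kdelta_gt0 K1; apply/andP; split.
  rewrite big_nat_cond; apply: sumr_ge0 => k /andP[/andP[kK _] _].
  by apply: inv_term_ge0; exact: leq_trans kK.
apply: (@le_trans _ _ (\sum_(K <= k < L) (K%:R + delta)^-1 * p k)).
  apply: ler_sum_nat => k /andP[kK _]; rewrite /inv_term mulrC ler_wpM2r ?law_ge0//.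
  by rewrite lef_pV2 ?posrE ?kdelta_gt0 ?lerD2r ?ler_nat//; exact: leq_trans kK.
rewrite -mulr_sumr; apply: ler_piMr; first by rewrite invr_ge0 ltW.
apply: le_trans (law_sum_le1 L).
rewrite -(big_mkord xpredT p) [leRHS](big_cat_nat (n := K))//= lerDr.
by apply: sumr_ge0 => k _; exact: law_ge0.
Qed.

Definition inv_lim : R := limn inv_sum.

Lemma cvg_inv_sum : inv_sum @ \oo --> inv_lim.
Proof.
apply: nondecreasing_is_cvgn.
  apply/nondecreasing_seqP => K; case: K => [|K]; first by rewrite /inv_sum !big_geq.
  by rewrite /inv_sum [leRHS]big_nat_recr//= lerDl inv_term_ge0.
exists (1 + delta)^-1 => _ [K _ <-].
have [K1|K1] := leqP 1 K; last by rewrite /inv_sum big_geq ?invr_ge0 ?(ltW (kdelta_gt0 (leqnn 1)))//; lia.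
have /andP[_] := inv_sum_tail (leqnn 1) K1.
by rewrite {2}/inv_sum big_geq// subr0.
Qed.

Lemma inv_lim_tail K : (1 <= K)%N -> 0 <= inv_lim - inv_sum K <= (K%:R + delta)^-1.
Proof.
move=> K1; have cv := cvgB cvg_inv_sum (cvg_cst (inv_sum K)).
apply/andP; split.
  rewrite subr_ge0; apply: limr_ge; first exact: cvgP cvg_inv_sum.
  near=> L; have KL : (K <= L)%N by near: L; exists K.
  by have /andP[h _] := inv_sum_tail K1 KL; rewrite -subr_ge0.
rewrite lerBlDr; apply: limr_le; first exact: cvgP cvg_inv_sum.
near=> L; have KL : (K <= L)%N by near: L; exists K.
by have /andP[_ h] := inv_sum_tail K1 KL; rewrite -lerBlDr.
Unshelve. all: by end_near. Qed.

(** The term [mu * q_k / (k + delta)^2] is [mu / a] times [p_k / (k + delta)]. *)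
Lemma informationE : information mu delta p = mu / a * inv_lim - mu / a ^+ 2.
Proof.
rewrite /information; congr (_ - _).
rewrite (_ : (fun K => _) = (fun K => mu / a * inv_sum K)); last first.
  apply/funext => K; rewrite /inv_sum mulr_sumr; apply: eq_big_nat => k /andP[k1 _].
  rewrite /q_of /inv_term -/a; field; rewrite !gt_eqF//.
  exact: kdelta_gt0.
by apply: cvg_lim => //; apply: cvgMr; exact: cvg_inv_sum.
Qed.

(* theta nu_0 is the sum of p_k (1 - (k + delta) / a)^2 / (k + delta). *)
Lemma information_gt0 : 0 < information mu delta p.
Proof.
have [k [k1 pk pk1]] := law_gt0_ex.
pose f j := (mu / a) * (inv_term j * (1 - (j%:R + delta) / a) ^+ 2).
have ma0 : 0 < mu / a by rewrite divr_gt0.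
have f0 j : (1 <= j)%N -> 0 <= f j.
  by move=> j1; apply: mulr_ge0; [exact: ltW|rewrite mulr_ge0 ?sqr_ge0 ?inv_term_ge0].
have fk : 0 < f k + f k.+1.
  have [E|E] := eqVneq (1 - (k%:R + delta) / a) 0; last first.
    apply: ltr_pwDl; last exact: f0.
    rewrite mulr_gt0// mulr_gt0 ?divr_gt0 ?kdelta_gt0//.
    by rewrite lt_neqAle sqr_ge0 andbT eq_sym sqrf_eq0.
  rewrite addrC; apply: ltr_pwDl; last exact: f0.
  rewrite mulr_gt0// mulr_gt0 ?divr_gt0 ?kdelta_gt0//.
  have -> : 1 - (k.+1%:R + delta) / a = - a^-1.
    have -> : 1 - (k.+1%:R + delta) / a = 1 - (k%:R + delta) / a - a^-1 by rewrite -natr1; field; rewrite gt_eqF.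
    by rewrite E sub0r.
  by rewrite sqrrN exprn_gt0// invr_gt0.
(* Truncation at [K] costs the defect of [law_sum_ge] times [2 mu / a^2]. This [O(1 / K)] is sent to
   0 by [le_of_sqrt_error], whose constant is enlarged to make the finitely many small [K]
   trivial. *)
suff H K : (k.+1 < K)%N -> f k + f k.+1 <= information mu delta p + 4 * mu ^+ 2 / a ^+ 2 / K%:R.
  apply: (lt_le_trans fk); apply: (@le_of_sqrt_error _ _ _ (4 * mu ^+ 2 / a ^+ 2 + k.+2%:R * (f k + f k.+1) + k.+2%:R * `|information mu delta p|)) => K K2.
  have K0 : 0 < K%:R :> R by rewrite ltr0n; lia.
  have r1 : 1 <= Num.sqrt K%:R :> R by apply: sqrt_nat_ge1; lia.
  have c4 : 0 <= 4 * mu ^+ 2 / a ^+ 2.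
    by apply: divr_ge0; last exact: sqr_ge0; apply: mulr_ge0 => //; exact: sqr_ge0.
  have kf : 0 <= k.+2%:R * (f k + f k.+1) by rewrite mulr_ge0// ltW.
  have ki : 0 <= k.+2%:R * `|information mu delta p| by rewrite mulr_ge0.
  apply: (@le_trans _ _ (K%:R * information mu delta p + (4 * mu ^+ 2 / a ^+ 2 + k.+2%:R * (f k + f k.+1) + k.+2%:R * `|information mu delta p|))); last first.
    by rewrite lerD2l ler_peMr// addr_ge0 ?addr_ge0.
  have [/H kK|Kk] := ltnP k.+1 K.
    have := ler_wpM2l (ltW K0) kK.
    rewrite [K%:R * (information _ _ _ + _)]mulrDr (_ : K%:R * (4 * mu ^+ 2 / a ^+ 2 / K%:R) = 4 * mu ^+ 2 / a ^+ 2); last by field; rewrite !gt_eqF.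
    by move: c4 kf ki; move: (K%:R * _) (K%:R * _) (_ / _) (k.+2%:R * _) (k.+2%:R * _) => *; lra.
  have KR : K%:R <= k.+2%:R :> R by rewrite ler_nat; lia.
  have h1 := ler_wpM2r (ltW fk) KR.
  have h2 := ler_wpM2r (normr_ge0 (information mu delta p)) KR.
  have h3 : - (K%:R * `|information mu delta p|) <= K%:R * information mu delta p.
    by rewrite -mulrN ler_wpM2l// lerNl -normrN ler_norm.
  move: h1 h2 h3 c4 kf ki; move: (K%:R * (f k + _)) (K%:R * _) (K%:R * _) (_ / _) (k.+2%:R * _) (k.+2%:R * _) => *; lra.
move=> kK; have K1 : (1 <= K)%N by lia.
have K0 : 0 < K%:R :> R by rewrite ltr0n.
have [p0 _] := Hp.
apply: (@le_trans _ _ (\sum_(1 <= j < K) f j)).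
  rewrite (big_cat_nat (n := k))//=; last by lia.
  have -> : \sum_(k <= j < K) f j = f k + \sum_(k.+1 <= j < K) f j by rewrite big_ltn//; lia.
  have -> : \sum_(k.+1 <= j < K) f j = f k.+1 + \sum_(k.+2 <= j < K) f j by rewrite big_ltn//; lia.
  have h (u v : nat) : (1 <= u)%N -> 0 <= \sum_(u <= j < v) f j.
    move=> u1; rewrite big_nat_cond; apply: sumr_ge0 => j /andP[/andP[uj _] _].
    by apply: f0; exact: leq_trans uj.
  by have := h 1%N k isT; have := h k.+2 K isT; lra.
(* Expanding the square leaves partial sums of [p j / (j + delta)], [p j] and [(j + delta) * p j],
   controlled by [inv_lim_tail], [law_sum_ge] and [law_weighted_sum_le]. *)
have E : \sum_(1 <= j < K) f j = mu / a * inv_sum K - 2 * mu / a ^+ 2 * (\sum_(j < K) p j)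
    + mu / a ^+ 3 * (\sum_(j < K) (j%:R + delta) * p j).
  rewrite -(big_mkord xpredT p) -(big_mkord xpredT (fun j => (j%:R + delta) * p j)).
  rewrite [X in _ - _ * X]big_ltn// [X in _ + _ * X]big_ltn// p0 mulr0 !add0r.
  rewrite /inv_sum !mulr_sumr -sumrB -big_split /=; apply: eq_big_nat => j /andP[j1 _].
  by rewrite /f /inv_term; field; rewrite !gt_eqF//; exact: kdelta_gt0.
rewrite E informationE.
have /andP[h1 _] := inv_lim_tail K1.
have h2 := law_sum_ge K1; have h3 := law_weighted_sum_le K.
have {h1} h1 : mu / a * inv_sum K <= mu / a * inv_lim by apply: ler_wpM2l; [exact: ltW|rewrite -subr_ge0].
have a2 : 0 <= 2 * mu / a ^+ 2 by rewrite divr_ge0 ?sqr_ge0// mulr_ge0// ltW.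
have a3 : 0 <= mu / a ^+ 3 by rewrite divr_ge0 ?exprn_ge0// ltW.
have := ler_wpM2l a2 h2; have := ler_wpM2l a3 h3; move: h1.
have -> : mu / a ^+ 3 * a = mu / a ^+ 2 by field; rewrite gt_eqF.
have -> : 2 * mu / a ^+ 2 * (1 - 2 * mu / K%:R) = 2 * (mu / a ^+ 2) - 4 * mu ^+ 2 / a ^+ 2 / K%:R.
  by field; rewrite !gt_eqF.
move: (mu / a * _) (mu / a * _) (2 * mu / a ^+ 2 * _) (mu / a ^+ 3 * _) (mu / a ^+ 2) (_ / K%:R) => *; lra.
Qed.

End limit_law.

(** * Quadratic variations *)

Section negligible.
Context {R : realType} {d : measure_display} {T : measurableType d}.
Variable P : probability T R.
Local Notation Ex := (Ex P).
Local Notation L1 := (L1 P).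

(* Z_n = o(n) in L^1; this form is stable under sums without extracting limits. *)
Definition negligible (Z : nat -> T -> R) := (forall n, (1 <= n)%N -> L1 (Z n)) /\
  forall e, 0 < e -> exists2 K, 0 <= K & forall n, (1 <= n)%N ->
    Ex (fun w => `|Z n w|) <= e * n%:R + K * Num.sqrt n%:R.

Lemma negligible_sqrt Z (K : R) : 0 <= K ->
  (forall n, (1 <= n)%N -> L1 (Z n) /\ Ex (fun w => `|Z n w|) <= K * Num.sqrt n%:R) -> negligible Z.
Proof.
move=> K0 H; split => [n n1|e e0]; first by have [] := H n n1.
exists K => // n n1; have [_ E] := H n n1.
by rewrite (le_trans E)// lerDr mulr_ge0// ltW.
Qed.

Lemma negligibleD Y Z : negligible Y -> negligible Z -> negligible (fun n w => Y n w + Z n w).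
Proof.
move=> [iY HY] [iZ HZ]; split => [n n1|e e0]; first by apply: L1D; [exact: iY|exact: iZ].
have e2 : 0 < e / 2 by rewrite divr_gt0.
have [K K0 HK] := HY _ e2; have [L L0 HL] := HZ _ e2.
exists (K + L) => [|n n1]; first exact: addr_ge0.
have i1 := iY n n1; have i2 := iZ n n1.
apply: (@le_trans _ _ (Ex (fun w => `|Y n w| + `|Z n w|))).
  apply: Ex_le => [||w]; [exact/L1_norm/L1D|by apply: L1D; exact: L1_norm|exact: ler_normD].
rewrite ExD; [|exact: L1_norm|exact: L1_norm].
have := HK n n1; have := HL n n1.
set A := Ex _; set B := Ex _; set r := Num.sqrt _; set N := n%:R.
by clearbody A B r N; lra.
Qed.

Lemma negligibleZ (c : R) Z : negligible Z -> negligible (fun n w => c * Z n w).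
Proof.
move=> [iZ HZ]; split => [n n1|e e0]; first by apply: L1Z; exact: iZ.
have c1 : 0 < 1 + `|c| by rewrite ltr_pwDl.
have [K K0 HK] := HZ _ (divr_gt0 e0 c1).
exists (`|c| * K) => [|n n1]; first exact: mulr_ge0.
under eq_fun do rewrite normrM.
rewrite ExZ; last by apply: L1_norm; exact: iZ.
apply: (le_trans (ler_wpM2l (normr_ge0 c) (HK n n1))).
have ce : `|c| * (e / (1 + `|c|)) <= e.
  by rewrite mulrA ler_pdivrMr// mulrDr mulr1 mulrC lerDr ltW.
by rewrite mulrDr !mulrA lerD2r ler_wpM2r// -mulrA.
Qed.

Lemma negligible_prob Z (e : R) : 0 < e -> negligible Z -> exists N, forall n, (N <= n)%N ->
  fine (P [set w | e < `|n%:R^-1 * Z n w|]) <= e.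
Proof.
move=> e0 [iZ HZ].
(* Half of [e ^+ 2] pays for the linear term and half for [K * sqrt n], once [sqrt n] exceeds [B];
   Markov's inequality then divides by [e]. *)
have e2 : 0 < e ^+ 2 / 2 by rewrite divr_gt0 ?exprn_gt0.
have [K K0 HK] := HZ _ e2.
pose B := K / (e ^+ 2 / 2).
have B0 : 0 <= B by rewrite divr_ge0// ltW.
exists (Num.bound (B ^+ 2)).+1 => n nN.
have n1 : (1 <= n)%N by exact: leq_trans nN.
have n0 : 0 < n%:R :> R by rewrite ltr0n.
have r0 : 0 < Num.sqrt n%:R :> R by rewrite sqrtr_gt0.
have Bn : B <= Num.sqrt n%:R.
  rewrite -[leLHS](@ger0_norm R)// -sqrtr_sqr ler_wsqrtr//.
  apply: ltW; apply: lt_le_trans (archi_boundP (sqr_ge0 B)) _.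
  by rewrite ler_nat ltnW.
have iW : L1 (fun w => n%:R^-1 * Z n w) by apply: L1Z; exact: iZ.
apply: (le_trans (prob_norm_gt_le e0 iW)).
rewrite ler_pdivrMr//; under eq_fun do rewrite normrM.
rewrite ExZ; last by apply: L1_norm; exact: iZ.
rewrite gtr0_norm ?invr_gt0// mulrC ler_pdivrMr// (le_trans (HK n n1))//.
have KB : K * Num.sqrt n%:R <= e ^+ 2 / 2 * n%:R.
  have -> : K = B * (e ^+ 2 / 2) by rewrite /B divfK// gt_eqF.
  rewrite mulrAC mulrC; apply: ler_wpM2l; first exact: ltW.
  rewrite -[n%:R in leRHS](@sqr_sqrtr R) ?ler0n// expr2.
  by apply: ler_wpM2r => //; exact: ltW.
by rewrite -expr2; move: KB; lra.
Qed.

End negligible.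

Section variance_limits.
Context {R : realType} {d : measure_display} {T : measurableType d}.
Variable P : probability T R.
Variables (m : nat -> {RV P >-> nat}) (x : nat -> nat -> {RV P >-> nat}).
Variable delta : R.
Hypothesis d1 : -1 < delta.
Hypothesis HPA : is_preferential_attachment delta m x.
Implicit Types (t i j n k K : nat) (w : T) (psi phi : nat -> R).
Local Notation Ex := (Ex P).
Local Notation L1 := (L1 P).
Local Notation degs := (degs m).
Local Notation choices := (choices x).
Local Notation mu := (degree_mean m).
Local Notation dsum := (dsum m x).
Local Notation weight := (weight m x delta).
Local Notation count_deg := (count_deg m x).
Local Notation X := (centered m).

Variable p : nat -> R.
Hypothesis Hp : is_limit_degree_law (degree_prob m) mu delta p.

Let Hm : is_initial_degrees m. Proof. by case: HPA. Qed.
Let mg w := @degs_gt0 _ _ _ _ _ _ _ HPA w.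
Let xl w := @choices_lt _ _ _ _ _ _ _ HPA w.
Let mu1 : 1 <= mu := mean_ge1 Hm.
Let a : R := 2 * mu + delta.
Let a_gt0 : 0 < a. Proof. by rewrite /a; have := mu1; move: d1; lra. Qed.
Let mu_gt0 : 0 < mu. Proof. by rewrite (lt_le_trans _ mu1). Qed.
Let b_gt0 : 0 < 1 + delta. Proof. by move: d1; lra. Qed.

Definition invd k : R := (k%:R + delta)^-1.
Local Notation inv_lim := (inv_lim delta p).

Lemma invd_gt0 k : (1 <= k)%N -> 0 < invd k.
Proof. by move=> k1; rewrite invr_gt0 (kdelta_gt0 d1). Qed.

Lemma invd_le K k : (1 <= K)%N -> (K <= k)%N -> invd k <= invd K.
Proof.
move=> K1 Kk; rewrite lef_pV2 ?posrE ?(kdelta_gt0 d1)// ?lerD2r ?ler_nat//.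
exact: leq_trans Kk.
Qed.

Lemma invd_norm k : (0 < k)%N -> `|invd k| <= (1 + delta)^-1.
Proof. by move=> k0; rewrite ger0_norm ?(ltW (invd_gt0 k0))//; exact: (@invd_le 1%N). Qed.

(** Degrees below [K] are controlled by finitely many excesses, of order [sqrt n]. Degrees from [K]
    on contribute at most [invd K] per unit of time, in the network and in the limit alike, whence
    the choice [2 * invd K <= e]. The extra [|inv_lim|] is there because the sum has only [n.-1]
    terms. *)
Lemma average_dsum_invd :
  negligible P (fun n w => \sum_(2 <= t < n.+1) dsum invd t 0 w / t%:R - n%:R * inv_lim).
Proof.
have mS n : measurable_fun setT (fun w => \sum_(2 <= t < n.+1) dsum invd t 0 w / t%:R).
  have md t : measurable_fun setT (fun w => dsum invd t 0 w / t%:R).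
    by apply: measurable_funM => //; exact: measurable_dsum.
  elim: n => [|n IH]; first by under eq_fun do rewrite big_geq//; exact: measurable_cst.
  case: n IH => [_|n IH]; first by under eq_fun do rewrite big_geq//; exact: measurable_cst.
  by under eq_fun do rewrite big_nat_recr//=; exact: measurable_funD.
pose E K n w : R := \sum_(k < K) `|invd k| * `|excess m x p k n w|.
have iE K n : L1 (E K n).
  by apply: L1_sum => k; apply: L1Z; apply: L1_norm; exact: L1_excess.
have bnd K n w : (1 <= K)%N -> (1 <= n)%N ->
    `|\sum_(2 <= t < n.+1) dsum invd t 0 w / t%:R - n%:R * inv_lim| <=
    E K n w + (2 * invd K * n%:R + `|inv_lim|).
  move=> K1 n1; have [p0 _] := Hp.
  pose rest t := dsum (fun j => (K <= j)%N%:R * invd j) t 0 w / t%:R.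
  have rest0 t : (2 <= t)%N -> 0 <= rest t <= invd K.
    move=> t2; have t0 : 0 < t%:R :> R by rewrite ltr0n; lia.
    have rg (j : 'I_t) : 0 <= (K <= degree (PAstep (degs w) (choices w) t 0) j)%N%:R * invd (degree (PAstep (degs w) (choices w) t 0) j) <= invd K.
      set g := degree _ _; have g0 : (1 <= g)%N by exact: (degree_PAstep_gt0 (@mg w) (@xl w)).
      case: leqP => Kg; rewrite ?mul1r ?mul0r; last by rewrite lexx (ltW (invd_gt0 K1)).
      by rewrite (ltW (invd_gt0 g0)) (invd_le K1 Kg).
    apply/andP; split.
      by rewrite divr_ge0//; apply: sumr_ge0 => j _; have /andP[] := rg j.
    rewrite ler_pdivrMr//.
    apply: (@le_trans _ _ (\sum_(j < t) invd K)); last by rewrite sumr_const card_ord mulr_natr.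
    by apply: ler_sum => j _; have /andP[] := rg j.
  have sumK : \sum_(k < K) invd k * p k = inv_sum delta p K.
    rewrite -(big_mkord xpredT (fun k => invd k * p k)) big_ltn// p0 mulr0 add0r.
    by apply: eq_big_nat => k _; rewrite /inv_term mulrC.
  have tail := inv_lim_tail d1 HPA Hp K1.
  have -> : \sum_(2 <= t < n.+1) dsum invd t 0 w / t%:R - n%:R * inv_lim =
    \sum_(k < K) invd k * excess m x p k n w + \sum_(2 <= t < n.+1) rest t
      - (n.-1)%:R * (inv_lim - inv_sum delta p K) - inv_lim.
    have -> : n%:R = n.-1%:R + 1 :> R by rewrite natr1 prednK.
    have -> : \sum_(k < K) invd k * excess m x p k n w = \sum_(2 <= t < n.+1) (\sum_(k < K) invd k * (count_deg k t w / t%:R)) - n.-1%:R * inv_sum delta p K.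
      rewrite -sumK /excess; under eq_bigr do rewrite mulr_sumr.
      rewrite exchange_big /= mulr_natl -(subn1 n) -subSS -sumr_const_nat -sumrB; apply: eq_bigr => t _.
      by rewrite -sumrB; apply: eq_bigr => k _; ring.
    have -> : \sum_(2 <= t < n.+1) dsum invd t 0 w / t%:R = \sum_(2 <= t < n.+1) (\sum_(k < K) invd k * (count_deg k t w / t%:R)) + \sum_(2 <= t < n.+1) rest t.
      rewrite -big_split /=; apply: eq_bigr => t _.
      rewrite (dsum_split _ _ invd K) mulrDl; congr (_ + _).
      by rewrite mulr_suml; apply: eq_bigr => k _; rewrite mulrA.
    by ring.
  have h1 : `|\sum_(k < K) invd k * excess m x p k n w| <= E K n w.
    rewrite (le_trans (ler_norm_sum _ _ _))//; apply: ler_sum => k _.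
    by rewrite normrM.
  have nn : n.-1%:R <= n%:R :> R by rewrite ler_nat leq_pred.
  have iK0 := ltW (invd_gt0 K1).
  have h2 : `|\sum_(2 <= t < n.+1) rest t| <= invd K * n%:R.
    rewrite ger0_norm; last first.
      by rewrite big_nat_cond; apply: sumr_ge0 => t /andP[/andP[t2 _] _]; have /andP[] := rest0 t t2.
    apply: (@le_trans _ _ (\sum_(2 <= t < n.+1) invd K)).
      by apply: ler_sum_nat => t /andP[t2 _]; have /andP[] := rest0 t t2.
    by rewrite sumr_const_nat -[_ *+ _]mulr_natr ler_wpM2l// ler_nat; lia.
  have h3 : `|n.-1%:R * (inv_lim - inv_sum delta p K)| <= invd K * n%:R.
    move: tail => /andP[tl0 tl1]; rewrite normrM !ger0_norm// mulrC.
    by apply: ler_pM.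
  rewrite (le_trans (ler_normB _ _))// addrA lerD2r.
  rewrite (le_trans (ler_normB _ _))// (le_trans (lerD (ler_normD _ _) h3))//.
  rewrite (le_trans (lerD (lerD h1 h2) (lexx _)))//.
  by rewrite le_eqVlt; apply/orP; left; apply/eqP; ring.
split.
  move=> n n1; apply: (L1_le _ (L1D (iE 1%N n) (L1_cst P (2 * invd 1 * n%:R + `|inv_lim|)))) => [|w].
    by apply: measurable_funB.
  exact: bnd.
move=> e e0.
have [K K1 Ke] : exists2 K, (1 <= K)%N & 2 * invd K <= e.
  exists (Num.bound (2 / e)).+2 => //.
  have h : 2 / e < (Num.bound (2 / e))%:R by rewrite archi_boundP// divr_ge0// ltW.
  have h' : (Num.bound (2 / e))%:R <= (Num.bound (2 / e)).+2%:R + delta.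
    by rewrite -natr1 -natr1; move: d1; lra.
  rewrite /invd ler_pdivrMr; last by rewrite (kdelta_gt0 d1).
  by rewrite mulrC -ler_pdivrMr//; apply: le_trans h'; exact: ltW.
have [C C0 HC] : exists2 C, 0 <= C & forall n, Ex (E K n) <= C * Num.sqrt n%:R.
  rewrite /E; elim: K {K1 Ke} => [|K [C C0 HC]].
    by exists 0 => // n; under eq_fun do rewrite big_ord0; rewrite Ex_cst mul0r.
  have [D D0 HD] := Ex_excess d1 HPA (count_deg_root_rate d1 HPA Hp K).
  exists (C + `|invd K| * D) => [|n]; first by rewrite addr_ge0// mulr_ge0.
  under eq_fun do rewrite big_ord_recr/=.
  have iK : L1 (fun w => `|excess m x p K n w|) by apply: L1_norm; exact: L1_excess.
  rewrite ExD; [|exact: iE|exact: L1Z].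
  by rewrite ExZ// [leRHS]mulrDl lerD// -mulrA ler_wpM2l.
exists (C + `|inv_lim|) => [|n n1]; first exact: addr_ge0.
have ic := L1_cst P (2 * invd K * n%:R + `|inv_lim|).
apply: (@le_trans _ _ (Ex (fun w => E K n w + (2 * invd K * n%:R + `|inv_lim|)))).
  apply: Ex_le => [||w]; [|exact: L1D|exact: bnd].
  apply: L1_norm; apply: (L1_le _ (L1D (iE K n) ic)) => [|w]; last exact: bnd.
  exact: measurable_funB.
rewrite ExD// Ex_cst.
have r1 := @sqrt_nat_ge1 R n n1.
have h1 := HC n; have h2 : 2 * invd K * n%:R <= e * n%:R by rewrite ler_wpM2r.
have h3 : `|inv_lim| * 1 <= `|inv_lim| * Num.sqrt n%:R by rewrite ler_wpM2l.
move: h1 h2 h3; move: (Ex _) (2 * _ * _) (e * _) (Num.sqrt _) (`|_|) => A B D r J; lra.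
Qed.

Lemma dsum1 t i w : dsum (fun=> 1) t i w = t%:R.
Proof. by rewrite /dsum /degree_sum sumr_const card_ord. Qed.

Definition sqw t i w : R := (t%:R / weight t i.-1 w) ^+ 2.

Lemma weight_inv_le t i w : (2 <= t)%N -> (i <= degs w t)%N ->
  0 <= t%:R / weight t i w <= (1 + delta)^-1.
Proof.
move=> t2 im; have W0 := weight_gt0 d1 HPA t2 im; have Wb := weight_ge d1 HPA t2 im.
by apply/andP; split; [exact: divr_ge0 (ltW W0)|rewrite ler_pdivrMr// mulrC ler_pdivlMr].
Qed.

Lemma local_sqw : local_functional m x sqw.
Proof.
exact: (local_comp (fun t _ _ u _ _ => (t%:R / u) ^+ 2) (local_weight delta) (local_weight delta) (local_weight delta)).
Qed.

(** The quotient [t / S] is frozen at [1 / a] by [ratio_dev] for the constant function 1, a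
    difference of squares being at most [c] times the difference. The number of edges is then
    [n * mu] up to [X n - X 1] and a constant. *)
Lemma sqw_sum : negligible P (fun n w => esum m n sqw w - n%:R * (mu / a ^+ 2)).
Proof.
pose c := (1 + delta)^-1 + a^-1.
have c0 : 0 <= c by rewrite addr_ge0// invr_ge0 ltW.
have rc0 : 0 <= ratio_const m delta 1 by apply: (ratio_const_ge0 d1 HPA).
have k1 : 0 <= ratio_const m delta 1 * c by exact: mulr_ge0.
have k3 : 0 <= (a ^+ 2)^-1 by rewrite invr_ge0 sqr_ge0.
have bnd n w : (1 <= n)%N -> `|esum m n sqw w - n%:R * (mu / a ^+ 2)| <=
   \sum_(2 <= t < n.+1) (ratio_const m delta 1 * c * (mr m t w * (mr m t w + `|X t.-1 w|) / t%:R)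
      + 0 * (`|X t w| * mr m t w / t%:R)) + (a ^+ 2)^-1 * (`|X n w| + `|X 1 w|) + (a ^+ 2)^-1 * mu.
  move=> n1.
  have S1 t : (2 <= t)%N -> `|\sum_(1 <= i < (degs w t).+1) sqw t i w - mr m t w / a ^+ 2| <=
      ratio_const m delta 1 * c * (mr m t w * (mr m t w + `|X t.-1 w|) / t%:R).
    move=> t2.
    have -> : mr m t w / a ^+ 2 = \sum_(1 <= i < (degs w t).+1) (a ^+ 2)^-1.
      by rewrite sumr_const_nat subn1 /= /mr mulr_natl.
    rewrite -sumrB (le_trans (ler_norm_sum _ _ _))//.
    apply: (@le_trans _ _ (\sum_(1 <= i < (degs w t).+1) ratio_const m delta 1 * c * ((mr m t w + `|X t.-1 w|) / t%:R))).
      apply: ler_sum_nat => i im; have im' : (i.-1 <= degs w t)%N by lia.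
      have /andP[u0 ub] := weight_inv_le t2 im'.
      have phi1 k : (0 < k)%N -> `|1 : R| <= 1 by rewrite normr1.
      have := ratio_dev d1 HPA ler01 (phi := fun=> 1) phi1 t2 im'.
      rewrite !dsum1 -/a => rd.
      have t0 : 0 < t%:R :> R by rewrite ltr0n; lia.
      have e1 : t%:R / (t%:R * a) = a^-1 by field; rewrite !gt_eqF.
      rewrite e1 in rd.
      rewrite /sqw -exprVn subr_sqr normrM mulrAC; apply: ler_pM => //.
      by rewrite ger0_norm ?lerD2r// addr_ge0// invr_ge0 ltW.
    rewrite sumr_const_nat subn1 /= -[_ *+ degs w t]mulr_natl /mr /degs.
    by move: (m t w)%:R => M; rewrite le_eqVlt; apply/orP; left; apply/eqP; ring.
  have S2 : \sum_(2 <= t < n.+1) mr m t w / a ^+ 2 - n%:R * (mu / a ^+ 2) = (a ^+ 2)^-1 * (X n w - X 1 w) - (a ^+ 2)^-1 * mu.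
    rewrite -mulr_suml /centered /Mtot !natr_sum [\sum_(1 <= s < n.+1) _]big_ltn// big_nat1 /mr.
    by rewrite mul1r; ring.
  have -> : esum m n sqw w - n%:R * (mu / a ^+ 2) = \sum_(2 <= t < n.+1)
      (\sum_(1 <= i < (degs w t).+1) sqw t i w - mr m t w / a ^+ 2)
      + (a ^+ 2)^-1 * (X n w - X 1 w) - (a ^+ 2)^-1 * mu.
    by rewrite -addrA -S2 sumrB /esum /edge_sum [RHS]addrA subrK.
  apply: (le_trans (ler_normB _ _)); apply: lerD.
    apply: (le_trans (ler_normD _ _)); apply: lerD.
      apply: (le_trans (ler_norm_sum _ _ _)); apply: ler_sum_nat => t /andP[t2 _].
      by rewrite mul0r addr0; exact: S1.
    by rewrite normrM (ger0_norm k3) ler_wpM2l// ler_normB.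
  by rewrite ger0_norm// mulr_ge0// ltW.
apply: (@negligible_sqrt _ _ _ _ _ ((2 * (ratio_const m delta 1 * c) + 0) * second_moment m * 2 + (a ^+ 2)^-1 * (1 + second_moment m) + (a ^+ 2)^-1 * mu)).
  have s20 := @second_moment_ge0 _ _ _ _ m.
  apply: addr_ge0; last by apply: mulr_ge0 => //; exact: ltW.
  apply: addr_ge0; last by apply: mulr_ge0 => //; exact: addr_ge0.
  apply: mulr_ge0 => //; apply: mulr_ge0 => //; rewrite addr0; exact: mulr_ge0.
move=> n n1; have [iE EE] := Ex_error_sum HPA k1 (lexx 0) k3 n1.
have ic := L1_cst P ((a ^+ 2)^-1 * mu).
have mZ : measurable_fun setT (fun w => esum m n sqw w - n%:R * (mu / a ^+ 2)).
  by apply: measurable_funB => //; exact: (measurable_esum d1 n local_sqw).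
have iZ : L1 (fun w => esum m n sqw w - n%:R * (mu / a ^+ 2)).
  by apply: (L1_le mZ (L1D iE ic)) => w; exact: bnd.
split => //; rewrite [leRHS]mulrDl.
have k4 : 0 <= (a ^+ 2)^-1 * mu by apply: mulr_ge0 => //; exact: ltW.
have r1 := @sqrt_nat_ge1 R n n1; have EC := ler_peMr k4 r1; apply: (le_trans _ (lerD EE EC)).
rewrite -[X in _ <= _ + X](Ex_cst P) -ExD//.
by apply: Ex_le => [||w]; [exact: L1_norm|exact: L1D|exact: bnd].
Qed.

Local Notation nu0 := (information mu delta p).

Lemma variance_cond : negligible P (fun n w =>
  esum m n (fun t i w => dsum invd t i.-1 w / weight t i.-1 w - sqw t i w) w - n%:R * nu0).
Proof.
have c0 : 0 <= (1 + delta)^-1 by rewrite invr_ge0 ltW.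
have [K K0 HK] := Ex_ratio_sum d1 HPA c0 invd_norm.
have N1 := negligible_sqrt K0 HK.
have N2 := negligibleZ (mu / a) average_dsum_invd.
have N3 := negligibleZ (-1) sqw_sum.
have := negligibleD (negligibleD N1 N2) N3.
set F := (fun n w => _); set G := (fun n w => _).
suff -> : F = G by [].
apply/funext => n; apply/funext => w; rewrite /F /G (informationE d1 HPA Hp) -/a.
have -> : esum m n (fun t i w => dsum invd t i.-1 w / weight t i.-1 w - sqw t i w) w =
  esum m n (fun t i w => dsum invd t i.-1 w / weight t i.-1 w) w - esum m n sqw w by rewrite /esum edge_sumB.
by ring.
Qed.

(** The observed counterpart of [variance_cond], wanted for the quadratic Taylor term. Size-biasing
    turns [invd k ^+ 2] into [invd k], so both have the same limit. *)
Lemma variance_chosen : negligible P (fun n w =>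
  esum m n (fun t i w => invd (chosen m x t i w) ^+ 2 - sqw t i w) w - n%:R * nu0).
Proof.
have c0 : 0 <= (1 + delta)^-1 by rewrite invr_ge0 ltW.
have s1 k : (0 < k)%N -> `|invd k ^+ 2| <= (1 + delta)^-1 ^+ 2.
  by move=> k0; rewrite normrX lerXn2r ?nnegrE// invd_norm.
have s2 k : (0 < k)%N -> `|invd k ^+ 2 * (k%:R + delta)| <= (1 + delta)^-1.
  move=> k0; rewrite (_ : invd k ^+ 2 * (k%:R + delta) = invd k) ?invd_norm//.
  by rewrite /invd; field; rewrite gt_eqF// (kdelta_gt0 d1).
have [K K0 HK] := Ex_chosen_sum d1 HPA (sqr_ge0 (1 + delta)^-1) c0 s1 s2.
have N1 := negligible_sqrt K0 HK.
have N2 := negligibleZ (mu / a) average_dsum_invd.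
have N3 := negligibleZ (-1) sqw_sum.
have := negligibleD (negligibleD N1 N2) N3.
set F := (fun n w => _); set G := (fun n w => _).
suff -> : F = G by [].
apply/funext => n; apply/funext => w; rewrite /F /G (informationE d1 HPA Hp) -/a.
have -> : esum m n (fun t i w => invd (chosen m x t i w) ^+ 2 - sqw t i w) w =
  esum m n (fun t i w => invd (chosen m x t i w) ^+ 2) w - esum m n sqw w by rewrite /esum edge_sumB.
have -> : \sum_(2 <= t < n.+1) dsum (fun k => invd k ^+ 2 * (k%:R + delta)) t 0 w / t%:R =
  \sum_(2 <= t < n.+1) dsum invd t 0 w / t%:R.
  apply: eq_big_nat => t /andP[t2 _]; congr (_ / _).
  rewrite /dsum /degree_sum; apply: eq_bigr => j _.
  rewrite /invd; field; rewrite gt_eqF// (kdelta_gt0 d1)//.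
  exact: (degree_PAstep_gt0 (@mg w) (@xl w)).
by ring.
Qed.

End variance_limits.

(** * Local asymptotic normality *)

Section convergence.
Context {R : realType} {d : measure_display} {T : measurableType d}.
Variable P : probability T R.

Lemma cvg_prob (A : nat -> set T) (l : R) : (forall n, measurable (A n)) ->
  (forall k, 0 < k -> exists N, forall n, (N <= n)%N -> `|fine (P (A n)) - l| <= k) ->
  P (A n) @[n --> \oo] --> l%:E.
Proof.
move=> mA H; apply: cvg_EFin; first by apply: nearW => n; rewrite fin_num_measure.
apply/cvgrPdist_le => k k0; have [N HN] := H k k0.
by exists N => // n /= Nn; rewrite distrC; exact: HN.
Qed.

Lemma eventually_le_sqrt (c : R) : exists2 N, (1 <= N)%N & forall n, (N <= n)%N -> c <= Num.sqrt n%:R.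
Proof.
exists (Num.bound (c ^+ 2)).+1 => // n nN; apply: (le_trans (ler_norm c)).
rewrite -sqrtr_sqr ler_wsqrtr// ltW// (lt_le_trans (archi_boundP (sqr_ge0 c)))//.
by rewrite ler_nat ltnW.
Qed.

Lemma negligible_cvg (Y Z : nat -> T -> R) N : negligible P Z -> (forall n, measurable_fun setT (Y n)) ->
  (forall n w, (N <= n)%N -> Y n w = n%:R^-1 * Z n w) -> cvg_in_probability P Y 0.
Proof.
move=> HZ mY YZ; split=> // e e0.
apply: cvg_prob => [n|k k0].
  by apply: measurable_gt; apply: measurableT_comp => //; exact: measurable_funB.
have f0 : 0 < Num.min e k by rewrite lt_min e0.
have [M HM] := negligible_prob f0 HZ; exists (maxn 1 (maxn M N)) => n; rewrite !geq_max => /and3P[n1 Mn Nn].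
rewrite subr0 ger0_norm ?fineP_ge0//; apply: le_trans (_ : Num.min e k <= k); last by rewrite ge_min lexx orbT.
apply: le_trans (HM n Mn); have [iZ _] := HZ.
have mg (Z' : T -> R) (c : R) : measurable_fun setT Z' -> measurable [set w | c < `|Z' w|].
  by move=> mZ; apply: measurable_gt; exact: measurableT_comp.
apply: fineP_le.
- by apply: (mg (fun w => Y n w - 0)); exact: measurable_funB.
- by apply: mg; exact/L1_measurable/L1Z/iZ.
- move=> w /=; rewrite subr0 YZ//; apply: le_lt_trans; by rewrite ge_min lexx.
Qed.

End convergence.

Section main.
Context {R : realType} {d : measure_display} {T : measurableType d}.
Variable P : probability T R.
Variables (m : nat -> {RV P >-> nat}) (x : nat -> nat -> {RV P >-> nat}).
Variable delta : R.
Hypothesis d1 : -1 < delta.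
Hypothesis HPA : is_preferential_attachment delta m x.
Implicit Types (t i j n k K : nat) (w : T) (psi phi : nat -> R).
Local Notation Ex := (Ex P).
Local Notation L1 := (L1 P).
Local Notation degs := (degs m).
Local Notation choices := (choices x).
Local Notation mu := (degree_mean m).
Local Notation s2 := (second_moment m).
Local Notation dsum := (dsum m x).
Local Notation weight := (weight m x delta).
Local Notation chosen := (chosen m x).
Local Notation esum := (esum m).
Local Notation compensated := (compensated m x delta).
Local Notation invd := (invd delta).
Local Notation sqw := (sqw m x delta).
Local Notation Delta := (Delta m x delta).

Variable p : nat -> R.
Hypothesis Hp : is_limit_degree_law (degree_prob m) mu delta p.
Local Notation nu0 := (information mu delta p).

Let Hm : is_initial_degrees m. Proof. by case: HPA. Qed.
Let mg w := @degs_gt0 _ _ _ _ _ _ _ HPA w.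
Let xl w := @choices_lt _ _ _ _ _ _ _ HPA w.
Let b_gt0 : 0 < 1 + delta. Proof. by move: d1; lra. Qed.
Let b : R := (1 + delta)^-1.
Let b0 : 0 <= b. Proof. by rewrite invr_ge0 ltW. Qed.
Let s20 : 0 <= s2. Proof. exact: second_moment_ge0. Qed.

(** The weight cancels [invd], so that the compensator of the score is exactly [t / S], without any
    estimate. *)
Lemma dsum_invd_weight (e : R) t i w : (2 <= t)%N ->
  dsum (fun k => e * invd k * (k%:R + delta)) t i w = e * t%:R.
Proof.
move=> t2; rewrite /dsum /degree_sum.
rewrite (eq_bigr (fun=> e)) ?sumr_const ?card_ord ?mulr_natr// => j _.
by rewrite -mulrA mulVf ?mulr1// gt_eqF// (kdelta_gt0 d1)// (degree_PAstep_gt0 (@mg w) (@xl w)).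
Qed.

Lemma compensated_invd (e : R) t i w : (2 <= t)%N ->
  compensated (fun k => e * invd k) t i w = e * (invd (chosen t i w) - t%:R / weight t i.-1 w).
Proof. by move=> t2; rewrite /compensated dsum_invd_weight// mulrBr mulrA. Qed.

Lemma esum_compensated (e : R) n w :
  esum n (compensated (fun k => e * invd k)) w =
  e * esum n (fun t i w => invd (chosen t i w) - t%:R / weight t i.-1 w) w.
Proof.
rewrite /esum -edge_sumZ; apply: eq_big_nat => t /andP[t2 _].
by apply: eq_bigr => i _; rewrite compensated_invd.
Qed.

(** The factor [n.+1 / sqrt n] cancels the normalization of the score and leaves [1 / sqrt n], which
    is moved into the test function. *)
Lemma DeltaE n w : (1 <= n)%N ->
  Delta n w = esum n (compensated (fun k => (Num.sqrt n%:R)^-1 * invd k)) w.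
Proof.
move=> n1; rewrite /Defs.Delta esum_compensated (scoreE (@mg w) (@xl w))//.
by rewrite [n.+1%:R / _]mulrC -mulrA mulVKf// pnatr_eq0.
Qed.

Lemma measurable_Delta n : measurable_fun setT (Delta n).
Proof.
case: n => [|n].
  rewrite (_ : Delta 0%N = fun=> 0); first exact: measurable_cst.
  by apply/funext => w; rewrite /Defs.Delta sqrtr0 invr0 mulr0 mul0r.
rewrite (_ : Delta n.+1 = esum n.+1 (compensated (fun k => (Num.sqrt n.+1%:R)^-1 * invd k))).
  exact/(measurable_esum d1)/local_compensated.
by apply/funext => w; rewrite DeltaE.
Qed.

Lemma measurable_llr (h : R) n : measurable_fun setT (log_likelihood_ratio m x delta h n).
Proof.
apply: (@determined_measurable _ _ _ _ (hist m x n n.+1 0)); first exact: fibers_hist.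
move=> w w' E; rewrite /log_likelihood_ratio.
have Em s : (1 <= s <= n)%N -> degs w s = degs w' s by exact: (hist_degs E).
have EP : PA (degs w) (choices w) n = PA (degs w') (choices w') n.
  by case: E => _; rewrite !min0n /PAstep !cats0.
by rewrite !(agree_likelihood Em EP).
Qed.

(** [cvar] without the indicator and with edges numbered from 1, to be summed over the true
    edges. *)
Definition edge_variance psi t i w : R :=
  dsum (fun k => psi k ^+ 2 * (k%:R + delta)) t i.-1 w / weight t i.-1 w
  - (dsum (fun k => psi k * (k%:R + delta)) t i.-1 w / weight t i.-1 w) ^+ 2.

Lemma local_edge_variance psi : local_functional m x (edge_variance psi).
Proof. by move=> t i w w' t2 im _ EP _; rewrite /edge_variance /dsum /degree_sum /weight /total_weight EP. Qed.

Lemma edge_variance_norm psi (c : R) t i w : 0 <= c -> (forall k, (0 < k)%N -> `|psi k| <= c) ->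
  (2 <= t)%N -> (1 <= i <= degs w t)%N -> `|edge_variance psi t i w| <= c ^+ 2.
Proof.
move=> c0 psic t2; case: i => // i im.
have im' : (i < degs w t)%N by [].
have cE : cvar m x delta psi t i w = edge_variance psi t i.+1 w by rewrite /cvar /ind im' mul1r.
by rewrite -cE ger0_norm ?(cvar_ge0 d1 HPA)// (cvar_le d1 HPA).
Qed.

Lemma esum_edge_variance n w : (1 <= n)%N ->
  esum n (edge_variance (fun k => (Num.sqrt n%:R)^-1 * invd k)) w =
  n%:R^-1 * esum n (fun t i w => dsum invd t i.-1 w / weight t i.-1 w - sqw t i w) w.
Proof.
move=> n1; rewrite /esum -edge_sumZ; apply: eq_big_nat => t /andP[t2 _].
apply: eq_bigr => i _; rewrite /edge_variance dsum_invd_weight// mulrBr /sqw.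
have E : (Num.sqrt n%:R)^-1 ^+ 2 = n%:R^-1 :> R by rewrite exprVn sqr_sqrtr.
congr (_ - _); last by rewrite -mulrA exprMn E.
rewrite mulrA; congr (_ / _); rewrite /dsum /degree_sum mulr_sumr; apply: eq_bigr => j _.
rewrite exprMn E -mulrA; congr (_ * _); rewrite expr2 -mulrA mulVf ?mulr1// gt_eqF//.
by rewrite (kdelta_gt0 d1)// (degree_PAstep_gt0 (@mg w) (@xl w)).
Qed.

Lemma psi_norm n k : (0 < k)%N -> `|(Num.sqrt n%:R)^-1 * invd k| <= (Num.sqrt n%:R)^-1 * b.
Proof.
move=> k0; rewrite normrM ger0_norm ?invr_ge0 ?sqrtr_ge0// ler_wpM2l ?invr_ge0 ?sqrtr_ge0//.
exact: (invd_norm d1).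
Qed.

Lemma sqrt_inv n : (1 <= n)%N -> n%:R * (Num.sqrt n%:R)^-1 = Num.sqrt n%:R :> R.
Proof.
move=> n1; rewrite -{1}(@sqr_sqrtr R n%:R)// expr2 mulfK// gt_eqF// sqrtr_gt0 ltr0n; exact: n1.
Qed.

(** With [n] slots per vertex and summands of size [1 / sqrt n], the lost edges cost [O(1 / sqrt n)]
    in mean; the factor [n] puts this in the form of [negligible]. *)
Lemma negligible_grid (f : nat -> nat -> nat -> T -> R) (c : R) : 0 <= c ->
  (forall n, local_functional m x (f n)) ->
  (forall n t i w, (1 <= n)%N -> (2 <= t)%N -> (1 <= i <= degs w t)%N -> `|f n t i w| <= (Num.sqrt n%:R)^-1 * c) ->
  negligible P (fun n w => n%:R * (esum n (f n) w - gsum m n n (f n) w)).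
Proof.
move=> c0 lf fc; apply: (@negligible_sqrt _ _ _ _ _ (c * s2)); first exact: mulr_ge0.
move=> n n1; have n0 : n%:R != 0 :> R by rewrite pnatr_eq0; lia.
have c1 : 0 <= (Num.sqrt n%:R)^-1 * c by rewrite mulr_ge0 ?invr_ge0 ?sqrtr_ge0.
have c2 : 0 <= (Num.sqrt n%:R)^-1 * c / n%:R by rewrite divr_ge0.
have [iS ES] := Ex_sum_mr_sqr d1 HPA n c2.
have bnd w := esum_gsum (f := f n) n w n1 c1 (fun t i w => fc n t i w n1).
have iD : L1 (fun w => esum n (f n) w - gsum m n n (f n) w).
  apply: (L1_le _ iS) => [|w]; last exact: bnd.
  apply: measurable_funB; [exact: (measurable_esum d1)|exact: (measurable_gsum d1)].
split; first exact: L1Z.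
under eq_fun do rewrite normrM normr_nat.
rewrite ExZ; last exact: L1_norm.
apply: (@le_trans _ _ (n%:R * ((Num.sqrt n%:R)^-1 * c / n%:R * (n%:R * s2)))).
  rewrite ler_wpM2l//; apply: (le_trans _ ES).
  by apply: Ex_le => [||w]; [exact: L1_norm|exact: iS|exact: bnd].
rewrite le_eqVlt; apply/orP; left; apply/eqP.
by rewrite [RHS]mulrC -[in RHS](sqrt_inv n1); move: (_^-1) => r; field.
Qed.

Let nu_gt0 : 0 < nu0. Proof. exact: (information_gt0 d1 HPA Hp). Qed.

(** The requirements of [martingale_clt] are met on the grid with [B = n]: increments of size
    [2 b / sqrt n], total variance near [nu_0], and [Delta] near the grid martingale. *)
Lemma Delta_cdf (y k : R) : 0 < k -> exists N, forall n, (N <= n)%N ->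
  `|fine (P [set w | Delta n w <= y]) - gauss_cdf (y / Num.sqrt nu0)| <= k.
Proof.
move=> k0; have [eta eta0 H] := martingale_clt P y nu_gt0 k0.
pose psi n j := (Num.sqrt n%:R)^-1 * invd j.
have psiB n t i w : (1 <= n)%N -> (2 <= t)%N -> (1 <= i <= degs w t)%N ->
    `|compensated (psi n) t i w| <= (Num.sqrt n%:R)^-1 * (2 * b).
  by move=> n1 t2 im; rewrite mulrCA; apply: (compensated_norm d1 HPA) => // j; exact: psi_norm.
(* The variance is of size [1 / n]; the weaker [1 / sqrt n] is enough to discard the edges off the
   grid. *)
have varB n t i w : (1 <= n)%N -> (2 <= t)%N -> (1 <= i <= degs w t)%N ->
    `|edge_variance (psi n) t i w| <= (Num.sqrt n%:R)^-1 * (b ^+ 2).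
  move=> n1 t2 im.
  have r1 := @sqrt_nat_ge1 R n n1; have r0 : 0 <= (Num.sqrt n%:R)^-1 :> R by rewrite invr_ge0 sqrtr_ge0.
  apply: (le_trans (edge_variance_norm (mulr_ge0 r0 b0) (@psi_norm n) t2 im)).
  rewrite exprMn ler_wpM2r ?sqr_ge0// expr2 ler_piMr// invf_le1//.
  exact: lt_le_trans r1.
have N1 := negligible_grid (mulr_ge0 (ler0n R 2) b0) (fun n => local_compensated delta (psi n)) psiB.
have N2 := negligible_grid (sqr_ge0 b) (fun n => local_edge_variance (psi n)) varB.
(* This is [n] times the grid variance minus [nu_0]: the truncation error with its sign changed plus
   the error of the full edge sum. *)
have N3 := negligibleD (negligibleZ (-1) N2) (variance_cond d1 HPA Hp).
have [M1 H1] := negligible_prob eta0 N1; have [M3 H3] := negligible_prob eta0 N3.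
have [M4 M41 H4] := eventually_le_sqrt (2 * b / eta).
exists (maxn M4 (maxn M1 M3)) => n; rewrite !geq_max => /and3P[n4 Mn1 Mn3].
have n1 : (1 <= n)%N by exact: leq_trans n4.
have n0 : n%:R != 0 :> R by rewrite pnatr_eq0; lia.
have s0 : 0 < Num.sqrt n%:R :> R by rewrite sqrtr_gt0 ltr0n.
have c0 : 0 <= (Num.sqrt n%:R)^-1 * b by rewrite mulr_ge0 // invr_ge0 sqrtr_ge0.
have gh := grid_history m x d1 n n1; have gm := grid_mart_diff d1 HPA n n1 c0 (@psi_norm n).
have gv := grid_cond_variance d1 HPA n n1 c0 (@psi_norm n).
have {gh gm gv} := H _ _ _ _ _ _ _ gh gm gv (measurable_Delta n); apply.
- have := H4 n n4; rewrite ler_pdivrMr// => h.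
  by rewrite mulrCA mulrC ler_pdivrMr// [leRHS]mulrC.
- have := H3 n Mn3; congr (fine (P _) <= _); apply/funext => w; congr (eta < `|_|).
  have -> : \sum_(j < grid_size n n) cvar m x delta (psi n) (grid_t n j) (grid_i n j) w =
      gsum m n n (edge_variance (psi n)) w.
    exact: (grid_sum n n1 (fun t i => cvar m x delta (psi n) t i w)).
  rewrite esum_edge_variance//; field; exact: n0.
- have := H1 n Mn1; congr (fine (P _) <= _); apply/funext => w; congr (eta < `|_|).
  rewrite DeltaE// mulKf//; congr (_ - _).
  exact: (gsum_compensated m x delta n (psi n) w n1).
Qed.

Theorem Delta_cvg : cvg_in_distribution P Delta (normal_prob 0 (Num.sqrt nu0)).
Proof.
split=> [n|y _]; first exact: measurable_Delta.
have -> : [set u : R | u <= y] = `]-oo, y]%classic by apply/seteqP; split => u /=; rewrite in_itv.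
rewrite normal_prob_Nyc ?sqrtr_gt0//; apply: cvg_prob => [n|k k0]; first exact/measurable_le/measurable_Delta.
exact: Delta_cdf.
Qed.

Section llr.
Variable h : R.

Let quad n := esum n (fun t i w => invd (chosen t i w) ^+ 2 - sqw t i w).

Definition llr_remainder n w : R := log_likelihood_ratio m x delta h n w
  - (h * Delta n w - 2^-1 * h ^+ 2 * (n%:R^-1 * quad n w)).

(** Each edge contributes two logarithms, at [e * invd D] and [e * t / S] with [e = h / sqrt n].
    Both arguments are at most [|e| * b], hence at most 1/2 here, and [delta + e] stays above -1.
    The constant 4 is twice that of [ln1D_taylor], and [m_t <= m_t^2] again. *)
Lemma llr_remainder_le n w : (1 <= n)%N -> 2 * (`|h| * b) <= Num.sqrt n%:R ->
  `|llr_remainder n w| <= \sum_(2 <= t < n.+1) 4 * (`|h| / Num.sqrt n%:R * b) ^+ 3 * mr m t w ^+ 2.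
Proof.
move=> n1 hb; have s0 : 0 < Num.sqrt n%:R :> R by rewrite sqrtr_gt0 ltr0n.
pose e := h / Num.sqrt n%:R.
have eN : `|e| = `|h| / Num.sqrt n%:R by rewrite normrM normfV (gtr0_norm s0).
have eb : `|e| * b <= 2^-1.
  by rewrite eN mulrAC ler_pdivrMr// ler_pdivlMl.
have de : -1 < delta + e.
  have : `|e| <= 2^-1 * (1 + delta) by rewrite -ler_pdivrMr.
  by move: (ler_norm (- e)); rewrite normrN; move: b_gt0; lra.
have e2 : e ^+ 2 = h ^+ 2 * n%:R^-1 by rewrite /e expr_div_n sqr_sqrtr.
have eD : h * Delta n w = esum n (fun t i w => e * invd (chosen t i w) - e * (t%:R / weight t i.-1 w)) w.
  rewrite DeltaE// esum_compensated mulrA -/e /esum -edge_sumZ.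
  by apply: eq_bigr => t _; apply: eq_bigr => i _; rewrite mulrBr.
have eQ : 2^-1 * h ^+ 2 * (n%:R^-1 * quad n w) =
    esum n (fun t i w => (e * invd (chosen t i w)) ^+ 2 / 2 - (e * (t%:R / weight t i.-1 w)) ^+ 2 / 2) w.
  rewrite mulrA -(mulrA 2^-1) -e2 /quad /esum -edge_sumZ.
  by apply: eq_bigr => t _; apply: eq_bigr => i _; rewrite /sqw; move: (t%:R / _) (invd _) => u v; field.
have rE : llr_remainder n w = esum n (fun t i w =>
    (ln (1 + e * invd (chosen t i w)) - e * invd (chosen t i w) + (e * invd (chosen t i w)) ^+ 2 / 2)
    - (ln (1 + e * (t%:R / weight t i.-1 w)) - e * (t%:R / weight t i.-1 w) + (e * (t%:R / weight t i.-1 w)) ^+ 2 / 2)) w.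
  rewrite /llr_remainder eD eQ /log_likelihood_ratio.
  have := log_likelihood_ratioE (@mg w) (@xl w) n d1 de.
  rewrite [delta + e - delta](_ : _ = e) => [->|]; last by ring.
  rewrite /esum -!edge_sumB; apply: eq_bigr => t _; apply: eq_bigr => i _.
  by rewrite /invd /chosen /weight; ring.
have rn t i w' : (2 <= t)%N -> (1 <= i <= degs w' t)%N -> forall u, `|u| <= b ->
    `|ln (1 + e * u) - e * u + (e * u) ^+ 2 / 2| <= 2 * (`|e| * b) ^+ 3.
  move=> t2 im u ub; have eub : `|e * u| <= `|e| * b by rewrite normrM ler_wpM2l.
  apply: (le_trans (ln1D_taylor (le_trans eub eb))).
  by rewrite ler_wpM2l// lerXn2r ?nnegrE ?mulr_ge0.
rewrite rE -eN; set f := (fun t i w => _ - _).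
have fn t i w' : (2 <= t)%N -> (1 <= i <= degs w' t)%N -> `|f t i w'| <= 4 * (`|e| * b) ^+ 3.
  move=> t2 im; rewrite /f (le_trans (ler_normB _ _))//.
  rewrite (_ : 4 * _ = 2 * (`|e| * b) ^+ 3 + 2 * (`|e| * b) ^+ 3); last by ring.
  apply: lerD; apply: (rn t i w' t2 im).
    apply: (invd_norm d1); case: (i) im => // i' im'; exact: (chosen_gt0 HPA).
  have im' : (i.-1 <= degs w' t)%N by lia.
  by have /andP[u0 ub] := weight_inv_le d1 HPA t2 im'; rewrite ger0_norm.
apply: (le_trans (esum_norm n w fn)); apply: ler_sum_nat => t /andP[t2 _].
rewrite ler_wpM2l ?(mr_le_sqr Hm)//; last exact: ltnW.
by rewrite mulr_ge0// exprn_ge0// mulr_ge0.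
Qed.

(** The remainder is of order [1 / sqrt n] in mean, being a sum of order [n] cubes of size
    [n^(-3/2)]; [variance_chosen] then replaces the observed quadratic variation by [nu_0]. *)
Theorem llr_cvg : cvg_in_probability P (fun n w => log_likelihood_ratio m x delta h n w
  - (h * Delta n w - 2^-1 * h ^+ 2 * nu0)) 0.
Proof.
have [N N1 HN] := eventually_le_sqrt (2 * (`|h| * b)).
(* The Taylor bound holds only from [N] on; [Z] is set to 0 before, which does not affect the
   limit. *)
pose Z n w := if (N <= n)%N then n%:R * llr_remainder n w else 0.
have mq n : measurable_fun setT (quad n).
  apply: (measurable_esum (x := x) d1) => t i w w' t2 im _ EP Ec.
  by rewrite /sqw /weight /total_weight EP /chosen /chosen_degree EP Ec.
have mr n : measurable_fun setT (llr_remainder n).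
  apply: measurable_funB; first exact: measurable_llr.
  apply: measurable_funB; apply: measurable_funM => //; first exact: measurable_Delta.
  exact: measurable_funM.
have nZ : negligible P Z.
  have K0 : 0 <= 4 * (`|h| * b) ^+ 3 * s2 by rewrite mulr_ge0// mulr_ge0// exprn_ge0// mulr_ge0.
  apply: (negligible_sqrt K0) => n n1; rewrite /Z; case: leqP => Nn; last first.
    split; first exact: L1_cst.
    by under eq_fun do rewrite normr0; rewrite Ex_cst mulr_ge0// sqrtr_ge0.
  have s0 : 0 < Num.sqrt n%:R :> R by rewrite sqrtr_gt0 ltr0n.
  have c0 : 0 <= 4 * (`|h| / Num.sqrt n%:R * b) ^+ 3.
    by rewrite mulr_ge0// exprn_ge0// mulr_ge0// divr_ge0// ltW.
  have [iS ES] := Ex_sum_mr_sqr d1 HPA n c0.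
  have bnd w := llr_remainder_le w n1 (HN n Nn).
  have iR : L1 (llr_remainder n) by apply: (L1_le (mr n) iS).
  split; first exact: L1Z.
  under eq_fun do rewrite normrM normr_nat.
  rewrite ExZ; last exact: L1_norm.
  apply: (@le_trans _ _ (n%:R * (4 * (`|h| / Num.sqrt n%:R * b) ^+ 3 * (n%:R * s2)))).
    by rewrite ler_wpM2l// (le_trans _ ES)//; apply: Ex_le => //; exact: L1_norm.
  rewrite le_eqVlt; apply/orP; left; apply/eqP.
  have := @sqr_sqrtr R n%:R (ler0n R n); move: (Num.sqrt n%:R) s0 => r r0 <-.
  by field; rewrite gt_eqF.
have N2 := negligibleD nZ (negligibleZ (- (2^-1 * h ^+ 2)) (variance_chosen d1 HPA Hp)).
apply: (@negligible_cvg _ _ _ _ _ _ N N2) => [n|n w Nn].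
  apply: measurable_funB; first exact: measurable_llr.
  by apply: measurable_funB => //; apply: measurable_funM => //; exact: measurable_Delta.
have n0 : n%:R != 0 :> R by rewrite pnatr_eq0; move: (leq_trans N1 Nn); lia.
rewrite /Z Nn /llr_remainder -/(quad n w); field; exact: n0.
Qed.

End llr.
End main.

Theorem mainTheorem4 (R : realType) (d : measure_display)
    (T : measurableType d) (P : probability T R)
    (m : nat -> {RV P >-> nat}) (x : nat -> nat -> {RV P >-> nat})
    (delta0 h : R) (p : nat -> R) :
  -1 < delta0 ->
  is_preferential_attachment delta0 m x ->
  is_limit_degree_law (degree_prob m) (degree_mean m) delta0 p ->
  let nu0 := information (degree_mean m) delta0 p in
  cvg_in_probability P
    (fun n w => log_likelihood_ratio m x delta0 h n w
                - (h * Delta m x delta0 n w - 2^-1 * h ^+ 2 * nu0)) 0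
  /\ cvg_in_distribution P (Delta m x delta0) (normal_prob 0 (Num.sqrt nu0)).
Proof.
by move=> d1 HPA Hp nu0; split; [exact: llr_cvg|exact: Delta_cvg].
Qed.
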